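(* Let $q$ be real-valued, $q\in L^\infty[0,1]$, $q(x)=0$ for $x>1$, let $K(x,y)$ be its transformation kernel, and let $h=\binom fg$ be computed from the Cauchy data $\{K(1,y),K_x(1,y)\}_{0\le y\le1}$ by the formulas in the context. Let $\|h\|\le R$, choose any $\widetilde R>R$, and put $$\mu:=\min\left(\frac{8(\widetilde R-R)}{5\widetilde R^2},\ \frac2{5\widetilde R}\right).$$ Then for any $x_0\in(1-\mu,1)$ the iterative process $$U_{n+1}=W(U_n)+h,\qquad U_0=h,$$ converges in $L(x_0)$ at the rate of a geometric progression, and $$\lim_{n\to\infty}U_n=\binom{q(x)}{K(x,y)},\qquad (x,y)\in\Delta_{x_0}.$$ If one starts with the data $\{K(x_0,y),K_x(x_0,y)\}_{0\le|y|\le x_0}$ and replaces $h$ in the iterative process by $h_0=\binom{f_0}{g_0}$, where $f_0,g_0$ are calculated by the formulas for $f,g$ in which the first argument $x=1$ of $K(1,y)$ is replaced by $x=x_0$, then the iterative process with the new $h=h_0$, in the new space $L(x_1):=L^\infty(x_1,x_0)\times L^\infty(\Delta_{x_1})$ with $\Delta_{x_1}=\{(x,y):x_1\le x\le x_0,\ 0\le|y|\le x\}$, converges to $\binom{q(x)}{K(x,y)}$ in $L(x_1)$. In a finite number of steps one can uniquely reconstruct $q(x)$ on $[0,1]$ from the data $\{K(1,y),K_x(1,y)\}_{0\le y\le1}$ using this iterative process.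
   Context: $K(x,y)$ is the kernel for which $u(x,k)=\frac{\sin kx}k+\int_0^xK(x,y)\frac{\sin ky}k\,dy$ solves $u''+k^2u-q(x)u=0$, $u(0,k)=0$, $u'(0,k)=1$. It satisfies $K_{xx}-q(x)K=K_{yy}$ for $0\le y\le x$, $K(x,x)=\frac12\int_0^xq(t)\,dt$, $K(x,0)=0$, and is extended to $-x\le y\le0$ by $K(x,-y)=-K(x,y)$. For $x_0\in(0,1)$: $L(x_0):=L^\infty(x_0,1)\times L^\infty(\Delta_{x_0})$, $\Delta_{x_0}:=\{(x,y):x_0\le x\le1,\ 0\le|y|\le x\}$. For $U=\binom{q(x)}{K(x,y)}$, $\|U\|:=\operatorname{ess\,sup}_{x_0\le x\le1}|q(x)|+\sup_{(x,y)\in\Delta_{x_0}}|K(x,y)|$; the norm of $h=\binom fg$ is defined in the same way, with $f,g$ in place of $q,K$. The nonlinear map is $$W(U):=\begin{pmatrix}-2\int_x^1q(s)K(s,2x-s)\,ds\\[2pt]\frac12\int_{D_{xy}}q(s)K(s,t)\,ds\,dt\end{pmatrix},$$ where $D_{xy}$ is the region in the $(s,t)$-plane bounded by the lines $s=1$, $t-y=s-x$, $t-y=-(s-x)$. The free term $h=\binom fg$ is $$f(x):=2[K_y(1,2x-1)+K_x(1,2x-1)],$$ $$g(x,y):=\frac{K(1,y+x-1)+K(1,y-x+1)}2-\frac12\int_{y+x-1}^{y-x+1}K_s(1,t)\,dt,$$ where $K_x$ and $K_s$ denote the derivative in the first argument and $K_y$ the derivative in the second. When the process is carried out from $x_0$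 instead of $1$, the number $1$ is correspondingly replaced by $x_0$ in $f$, $g$, $W$, $D_{xy}$ and the norm. *)

(* Defs.v *)
From HB Require Import structures.
From mathcomp Require Import all_boot all_order all_algebra.
From mathcomp Require Import all_classical all_reals all_analysis ess_sup_inf.

Set Implicit Arguments.
Unset Strict Implicit.
Unset Printing Implicit Defensive.

Import Order.TTheory GRing.Theory Num.Theory.
Import numFieldNormedType.Exports.

Local Open Scope classical_set_scope.
Local Open Scope ring_scope.

(* Functions on intervals, triangles and sectors are total functions; only
   their values on the indicated set matter.  Elements of L^oo are represented
   by Borel functions. *)

Section potential.
Variable R : realType.
Implicit Types (q u : R -> R) (K phi : R -> R -> R).

Definition mu2 := ((@lebesgue_measure R) \x (@lebesgue_measure R))%E.

(* Essential supremum of |f| over A. *)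
Definition ess_norm (A : set R) (f : R -> R) : \bar R :=
  ess_sup (@lebesgue_measure R) (fun x => (\1_A x * `|f x|)%:E).

Definition admissible_potential q : Prop :=
  [/\ measurable_fun `[(0 : R), 1] q,
      (ess_norm `[0%R, 1%R] q < +oo)%E
    & forall x : R, 1 < x -> q x = 0].

Definition dx phi : R -> R -> R := fun x y => derive1 (phi^~ y) x.
Definition dy phi : R -> R -> R := fun x y => derive1 (phi x) y.

Fixpoint class_C n phi : Prop :=
  continuous (fun p : R * R => phi p.1 p.2) /\
  match n with
  | 0 => True
  | m.+1 => [/\ forall x y : R, derivable (phi^~ y) x 1,
                forall x y : R, derivable (phi x) y 1,
                class_C m (dx phi)
              & class_C m (dy phi)]
  end.

Definition test_function (O : set (R * R)) phi : Prop :=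
  class_C 2 phi /\
  exists2 A : set (R * R), compact A /\ A `<=` O &
    forall x y, ~ A (x, y) -> phi x y = 0.

Definition open_sector : set (R * R) := [set p | 0 < p.2 < p.1].
Definition closed_sector : set (R * R) := [set p | 0 <= p.2 <= p.1].

(* K_xx - q K = K_yy in the weak sense: for bounded q the kernel is in general
   only Lipschitz, so that K_xx and K_yy need not be functions. *)
Definition weak_wave_equation q K : Prop :=
  forall phi, test_function open_sector phi ->
  \int[mu2]_(p in open_sector)
     (K p.1 p.2 * (dx (dx phi) p.1 p.2 - dy (dy phi) p.1 p.2)
      - q p.1 * K p.1 p.2 * phi p.1 p.2) = 0.

(* u'' + k^2 u - q u = 0 on the half-line, u(0) = 0, u'(0) = 1.  For bounded q
   this means: u' is locally Lipschitz and the equation holds almost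
   everywhere; u'(0) is a one-sided derivative. *)
Definition solves_ivp q (k : R) u : Prop :=
  [/\ u 0 = 0,
      (fun h : R => h^-1 * (u h - u 0)) @ 0^'+ --> (1 : R),
      forall x : R, 0 < x -> derivable u x 1,
      forall b : R, 0 < b -> exists C : R, C.-lipschitz_(`]0, b[) (derive1 u)
    & {ae (@lebesgue_measure R), forall x : R, 0 < x ->
        derivable (derive1 u) x 1 /\
        derive1 (derive1 u) x + k ^+ 2 * u x - q x * u x = 0}].

Record transformation_kernel q K : Prop := TransformationKernel {
  tk_continuous :
    {within closed_sector, continuous (fun p : R * R => K p.1 p.2)} ;
  tk_transform : forall k : R, k != 0 ->
    solves_ivp q k (fun x => sin (k * x) / k +
      \int[lebesgue_measure]_(y in `[0, x]) (K x y * (sin (k * y) / k))) ;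
  tk_wave : weak_wave_equation q K ;
  tk_diag : forall x : R, 0 <= x ->
    K x x = 2^-1 * \int[lebesgue_measure]_(t in `[0, x]) q t ;
  tk_zero : forall x : R, 0 <= x -> K x 0 = 0 ;
  tk_odd : forall x y : R, 0 <= y <= x -> K x (- y) = - K x y
}.

End potential.

Section process.
Variable R : realType.

(* A pair (q, K). *)
Definition state : Type := ((R -> R) * (R -> R -> R))%type.

(* Cauchy data (K(a, .), K_x(a, .)) on the line x = a.  For bounded q the
   derivative K_x(a, y) exists for almost every y in (- a, a); elsewhere the
   value of derive1 or lim is irrelevant, as the data only enter through f
   (up to null sets) and through integrals. *)
Definition data : Type := ((R -> R) * (R -> R))%type.

Implicit Types (a b : R) (d : data) (U V : state) (q : R -> R)
  (K : R -> R -> R).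

Definition state_add U V : state :=
  (fun x => U.1 x + V.1 x, fun x y => U.2 x y + V.2 x y).

Definition state_sub U V : state :=
  (fun x => U.1 x - V.1 x, fun x y => U.2 x y - V.2 x y).

Definition Delta b a : set (R * R) :=
  [set p | b <= p.1 <= a /\ `|p.2| <= p.1].

Definition L_norm b a U : \bar R :=
  (ess_norm `[b, a] U.1 +
   ereal_sup [set `|U.2 p.1 p.2|%:E | p in Delta b a])%E.

(* U is in L^oo(b, a) x L^oo(Delta b a). *)
Definition in_L b a U : Prop :=
  [/\ measurable_fun `]b, a[ U.1,
      measurable_fun (Delta b a) (fun p : R * R => U.2 p.1 p.2)
    & (L_norm b a U < +oo)%E].

Definition cauchy_data K a : data := (K a, fun y => derive1 (K^~ y) a).

(* The same data computed from the values of K for x >= a only. *)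
Definition right_cauchy_data K a : data :=
  (K a, fun y => lim ((fun h : R => h^-1 * (K (a + h) y - K a y)) @ 0^'+)).

Definition free_term a d : state :=
  (fun x => 2 * (derive1 d.1 (2 * x - a) + d.2 (2 * x - a)),
   fun x y => (d.1 (y + x - a) + d.1 (y - x + a)) / 2
     - 2^-1 * \int[lebesgue_measure]_(t in `[y + x - a, y - x + a]) d.2 t).

Definition D_region a x y : set (R * R) :=
  [set p | x <= p.1 <= a /\ `|p.2 - y| <= p.1 - x].

Definition W a U : state :=
  (fun x => - 2 * \int[lebesgue_measure]_(s in `[x, a])
                    (U.1 s * U.2 s (2 * x - s)),
   fun x y => 2^-1 * \int[@mu2 R]_(p in D_region a x y)
                       (U.1 p.1 * U.2 p.1 p.2)).

Fixpoint iterates a d n : state :=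
  match n with
  | 0 => free_term a d
  | m.+1 => state_add (W a (iterates a d m)) (free_term a d)
  end.

Definition converges_in_L b a (u : nat -> state) V : Prop :=
  [/\ forall n, in_L b a (u n),
      in_L b a V
    & (fun n => L_norm b a (state_sub (u n) V)) @ \oo --> 0%E].

Definition geometric_rate_in_L b a (u : nat -> state) V : Prop :=
  exists C rho : R, 0 <= rho < 1 /\
    forall n, (L_norm b a (state_sub (u n) V) <= (C * rho ^+ n)%:E)%E.

Definition mu_step (r rt : R) : R :=
  Num.min (8 * (rt - r) / (5 * rt ^+ 2)) (2 / (5 * rt)).

(* b is a point to which the process with data d on the line x = a may be
   carried: a - b is smaller than the step bound mu for some r >= ||h||. *)
Definition admissible_step a b d : Prop :=
  exists r rt : R, [/\ (L_norm b a (free_term a d) <= r%:E)%E, r < rt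
                     & a - mu_step r rt < b < a].

(* The data on the j-th line: the given d0 for j = 0, afterwards read off
   from the limit V (j - 1) of the process of the preceding step. *)
Definition step_data d0 (x : nat -> R) (V : nat -> state) (j : nat) : data :=
  match j with
  | 0 => d0
  | i.+1 => right_cauchy_data (V i).2 (x j)
  end.

(* Starting from the data d0 on the line x = 1, finitely many admissible steps
   1 = x_0 > x_1 > ... > x_m = 0 of the process produce q on [0, 1]. *)
Definition reconstructs d0 q : Prop :=
  exists (m : nat) (x : nat -> R) (V : nat -> state),
  [/\ x 0%N = 1, x m = 0 &
    forall j, (j < m)%N ->
      let d := step_data d0 x V j in
      [/\ admissible_step (x j) (x j.+1) d,
          converges_in_L (x j.+1) (x j) (iterates (x j) d) (V j)
        & {ae (@lebesgue_measure R), forall t : R, x j.+1 <= t <= x j ->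
             (V j).1 t = q t}]].

End process.

(* Main.v *)
(* Testing the wave equation against tensor products of splines in the
   characteristic coordinates x + y and x - y, and letting the splines tend to
   indicator functions, gives 2 K(x, y) as a difference of primitives of q plus
   the integral of qK over a characteristic rectangle.  Since qK is odd in y, the
   rectangle may be traded for the backward cone D_xy, or for the forward cone
   beyond the line x = a; on that line both cones are of second order, so
   Lebesgue differentiation yields K_x and K_y at almost every point of it.
   Eliminating the primitives shows that (q, K) is a fixed point of U -> W U + h.

   W is quadratic with |W U| <= (5/2) (a - b) |q| |K|, and |q| |K| <= rt^2 / 4 in
   the ball of radius rt; the choice of mu therefore keeps the iterates in that
   ball.  On bounded sets W is of Volterra type and contracts by 1/2 in the norm
   weighted by exp(l (a - x)), l large.  As (q, K) is already known to be a fixed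
   point, this gives geometric convergence, and also uniqueness without any
   restriction on the step.  The size of h on later lines is bounded by the sup
   norms of q and K, so equal steps reach 0. *)

Require Import Defs.
From HB Require Import structures.
From mathcomp Require Import all_boot all_order all_algebra.
From mathcomp Require Import all_classical all_reals all_analysis ess_sup_inf.
From mathcomp Require Import measurable_realfun lebesgue_integral_differentiation.
From mathcomp Require Import lra ring.
Import Order.TTheory GRing.Theory Num.Theory.
Import numFieldNormedType.Exports.
Local Open Scope classical_set_scope.
Local Open Scope ring_scope.
Set Implicit Arguments.
Unset Strict Implicit.
Unset Printing Implicit Defensive.

(** * Integrals of bounded functions with bounded support *)

(** The obstacle is to identify K_x and K_y on the line x = a when q is only bounded. The integral
    over the characteristic rectangle depends on x + y and x - y jointly, so Lebesgue
    differentiation, a statement about functions of one variable, does not apply to it directly.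
    Oddness removes this: the strip swept out by the characteristics x + y = r up to the line x = a
    has an integral that is a function of x + y minus the same function of x - y, and rectangle and
    strip differ by a cone with vertex (x, y) and by regions symmetric in y, which do not count.
    Near the line K is therefore, up to second order, d'Alembert's solution with a single profile
    [Gk a], the same on both sides of the line. The derivatives of K are read off from the density
    [gam a] of this profile, and the second component of the free term is d'Alembert's formula for
    it. Since K_x(1, y) is a two-sided derivative, the kernel has to be controlled beyond x = 1, and
    it is followed up to x = 2. *)

Section bounded_support.
Variable R : realType.
Notation mu := (@lebesgue_measure R).
Notation mu2 := (@mu2 R).
Local Notation TR := (measurableTypeR R).
Local Notation TR2 := (measurableTypeR R * measurableTypeR R)%type.

Lemma bounded_integrable d (T : measurableType d) (m : {measure set T -> \bar R})
    (B : set T) (C : R) (f : T -> R) :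
  measurable B -> (m B < +oo)%E -> measurable_fun setT f ->
  (forall x, `|f x| <= C * \1_B x) -> m.-integrable setT (EFin \o f).
Proof.
move=> mB fB mf fC.
apply: (@le_integrable _ _ _ _ _ measurableT _ (EFin \o (fun x => C * \1_B x))) => //.
- exact/measurable_EFinP.
- by move=> x _ /=; rewrite lee_fin (le_trans (fC x))// ler_norm.
- have -> : EFin \o (fun x => C * \1_B x) = (fun x => C%:E * (\1_B x)%:E)%E.
    by apply/funext => x /=; rewrite EFinM.
  apply: integrableZl => //; apply/integrableP; split; first exact/measurable_EFinP.
  rewrite (eq_integral (fun x => (\1_B x)%:E)); last first.
    by move=> t _; rewrite gee0_abs// lee_fin.
  by rewrite integral_indic// setIT.
Qed.

(** Bounded Borel functions with bounded support are integrable, and the class is stable under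
    affine substitutions, sections and partial integrals. Integrals over regions are therefore
    written over the whole space with a 0-1 factor, so that integrability follows from the shape of
    the integrand. *)
Definition bs1 (f : R -> R) := measurable_fun [set: TR] (f : TR -> R) /\
  exists C M : R, forall x, `|f x| <= C /\ (~~ (`|x| <= M) -> f x = 0).

Definition bs2 (f : R * R -> R) := measurable_fun [set: TR2] (f : TR2 -> R) /\
  exists C M : R, forall p, `|f p| <= C /\ (~~ ((`|p.1| <= M) && (`|p.2| <= M)) -> f p = 0).

Lemma lebesgue_itv_fin (M : R) : (mu `[(- M)%R, M]%classic < +oo)%E.
Proof. by rewrite lebesgue_measure_itv/=; case: ifP => _; rewrite ?ltry. Qed.

Lemma bs1_integrable f : bs1 f -> mu.-integrable setT (EFin \o f).
Proof.
move=> [mf [C [M H]]].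
apply: (@bounded_integrable _ TR mu `[(- M)%R, M]%classic C) => //.
- exact: lebesgue_itv_fin.
- move=> x; have [fC f0] := H x; have C0 : 0 <= C by exact: le_trans fC.
  rewrite indicE; have [xM|/f0 ->] := boolP (`|x| <= M).
    by rewrite mem_set ?mulr1//= in_itv/= -ler_norml.
  by rewrite normr0 mulr_ge0.
Qed.

Lemma mu2_box_fin (M : R) : (mu2 (`[(- M)%R, M]%classic `*` `[(- M)%R, M]%classic) < +oo)%E.
Proof.
rewrite /Defs.mu2 product_measure1E; [|exact: (@measurable_itv R)..].
rewrite lte_mul_pinfty//.
  by rewrite ge0_fin_numE//; exact: lebesgue_itv_fin.
exact: lebesgue_itv_fin.
Qed.

Lemma bs2_integrable f : bs2 f -> mu2.-integrable setT (EFin \o f).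
Proof.
move=> [mf [C [M H]]].
apply: (@bounded_integrable _ TR2 mu2 (`[(- M)%R, M]%classic `*` `[(- M)%R, M]%classic) C) => //.
- by apply: measurableX; exact: (@measurable_itv R).
- exact: mu2_box_fin.
- move=> x; have [fC f0] := H x; have C0 : 0 <= C by exact: le_trans fC.
  rewrite indicE; have [/andP[x1 x2]|/f0 ->] := boolP ((`|x.1| <= M) && (`|x.2| <= M)).
    by rewrite mem_set ?mulr1//= !in_itv/= -!ler_norml x1 x2.
  by rewrite normr0 mulr_ge0.
Qed.

Lemma measurable_affine (c d : R) : measurable_fun [set: TR] ((fun x => c * x + d) : TR -> TR).
Proof.
apply: measurable_funD; last exact: measurable_cst.
apply: measurable_funM; [exact: measurable_cst|exact: measurable_id].
Qed.

(** The image of Lebesgue measure under the affine map, multiplied by c, gives every half-open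
    interval its length, and this determines Lebesgue measure. *)
Lemma affine_lebesgue (c d : R) : 0 < c -> forall A : set TR, measurable A ->
  mu A = (c%:E * mu ((fun x => (c * x + d)%R) @^-1` A))%E.
Proof.
move=> c0 A mA.
have c0' : 0 <= c by exact: ltW.
pose m := measure_function_pushforward__canonical__measure_function_Measure mu (measurable_affine c d).
pose m' := (mscale (NngNum c0') m).
rewrite (@lebesgue_measure_unique _ m' _ A)//.
move=> X [[u v] _ <-] /=.
rewrite /m' /m /mscale /= /pushforward.
have -> : (fun x : TR => (c * x + d)%R) @^-1` [set` `]u, v]] = [set` `](u - d) / c, (v - d) / c]].
  apply/seteqP; split => x /=; rewrite !in_itv/= ltr_pdivrMr// ler_pdivlMr// (mulrC x); lra.
rewrite !lebesgue_measure_itv/= !lte_fin ltr_pM2r ?invr_gt0// ltrD2r.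
case: ifP => _; last by rewrite mule0.
by rewrite -EFinB -EFinM; congr EFin; field; rewrite gt_eqF.
Qed.

Lemma measurable_oppR : measurable_fun [set: TR] (-%R : TR -> TR).
Proof. exact: (@oppr_measurable R). Qed.

Lemma opp_lebesgue (A : set TR) : measurable A -> mu A = mu (-%R @^-1` A).
Proof.
move=> mA.
pose m := measure_function_pushforward__canonical__measure_function_Measure mu measurable_oppR.
rewrite (@lebesgue_measure_unique _ m _ A)//.
move=> X [[u v] _ <-] /=.
rewrite /m /= /pushforward.
have -> : (-%R : TR -> TR) @^-1` [set` `]u, v]] = [set` `[ - v, - u[].
  apply/seteqP; split => x /=; rewrite !in_itv/=; lra.
rewrite !lebesgue_measure_itv/= !lte_fin ltrN2.
by case: ifP => // _; rewrite -!EFinB opprK addrC.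
Qed.

Lemma bs1_affine (c d : R) f : c != 0 -> bs1 f -> bs1 (fun x => f (c * x + d)).
Proof.
move=> c0 [mf [C [M H]]]; split.
  by apply: measurableT_comp mf _; exact: measurable_affine.
exists C, ((`|M| + `|d|) / `|c|) => x; have [h1 h2] := H (c * x + d); split => // xM.
apply: h2; apply: contra xM => xM.
rewrite ler_pdivlMr ?normr_gt0// mulrC -normrM.
have -> : c * x = c * x + d - d by ring.
rewrite (le_trans (ler_normB _ _))// lerD2r (le_trans xM)// ler_norm//.
Qed.

Lemma int_affine (c d : R) f : 0 < c -> bs1 f ->
  \int[mu]_x f x = c * \int[mu]_x f (c * x + d).
Proof.
move=> c0 bf; have c0' : 0 <= c by exact: ltW.
have [mf _] := bf.
have bf' := bs1_affine d (lt0r_neq0 c0) bf.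
pose m := measure_function_pushforward__canonical__measure_function_Measure mu (measurable_affine c d).
have mfE : measurable_fun [set: TR] (EFin \o f : TR -> \bar R) by exact/measurable_EFinP.
have key (g : TR -> \bar R) : measurable_fun setT g -> (forall x, 0 <= g x)%E ->
    (\int[mu]_x g x = c%:E * \int[mu]_x g (c * x + d)%R)%E.
  move=> mg g0; rewrite (@eq_measure_integral _ TR _ setT (mscale (NngNum c0') m)); last first.
    by move=> A mA _; exact: (affine_lebesgue d c0 mA).
  rewrite ge0_integral_mscale//; congr (_ * _)%E.
  by rewrite (@ge0_integral_pushforward _ _ _ _ _ _ (measurable_affine c d)).
pose fa x := (f (c * x + d))%:E.
(* The factor c distributes over the difference of the two parts only if that difference is not oo -
   oo. *)
have fin : (\int[mu]_x fa^\+ x)%E \is a fin_num.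
  exact: integrable_fin_num (integrable_funepos measurableT (bs1_integrable bf')).
have E : (\int[mu]_x (f x)%:E = c%:E * \int[mu]_x fa x)%E.
  rewrite [LHS]integralE [X in (_ = _ * X)%E]integralE.
  rewrite [X in (X - _)%E](_ : _ = c%:E * \int[mu]_x fa^\+ x)%E; last first.
    apply: (etrans (key _ (measurable_funepos mfE) _)).
      move=> x; exact: funepos_ge0.
    by congr (_ * _)%E; apply: eq_integral => x _; rewrite !funeposE.
  rewrite [X in (_ - X)%E](_ : _ = c%:E * \int[mu]_x fa^\- x)%E; last first.
    apply: (etrans (key _ (measurable_funeneg mfE) _)).
      move=> x; exact: funeneg_ge0.
    by congr (_ * _)%E; apply: eq_integral => x _; rewrite !funenegE.
  by move: fin; move: (\int[mu]_x _)%E (\int[mu]_x _)%E => x y xf; rewrite muleBr// fin_num_adde_defr.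
rewrite /Rintegral E fineM//; exact: integrable_fin_num (bs1_integrable bf').
Qed.

Lemma bs1_opp f : bs1 f -> bs1 (fun x => f (- x)).
Proof.
move=> bf; have := @bs1_affine (-1) 0 f (ltr0_neq0 (ltrN10 _)) bf.
by under [X in bs1 X]eq_fun do rewrite mulN1r addr0.
Qed.

Lemma int_opp f : bs1 f -> \int[mu]_x f x = \int[mu]_x f (- x).
Proof.
move=> bf; have [mf _] := bf.
have bf' := bs1_opp bf.
pose m := measure_function_pushforward__canonical__measure_function_Measure mu (measurable_oppR).
have mfE : measurable_fun [set: TR] (EFin \o f : TR -> \bar R) by exact/measurable_EFinP.
rewrite /Rintegral; congr fine.
rewrite (@eq_measure_integral _ TR _ setT m); last first.
  by move=> A mA _; exact: (opp_lebesgue mA).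
rewrite integral_pushforward//=; exact: (bs1_integrable bf').
Qed.
End bounded_support.

Section algebra.
Variable R : realType.
Notation mu := (@lebesgue_measure R).
Notation mu2 := (@mu2 R).
Local Notation TR := (measurableTypeR R).
Local Notation TR2 := (measurableTypeR R * measurableTypeR R)%type.
Implicit Types (f g : R -> R) (F G : R * R -> R).

Lemma aeS (P Q : R -> Prop) : {ae mu, forall x, P x} -> (forall x, P x -> Q x) ->
  {ae mu, forall x, Q x}.
Proof. by move=> hP PQ; apply: (@filterS _ _ (ae_filter_ringOfSetsType mu)) hP. Qed.

Lemma aeS2 (P Q S : R -> Prop) : {ae mu, forall x, P x} -> {ae mu, forall x, Q x} ->
  (forall x, P x -> Q x -> S x) -> {ae mu, forall x, S x}.
Proof. by move=> hP hQ PQ; apply: (@filterS2 _ _ (ae_filter_ringOfSetsType mu)) hP hQ. Qed.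

Lemma bs1_add f g : bs1 f -> bs1 g -> bs1 (fun x => f x + g x).
Proof.
move=> [mf [C [M H]]] [mg [C' [M' H']]]; split; first exact: measurable_funD.
exists (C + C'), (Num.max M M') => x; have [h1 h2] := H x; have [h1' h2'] := H' x; split.
  by rewrite (le_trans (ler_normD _ _))// lerD.
by rewrite le_max negb_or => /andP[/h2 -> /h2' ->]; rewrite addr0.
Qed.

Lemma bs1_mul f g (C : R) : measurable_fun [set: TR] (f : TR -> R) ->
  (forall x, `|f x| <= C) -> bs1 g -> bs1 (fun x => f x * g x).
Proof.
move=> mf fC [mg [C' [M' H']]]; split; first exact: measurable_funM.
exists (C * C'), M' => x; have [h1 h2] := H' x; split.
  by rewrite normrM ler_pM.
by move/h2 => ->; rewrite mulr0.
Qed.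

Lemma bs1_scale (c : R) g : bs1 g -> bs1 (fun x => c * g x).
Proof. by apply: (bs1_mul (C := `|c|)) => //; exact: measurable_cst. Qed.

Lemma bs1_sub f g : bs1 f -> bs1 g -> bs1 (fun x => f x - g x).
Proof.
move=> bf /(bs1_scale (-1)) bg; have := bs1_add bf bg.
by under [X in bs1 X -> _]eq_fun do rewrite mulN1r.
Qed.

Lemma int1D f g : bs1 f -> bs1 g ->
  \int[mu]_x (f x + g x) = \int[mu]_x f x + \int[mu]_x g x.
Proof. by move=> /bs1_integrable bf /bs1_integrable bg; exact: RintegralD. Qed.

Lemma int1B f g : bs1 f -> bs1 g ->
  \int[mu]_x (f x - g x) = \int[mu]_x f x - \int[mu]_x g x.
Proof. by move=> /bs1_integrable bf /bs1_integrable bg; exact: RintegralB. Qed.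

Lemma int1Z (c : R) f : bs1 f -> \int[mu]_x (c * f x) = c * \int[mu]_x f x.
Proof. by move=> /bs1_integrable bf; exact: RintegralZl. Qed.

Lemma bs2_add F G : bs2 F -> bs2 G -> bs2 (fun x => F x + G x).
Proof.
move=> [mf [C [M H]]] [mg [C' [M' H']]]; split; first exact: measurable_funD.
exists (C + C'), (Num.max M M') => x; have [h1 h2] := H x; have [h1' h2'] := H' x; split.
  by rewrite (le_trans (ler_normD _ _))// lerD.
move=> h; rewrite h2 ?h2' ?addr0//; apply: contra h => /andP[u v]; rewrite !le_max u v ?orbT//.
Qed.

Lemma bs2_mul F G (C : R) : measurable_fun [set: TR2] (F : TR2 -> R) ->
  (forall x, `|F x| <= C) -> bs2 G -> bs2 (fun x => F x * G x).
Proof.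
move=> mf fC [mg [C' [M' H']]]; split; first exact: measurable_funM.
exists (C * C'), M' => x; have [h1 h2] := H' x; split.
  by rewrite normrM ler_pM.
by move/h2 => ->; rewrite mulr0.
Qed.

Lemma bs2_scale (c : R) G : bs2 G -> bs2 (fun x => c * G x).
Proof. by apply: (bs2_mul (C := `|c|)) => //; exact: measurable_cst. Qed.

Lemma bs2_sub F G : bs2 F -> bs2 G -> bs2 (fun x => F x - G x).
Proof.
move=> bf /(bs2_scale (-1)) bg; have := bs2_add bf bg.
by under [X in bs2 X -> _]eq_fun do rewrite mulN1r.
Qed.

Lemma int2D F G : bs2 F -> bs2 G ->
  \int[mu2]_x (F x + G x) = \int[mu2]_x F x + \int[mu2]_x G x.
Proof. by move=> /bs2_integrable bf /bs2_integrable bg; exact: RintegralD. Qed.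

Lemma int2B F G : bs2 F -> bs2 G ->
  \int[mu2]_x (F x - G x) = \int[mu2]_x F x - \int[mu2]_x G x.
Proof. by move=> /bs2_integrable bf /bs2_integrable bg; exact: RintegralB. Qed.

Lemma int2Z (c : R) F : bs2 F -> \int[mu2]_x (c * F x) = c * \int[mu2]_x F x.
Proof. by move=> /bs2_integrable bf; exact: RintegralZl. Qed.

Lemma bs1_le f (C M : R) : bs1 f -> 0 <= M -> (forall x, `|f x| <= C) ->
  forall u, (forall x, ~~ (u <= x <= u + M) -> f x = 0) -> `|\int[mu]_x f x| <= C * M.
Proof.
move=> bf M0 fC u fu.
have C0 : 0 <= C by apply: le_trans (fC 0).
have mI : measurable ([set` `[u, u + M]] : set TR) by exact: (@measurable_itv R).
have I := bs1_integrable bf.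
have -> : \int[mu]_x f x = \int[mu]_(x in `[u, u + M]) f x.
  rewrite [RHS]Rintegral_mkcond; apply: eq_Rintegral => x _; rewrite patchE.
  case: ifPn => // /negP h; rewrite fu//; apply/negP => h'; apply: h; apply/mem_set => /=.
  by rewrite in_itv.
have I' : mu.-integrable [set` `[u, u + M]] (EFin \o f) by exact: integrableS I.
rewrite (le_trans (le_normr_Rintegral mI I'))//.
rewrite (@le_trans _ _ (\int[mu]_(x in `[u, u + M]) C))//.
  apply: le_Rintegral => //.
  - by have := integrable_abse I'; apply: eq_integrable => // x _.
  - apply/integrableP; split; first exact: measurable_cst.
    rewrite integral_cst//= lebesgue_measure_itv/=; case: ifP => _; rewrite ?mule0// -EFinB -EFinM ltry//.
rewrite Rintegral_cst//= lebesgue_measure_itv/= lte_fin; case: ifP => _ /=; last by rewrite mulr0 mulr_ge0.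
by rewrite addrC addKr.
Qed.

Lemma ae_int1 f g : bs1 f -> bs1 g -> {ae mu, forall x, f x = g x} ->
  \int[mu]_x f x = \int[mu]_x g x.
Proof.
move=> bf bg fg; rewrite /Rintegral; congr fine; apply: ae_eq_integral => //.
- exact: (measurable_int _ (bs1_integrable bf)).
- exact: (measurable_int _ (bs1_integrable bg)).
- by apply: (aeS fg) => x /= ->.
Qed.

Lemma ae_neq (c : R) : {ae mu, forall x, x != c}.
Proof.
exists [set c]; split; [exact: (@measurable_set1 R)|exact: lebesgue_measure_set1|].
by move=> x /= /negP; rewrite negbK => /eqP.
Qed.
End algebra.

(** * Fubini's theorem and characteristic coordinates *)

Section fubini.
Variable R : realType.
Notation mu := (@lebesgue_measure R).
Notation mu2 := (@mu2 R).
Local Notation TR := (measurableTypeR R).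
Local Notation TR2 := (measurableTypeR R * measurableTypeR R)%type.
Implicit Types (f g : R -> R) (F G : R * R -> R).

Lemma bs2_section1 F x : bs2 F -> bs1 (fun y => F (x, y)).
Proof.
move=> [mf [C [M H]]]; split; first exact: (measurableT_comp mf (@pair1_measurable _ _ TR TR x)).
exists C, M => y; have [h1 h2] := H (x, y); split => // h; apply: h2 => /=.
by rewrite negb_and h orbT.
Qed.

Lemma bs2_section2 F y : bs2 F -> bs1 (fun x => F (x, y)).
Proof.
move=> [mf [C [M H]]]; split; first exact: (measurableT_comp mf (@pair2_measurable _ _ TR TR y)).
exists C, M => x; have [h1 h2] := H (x, y); split => // h; apply: h2 => /=.
by rewrite negb_and h.
Qed.

Lemma integral_bs1 f : bs1 f -> (\int[mu]_x (f x)%:E = (\int[mu]_x f x)%:E)%E.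
Proof. by move=> bf; rewrite fineK//; exact: integrable_fin_num (bs1_integrable bf). Qed.

Lemma bs2_fubini_bs1 F : bs2 F -> bs1 (fun x => \int[mu]_y F (x, y)).
Proof.
move=> bF; have := bF; move=> [mF [C [M H]]].
have /= M0 : 0 <= `|M| by [].
split.
  have := measurable_fubini_F (bs2_integrable bF).
  rewrite /fubini_F => h; apply/measurable_EFinP; apply: eq_measurable_fun h => x _ /=.
  by rewrite (integral_bs1 (bs2_section1 x bF)).
exists (C * (2 * `|M|)), M => x; split.
  apply: (@bs1_le _ _ _ _ (bs2_section1 x bF) _ _ (- `|M|)); first by rewrite mulr_ge0.
    by move=> y; have [] := H (x, y).
  move=> y h; have [_ ->] := H (x, y) => //=; apply: contra h => /andP[_ h].
  move: (le_trans h (ler_norm M)); rewrite ler_norml => /andP[? ?]; apply/andP; split; lra.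
move=> h; rewrite (_ : (fun y => _) = (fun=> 0)).
  by rewrite Rintegral_cst// mul0r.
by apply/funext => y; have [_ ->] := H (x, y) => //=; rewrite negb_and h.
Qed.

Lemma bs2_swap F : bs2 F -> bs2 (fun p => F (p.2, p.1)).
Proof.
move=> [mF [C [M H]]]; split.
  apply: (measurableT_comp mF); apply: measurable_fun_pair => //.
exists C, M => p; have [h1 h2] := H (p.2, p.1); split => // h; apply: h2 => /=.
by rewrite andbC.
Qed.

Lemma fubini12 F : bs2 F -> \int[mu2]_p F p = \int[mu]_x \int[mu]_y F (x, y).
Proof.
move=> bF; rewrite /Rintegral; congr fine.
have := integral12_prod_meas1 (bs2_integrable bF); rewrite /fubini_F /= => <-.
by apply: eq_integral => x _; rewrite (integral_bs1 (bs2_section1 x bF)).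
Qed.

Lemma fubini21 F : bs2 F -> \int[mu2]_p F p = \int[mu]_y \int[mu]_x F (x, y).
Proof.
move=> bF; rewrite /Rintegral; congr fine.
have := integral21_prod_meas1 (bs2_integrable bF); rewrite /fubini_G /= => <-.
by apply: eq_integral => x _; rewrite (integral_bs1 (bs2_section2 x bF)).
Qed.

Lemma fubini_swap F : bs2 F ->
  \int[mu]_x \int[mu]_y F (x, y) = \int[mu]_y \int[mu]_x F (x, y).
Proof. by move=> bF; rewrite -fubini12// fubini21. Qed.

Lemma bs2_char F : bs2 F -> bs2 (fun p => F ((p.1 + p.2) / 2, (p.1 - p.2) / 2)).
Proof.
move=> [mF [C [M H]]]; split.
  apply: (measurableT_comp mF); apply: measurable_fun_pair => //.
    apply: measurable_funM => //; exact: measurable_funD.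
  apply: measurable_funM => //; exact: measurable_funB.
exists C, (2 * `|M|) => p; have [h1 h2] := H ((p.1 + p.2) / 2, (p.1 - p.2) / 2); split => // h; apply: h2 => /=.
apply: contra h => /andP[h1' h2'].
move: (le_trans h1' (ler_norm M)) (le_trans h2' (ler_norm M)).
rewrite !ler_norml => /andP[? ?] /andP[? ?]; apply/andP; split; apply/andP; split; lra.
Qed.

Lemma bs2_shear F : bs2 F -> bs2 (fun p => F (p.1, p.2 - p.1)).
Proof.
move=> [mF [C [M H]]]; split.
  apply: (measurableT_comp mF); apply: measurable_fun_pair => //; exact: measurable_funB.
exists C, (2 * `|M|) => p; have [h1 h2] := H (p.1, p.2 - p.1); split => // h; apply: h2 => /=.
apply: contra h => /andP[h1' h2'].
move: (le_trans h1' (ler_norm M)) (le_trans h2' (ler_norm M)).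
rewrite !ler_norml => /andP[? ?] /andP[? ?]; apply/andP; split; apply/andP; split; lra.
Qed.

Lemma int_shift (d : R) f : bs1 f -> \int[mu]_x f x = \int[mu]_x f (x + d).
Proof.
move=> bf; rewrite (@int_affine R 1 d)// mul1r.
by under eq_Rintegral do rewrite mul1r.
Qed.

(** Fubini along the lines x + y = r: for fixed s, translating the second variable by s leaves the
    inner integral unchanged, so one-dimensional substitutions suffice. *)
Lemma int2_shear F : bs2 F -> \int[mu2]_p F p = \int[mu]_r \int[mu]_s F (s, r - s).
Proof.
move=> bF; rewrite (fubini12 bF); have /= <- := fubini_swap (bs2_shear bF).
by apply: eq_Rintegral => s _; rewrite (int_shift (- s)) //; exact: bs2_section1.
Qed.

(** After the shear, s = (r + v) / 2 is substituted on each line x + y = r; the Jacobian 2^-1 comes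
    from this substitution alone. *)
Lemma int2_char F : bs2 F -> \int[mu2]_p F p =
  2^-1 * \int[mu2]_p F ((p.1 + p.2) / 2, (p.1 - p.2) / 2).
Proof.
move=> bF; rewrite int2_shear// fubini12; last exact: bs2_char.
rewrite -int1Z; last exact: (bs2_fubini_bs1 (bs2_char bF)).
apply: eq_Rintegral => r _ /=.
rewrite (@int_affine R 2^-1 (r / 2)) ?invr_gt0//; last exact: (bs2_section2 r (bs2_shear bF)).
congr (_ * _); apply: eq_Rintegral => v _; congr (F (_, _)); by field.
Qed.


(** Bounds and supports pass to pointwise limits, so the limit stays in [bs2]; the dominating
    function is C on the square of half-width M. *)
Lemma int2_dct (Fn : nat -> R * R -> R) F (C M : R) :
  (forall n, measurable_fun [set: TR2] (Fn n : TR2 -> R)) ->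
  measurable_fun [set: TR2] (F : TR2 -> R) ->
  (forall n p, `|Fn n p| <= C /\ (~~ ((`|p.1| <= M) && (`|p.2| <= M)) -> Fn n p = 0)) ->
  (forall p, Fn ^~ p @ \oo --> F p) ->
  bs2 F /\ (fun n => \int[mu2]_p Fn n p) @ \oo --> \int[mu2]_p F p.
Proof.
move=> mFn mF H cF.
have bFn n : bs2 (Fn n) by split => //; exists C, M => p; exact: H.
have bF : bs2 F.
  split => //; exists C, M => p; split.
    have cN : (fun n => `|Fn n p|) @ \oo --> `|F p| by exact: cvg_norm (cF p).
    rewrite -(cvg_lim _ cN)//; apply: limr_le; first by apply/cvg_ex; exists `|F p|.
    by apply: nearW => n; have [] := H n p.
  move=> h; have : (fun n => Fn n p) @ \oo --> (0 : R).
    rewrite (_ : (fun n => _) = (fun=> 0)); first exact: cvg_cst.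
    by apply/funext => n; have [_ ->] := H n p.
  by move=> h0; apply: cvg_unique (cF p) h0.
split => //.
pose G (p : R * R) : R := if (`|p.1| <= M) && (`|p.2| <= M) then C else 0.
have bG : bs2 G.
  split.
    apply: measurable_fun_ifT => //; apply: measurable_and; apply: measurable_fun_ler => //;
      apply: measurableT_comp => //.
  exists C, M => p; rewrite /G; case: ifP => // _; split => //.
    by rewrite ger0_norm//; apply: le_trans (proj1 (H 0%N p)).
  by rewrite normr0; apply: le_trans (proj1 (H 0%N p)).
have GE n p : `|Fn n p| <= G p.
  by rewrite /G; have [h1 h2] := H n p; case: ifPn => // /h2 ->; rewrite normr0.
have [] := @dominated_convergence _ _ _ mu2 setT measurableT (fun n p => (Fn n p)%:E)
  (fun p => (F p)%:E) (fun p => (G p)%:E).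
- by move=> n; exact/measurable_EFinP.
- exact/measurable_EFinP.
- apply: aeW => p _; apply: cvg_EFin; [exact: nearW|exact: cF].
- exact: (bs2_integrable bG).
- by apply: aeW => p n _; rewrite lee_fin.
move=> _ _ h.
have fineF : (\int[mu2]_p (F p)%:E)%E = (\int[mu2]_p F p)%:E.
  by rewrite fineK//; exact: integrable_fin_num (bs2_integrable bF).
by move: h; rewrite fineF => /fine_cvgP[_].
Qed.
End fubini.

(** * Spline test functions in characteristic coordinates *)

Section spline.
Variable R : realType.
Notation mu := (@lebesgue_measure R).
Notation mu2 := (@mu2 R).
Local Notation TR := (measurableTypeR R).
Local Notation TR2 := (measurableTypeR R * measurableTypeR R)%type.

Lemma is_derive_lim (f : R -> R) (x l : R) :
  (fun h : R => h^-1 * (f (h + x) - f x)) @ 0^' --> l -> is_derive x 1 f l.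
Proof.
move=> fl.
have E : (fun h : R => h^-1 *: ((f \o shift x) (h *: 1) - f x)) = (fun h : R => h^-1 * (f (h + x) - f x)).
  by apply/funext => h /=; rewrite /GRing.scale/= mulr1.
apply: DeriveDef; first by apply/cvg_ex; exists l => /=; rewrite E.
by rewrite /derive E; apply: cvg_lim.
Qed.

(** The truncated power u_+^n, from which B-splines are built. For n = 0 it is the constant 1,
    because 0 ^+ 0 = 1. *)
Definition tpow (n : nat) (u : R) : R := Num.max 0 u ^+ n.

Lemma max0_continuous : continuous (fun u : R => Num.max 0 u).
Proof.
have -> : (fun u : R => Num.max 0 u) = (fun u => (u + `|u|) / 2).
  apply/funext => u; have [u0|u0] := leP 0 u.
    by rewrite ger0_norm//; field.
  by rewrite ltr0_norm// subrr mul0r.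
move=> u; apply: cvgM; last exact: cvg_cst.
by apply: cvgD; [exact: cvg_id|exact: norm_continuous].
Qed.

Lemma tpow_continuous n : continuous (tpow n).
Proof.
elim: n => [|n IH] u; first exact: cvg_cst.
rewrite (_ : tpow n.+1 = (fun u => Num.max 0 u * tpow n u)); last first.
  by apply/funext => v; rewrite /tpow exprS.
by apply: cvgM; [exact: max0_continuous|exact: IH].
Qed.

Lemma tpow0 n u : u <= 0 -> tpow n.+1 u = 0.
Proof. by move=> u0; rewrite /tpow (max_l u0) expr0n. Qed.

Lemma tpowE n u : 0 <= u -> tpow n u = u ^+ n.
Proof. by move=> u0; rewrite /tpow (max_r u0). Qed.

Lemma tpow_derive n (u : R) : is_derive u 1 (tpow n.+2) (n.+2%:R * tpow n.+1 u).
Proof.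
have [u0|u0|->] := ltgtP u 0.
- rewrite (tpow0 n (ltW u0)) mulr0.
  apply: (@near_eq_is_derive _ _ _ (cst (0 : R))).
  near=> v; rewrite /= tpow0//; apply: ltW; near: v; exact: lt_nbhsl.
- rewrite (tpowE _ (ltW u0)).
  apply: (@near_eq_is_derive _ R R (fun x : R => x ^+ n.+2)).
    near=> v; rewrite tpowE//; apply: ltW; near: v; exact: lt_nbhsr.
  have := @is_deriveX R R id n.+2 u 1 1 (is_derive_id _ _).
  rewrite (_ : id ^+ n.+2 = (fun x : R => x ^+ n.+2)); last first.
    by apply/funext => x; rewrite exprfctE.
  by rewrite /GRing.scale /= mulr1.
- rewrite tpow0// mulr0; apply: is_derive_lim.
  have c0 : tpow n.+1 h @[h --> 0^'] --> (0 : R).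
    by have := @tpow_continuous n.+1 0 => /continuous_withinNx; rewrite tpow0.
  apply: cvg_trans c0.
  apply: near_eq_cvg; near=> h.
  have h0 : h != 0 by near: h; exact: nbhs_dnbhs_neq.
  rewrite addr0 (tpow0 n.+1 (lexx _)) subr0; have [hp|hp] := leP 0 h.
    by rewrite !tpowE// [h ^+ n.+2]exprS mulKf.
  by rewrite !(tpow0 _ (ltW hp)) mulr0.
Unshelve. all: by end_near. Qed.


Lemma is_derive_comb (f g f' g' : R -> R) (c x : R) :
  is_derive x 1 f (f' x) -> is_derive x 1 g (g' x) ->
  is_derive x 1 (fun y => f y + c * g y) (f' x + c * g' x).
Proof.
move=> hf hg; have := is_deriveD hf (is_deriveZ c hg); exact.
Qed.

Lemma is_derive_affine (f f' : R -> R) (N c x : R) :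
  (forall y : R, is_derive y 1 f (f' y)) ->
  is_derive x 1 (fun y => f (N * (y - c))) (N * f' (N * (x - c))).
Proof.
move=> hf.
have h : is_derive x 1 (fun y : R => N * (y - c)) N.
  have := is_deriveZ N (is_deriveD (is_derive_id x (1 : R)) (is_derive_cst (- c) x 1)).
  by rewrite addr0 /GRing.scale /= mulr1; exact.
have := @is_derive1_comp R f (fun y => N * (y - c)) x (f' (N * (x - c))) N (hf _) h.
by rewrite mulrC; exact.
Qed.

Lemma is_derive_shiftc (f f' : R -> R) (c x : R) :
  (forall y : R, is_derive y 1 f (f' y)) ->
  is_derive x 1 (fun y => f (y - c)) (f' (x - c)).
Proof.
move=> hf; have := is_derive_affine 1 c x hf; rewrite !mul1r.
by under [X in is_derive _ _ X _ -> _]eq_fun do rewrite mul1r.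
Qed.

(* the second difference combination turns truncated powers into splines *)
Definition diff3 (f : R -> R) (u : R) : R :=
  f u + (- 3) * f (u - 1) + 3 * f (u - 2) + (- 1) * f (u - 3).

Lemma diff3_derive (f f' : R -> R) : (forall y : R, is_derive y 1 f (f' y)) ->
  forall y : R, is_derive y 1 (diff3 f) (diff3 f' y).
Proof.
move=> hf y; rewrite /diff3.
apply: (@is_derive_comb _ (fun u => f (u - 3)) (fun u => f' u + (- 3) * f' (u - 1) + 3 * f' (u - 2)) (fun u => f' (u - 3))).
  apply: (@is_derive_comb _ (fun u => f (u - 2)) (fun u => f' u + (- 3) * f' (u - 1)) (fun u => f' (u - 2))).
    apply: (@is_derive_comb _ (fun u => f (u - 1)) f' (fun u => f' (u - 1))) => //.
    exact: is_derive_shiftc.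
  exact: is_derive_shiftc.
exact: is_derive_shiftc.
Qed.

Lemma diff3_continuous f : continuous f -> continuous (diff3 f).
Proof.
move=> cf u; rewrite /diff3.
have h c : (fun u => f (u - c)) @ u --> f (u - c).
  apply: (@continuous_comp _ _ _ (fun u => u - c) f); last exact: cf.
  by apply: cvgB; [exact: cvg_id|exact: cvg_cst].
apply: cvgD; last by apply: cvgM; [exact: cvg_cst|exact: h].
apply: cvgD; last by apply: cvgM; [exact: cvg_cst|exact: h].
apply: cvgD; last by apply: cvgM; [exact: cvg_cst|exact: h].
exact: cf.
Qed.

(** [bump] is the quadratic B-spline with knots 0, 1, 2, 3, [bstep] its primitive and [dbump] its
    derivative. Two continuous derivatives are what [test_function] asks for, and with piecewise
    polynomials every bound is arithmetic on each piece. *)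
Definition bstep (u : R) := diff3 (tpow 3) u / 6.
Definition bump (u : R) := diff3 (tpow 2) u / 2.
Definition dbump (u : R) := diff3 (tpow 1) u.

Lemma bstep_derive (u : R) : is_derive u 1 bstep (bump u).
Proof.
have h := @diff3_derive (tpow 3) _ (@tpow_derive 1) u.
have := @is_deriveZ R R R _ (6^-1) u 1 _ h.
rewrite (_ : _ *: diff3 _ _ = bump u); last by rewrite /bump /diff3 /GRing.scale/=; field.
congr (is_derive u 1 _ _); apply/funext => v; rewrite /bstep mulrC //.
Qed.

Lemma bump_derive (u : R) : is_derive u 1 bump (dbump u).
Proof.
have h := @diff3_derive (tpow 2) _ (@tpow_derive 0) u.
have := @is_deriveZ R R R _ (2^-1) u 1 _ h.
rewrite (_ : _ *: diff3 _ _ = dbump u); last by rewrite /dbump /diff3 /GRing.scale/=; field.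
congr (is_derive u 1 _ _); apply/funext => v; rewrite /bump mulrC //.
Qed.

Lemma dbump_continuous : continuous dbump.
Proof. exact: (diff3_continuous (@tpow_continuous 1)). Qed.

Lemma tpow_max (u : R) n : (tpow n u = if 0 <= u then u ^+ n else 0 ^+ n) .
Proof.
by case: ifPn => [/tpowE ->//|]; rewrite -ltNge => /ltW h; rewrite /tpow max_l.
Qed.

Lemma bstep_lo u : u <= 0 -> bstep u = 0.
Proof.
move=> u0; rewrite /bstep /diff3 !tpow0; [|lra..]; by rewrite !mulr0 !addr0 mul0r.
Qed.

Lemma bstep_hi u : 3 <= u -> bstep u = 1.
Proof.
move=> u0; rewrite /bstep /diff3 !tpowE; [|lra..]; by field.
Qed.

Lemma bump_lo u : u <= 0 -> bump u = 0.
Proof.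
move=> u0; rewrite /bump /diff3 !tpow0; [|lra..]; by rewrite !mulr0 !addr0 mul0r.
Qed.

Lemma bump_hi u : 3 <= u -> bump u = 0.
Proof.
move=> u0; rewrite /bump /diff3 !tpowE; [|lra..]; by field.
Qed.

Lemma bump_ge0 u : 0 <= bump u.
Proof.
rewrite /bump /diff3 !tpow_max !expr0n/=.
have [?|?] := leP 0 u; have [?|?] := leP 0 (u - 1); have [?|?] := leP 0 (u - 2);
  have [?|?] := leP 0 (u - 3); try nra.
Qed.

Lemma bump_le u : `|bump u| <= 2.
Proof.
rewrite ger0_norm ?bump_ge0// /bump /diff3 !tpow_max !expr0n/=.
have [?|?] := leP 0 u; have [?|?] := leP 0 (u - 1); have [?|?] := leP 0 (u - 2);
  have [?|?] := leP 0 (u - 3); try nra.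
Qed.

Lemma derive_continuous (f f' : R -> R) : (forall y : R, is_derive y 1 f (f' y)) -> continuous f.
Proof.
move=> hf x; apply: differentiable_continuous; apply/derivable1_diffP.
by case: (hf x).
Qed.

Lemma bump_continuous : continuous bump.
Proof. exact: derive_continuous bump_derive. Qed.

Lemma bstep_continuous : continuous bstep.
Proof. exact: derive_continuous bstep_derive. Qed.

Lemma continuous_mfun (f : R -> R) : continuous f -> measurable_fun [set: TR] (f : TR -> R).
Proof. exact: (@continuous_measurable_fun R f). Qed.

Lemma bs1_bump : bs1 bump.
Proof.
split; first exact: continuous_mfun bump_continuous.
exists 2, 3 => x; split; first exact: bump_le.
rewrite ler_norml negb_and -!ltNge => /orP[h|h]; [apply: bump_lo|apply: bump_hi]; lra.
Qed.

Lemma int_bump : \int[mu]_x bump x = 1.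
Proof.
have : \int[mu]_(x in `[0, 3]) bump x = 1.
  rewrite /Rintegral (@continuous_FTC2 R bump bstep 0 3)//.
  - by rewrite (bstep_lo (lexx _)) (bstep_hi (lexx _)) -EFinB subr0.
  - exact: (continuous_subspaceT bump_continuous).
  - split.
    + by move=> x _; case: (bstep_derive x).
    + by apply: cvg_at_right_filter; exact: bstep_continuous.
    + by apply: cvg_at_left_filter; exact: bstep_continuous.
  - by move=> x _; rewrite derive1E; case: (bstep_derive x).
move=> <-; rewrite [RHS]Rintegral_mkcond; apply: eq_Rintegral => x _; rewrite patchE.
case: ifPn => // /negP h; have : ~~ (0 <= x <= 3).
  by apply/negP => h'; apply: h; apply/mem_set; rewrite /= in_itv.
by rewrite negb_and -!ltNge => /orP[h'|h']; [apply: bump_lo|apply: bump_hi]; lra.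
Qed.

Lemma bstep_bound u : `|bstep u| <= 2.
Proof.
rewrite /bstep /diff3 !tpow_max !expr0n/=.
rewrite ler_norml; have [?|?] := leP 0 u; have [?|?] := leP 0 (u - 1); have [?|?] := leP 0 (u - 2);
  have [?|?] := leP 0 (u - 3); apply/andP; split; nra.
Qed.
End spline.

Section test_functions.
Variable R : realType.
Notation mu := (@lebesgue_measure R).
Notation mu2 := (@mu2 R).
Local Notation TR := (measurableTypeR R).
Local Notation TR2 := (measurableTypeR R * measurableTypeR R)%type.

Fixpoint smooth n (f : R -> R) : Prop := continuous f /\
  match n with
  | 0 => True
  | m.+1 => exists2 f' : R -> R, forall x : R, is_derive x 1 f (f' x) & smooth m f'
  end.

Lemma smooth_pred n f : smooth n.+1 f -> smooth n f.
Proof.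
elim: n f => [|n IH] f /= [cf [f' df sf']]; split => //.
by exists f' => //; exact: IH.
Qed.

Lemma class_C_comb n (c : R) (phi psi : R -> R -> R) : class_C n phi -> class_C n psi ->
  class_C n (fun x y => phi x y + c * psi x y).
Proof.
elim: n phi psi => [|n IH] phi psi /= [cphi hphi] [cpsi hpsi]; split => //.
- by move=> p; apply: cvgD; [exact: cphi|apply: cvgM; [exact: cvg_cst|exact: cpsi]].
- by move=> p; apply: cvgD; [exact: cphi|apply: cvgM; [exact: cvg_cst|exact: cpsi]].
- have [d1 d2 d3 d4] := hphi; have [e1 e2 e3 e4] := hpsi.
  have i1 (x y : R) : is_derive x 1 (fun x => phi x y + c * psi x y) (dx phi x y + c * dx psi x y).
    apply: (@is_derive_comb _ (phi^~ y) (psi^~ y) (dx phi ^~ y) (dx psi ^~ y)); rewrite /dx derive1E; exact: derivableP.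
  have i2 (x y : R) : is_derive y 1 (fun y => phi x y + c * psi x y) (dy phi x y + c * dy psi x y).
    apply: (@is_derive_comb _ (phi x) (psi x) (dy phi x) (dy psi x)); rewrite /dy derive1E; exact: derivableP.
  split.
  + by move=> x y; case: (i1 x y).
  + by move=> x y; case: (i2 x y).
  + rewrite (_ : dx _ = (fun x y => dx phi x y + c * dx psi x y)); first exact: IH.
    by apply/funext => x; apply/funext => y; rewrite /dx derive1E; case: (i1 x y).
  + rewrite (_ : dy _ = (fun x y => dy phi x y + c * dy psi x y)); first exact: IH.
    by apply/funext => x; apply/funext => y; rewrite /dy derive1E; case: (i2 x y).
Qed.

Definition charprod (f g : R -> R) (x y : R) := f (x + y) * g (x - y).

(** The factor 1 puts the derivative into the form [phi + c * psi] of [class_C_comb] and [dd_comb];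
    for the derivative in y, c is -1. *)
Lemma charprod_dx (f f' g g' : R -> R) (x y : R) :
  (forall x : R, is_derive x 1 f (f' x)) -> (forall x : R, is_derive x 1 g (g' x)) ->
  is_derive x 1 (charprod f g ^~ y) (charprod f' g x y + 1 * charprod f g' x y).
Proof.
move=> hf hg; rewrite /charprod.
have h1 := is_derive_shiftc (- y) x hf; have h2 := is_derive_shiftc y x hg.
have := is_deriveM h1 h2; rewrite opprK /GRing.scale /= mul1r.
rewrite (_ : _ * _ + _ * _ = f' (x + y) * g (x - y) + f (x + y) * g' (x - y)); last by ring.
by congr (is_derive x 1 _ _); apply/funext => z /=; rewrite !fctE ?opprK.
Qed.

Lemma is_derive_reflect (f f' : R -> R) (c x : R) : (forall x : R, is_derive x 1 f (f' x)) ->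
  is_derive x 1 (fun y => f (c - y)) (- f' (c - x)).
Proof.
move=> hf; have := is_derive_affine (-1) c x hf.
rewrite mulN1r [-1 * _]mulN1r opprB.
by under [X in is_derive _ _ X _ -> _]eq_fun do rewrite mulN1r opprB.
Qed.

Lemma charprod_dy (f f' g g' : R -> R) (x y : R) :
  (forall x : R, is_derive x 1 f (f' x)) -> (forall x : R, is_derive x 1 g (g' x)) ->
  is_derive y 1 (charprod f g x) (charprod f' g x y + (- 1) * charprod f g' x y).
Proof.
move=> hf hg; rewrite /charprod.
have h1 := is_derive_shiftc (- x) y hf; have h2 := is_derive_reflect x y hg.
have := is_deriveM h1 h2; rewrite opprK /GRing.scale /=.
rewrite (_ : _ * _ + _ * _ = f' (x + y) * g (x - y) + (-1) * (f (x + y) * g' (x - y))); last first.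
  by rewrite (addrC y); ring.
by congr (is_derive y 1 _ _); apply/funext => z /=; rewrite !fctE ?opprK (addrC z).
Qed.

Lemma charprod_continuous f g : continuous f -> continuous g ->
  continuous (fun p : R * R => charprod f g p.1 p.2).
Proof.
move=> cf cg p; rewrite /charprod; apply: cvgM.
  apply: (@continuous_comp _ _ _ (fun p : R * R => p.1 + p.2) f); last exact: cf.
  by apply: cvgD; [exact: cvg_fst|exact: cvg_snd].
apply: (@continuous_comp _ _ _ (fun p : R * R => p.1 - p.2) g); last exact: cg.
by apply: cvgB; [exact: cvg_fst|exact: cvg_snd].
Qed.

Lemma dx_charprod (f f' g g' : R -> R) :
  (forall x : R, is_derive x 1 f (f' x)) -> (forall x : R, is_derive x 1 g (g' x)) ->
  dx (charprod f g) = (fun x y => charprod f' g x y + 1 * charprod f g' x y).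
Proof.
move=> hf hg; apply/funext => x; apply/funext => y; rewrite /dx derive1E.
by case: (charprod_dx x y hf hg).
Qed.

Lemma dy_charprod (f f' g g' : R -> R) :
  (forall x : R, is_derive x 1 f (f' x)) -> (forall x : R, is_derive x 1 g (g' x)) ->
  dy (charprod f g) = (fun x y => charprod f' g x y + (- 1) * charprod f g' x y).
Proof.
move=> hf hg; apply/funext => x; apply/funext => y; rewrite /dy derive1E.
by case: (charprod_dy x y hf hg).
Qed.

Lemma charprod_class n f g : smooth n f -> smooth n g -> class_C n (charprod f g).
Proof.
elim: n f g => [|n IH] f g sf sg.
  by split => //; apply: charprod_continuous; [case: sf|case: sg].
have sf0 := smooth_pred sf; have sg0 := smooth_pred sg.
have [cf [f' hf sf']] := sf; have [cg [g' hg sg']] := sg.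
split; first exact: charprod_continuous.
split.
- by move=> x y; case: (charprod_dx x y hf hg).
- by move=> x y; case: (charprod_dy x y hf hg).
- by rewrite (dx_charprod hf hg); apply: class_C_comb; exact: IH.
- by rewrite (dy_charprod hf hg); apply: class_C_comb; exact: IH.
Qed.

Lemma dd_comb (c : R) (phi psi : R -> R -> R) : class_C 1 phi -> class_C 1 psi ->
  dx (fun x y => phi x y + c * psi x y) = (fun x y => dx phi x y + c * dx psi x y) /\
  dy (fun x y => phi x y + c * psi x y) = (fun x y => dy phi x y + c * dy psi x y).
Proof.
move=> [_ [d1 d2 _ _]] [_ [e1 e2 _ _]]; split; apply/funext => x; apply/funext => y.
  rewrite /dx !derive1E; apply: derive_val; rewrite -!derive1E.
  apply: (@is_derive_comb _ (phi^~ y) (psi^~ y) (dx phi ^~ y) (dx psi ^~ y)); rewrite /dx derive1E; exact: derivableP.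
rewrite /dy !derive1E; apply: derive_val; rewrite -!derive1E.
apply: (@is_derive_comb _ (phi x) (psi x) (dy phi x) (dy psi x)); rewrite /dy derive1E; exact: derivableP.
Qed.

Lemma charprod_box (f f' f'' g g' g'' : R -> R) :
  (forall x : R, is_derive x 1 f (f' x)) -> (forall x : R, is_derive x 1 g (g' x)) ->
  (forall x : R, is_derive x 1 f' (f'' x)) -> (forall x : R, is_derive x 1 g' (g'' x)) ->
  continuous f'' -> continuous g'' ->
  forall x y, dx (dx (charprod f g)) x y - dy (dy (charprod f g)) x y = 4 * charprod f' g' x y.
Proof.
move=> hf hg hf' hg' cf'' cg'' x y.
have sf' : smooth 1 f' by split; [exact: derive_continuous hf'|exists f''].
have sg' : smooth 1 g' by split; [exact: derive_continuous hg'|exists g''].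
have sf : smooth 1 f by split; [exact: derive_continuous hf|exists f' => //; exact: smooth_pred].
have sg : smooth 1 g by split; [exact: derive_continuous hg|exists g' => //; exact: smooth_pred].
have C1 := charprod_class sf' sg; have C2 := charprod_class sf sg'.
rewrite (dx_charprod hf hg) (dy_charprod hf hg) (proj1 (dd_comb 1 C1 C2)) (proj2 (dd_comb (-1) C1 C2)).
rewrite (dx_charprod hf' hg) (dx_charprod hf hg') (dy_charprod hf' hg) (dy_charprod hf hg').
by rewrite /charprod; ring.
Qed.

(* rises from 0 to 1 just after lo, falls back just before hi *)
Definition plateau (N lo hi r : R) :=
  bstep (N * (r - (lo + N^-1))) + (- 1) * bstep (N * (r - (hi - 4 * N^-1))).
Definition dplateau (N lo hi r : R) :=
  N * bump (N * (r - (lo + N^-1))) + (- 1) * (N * bump (N * (r - (hi - 4 * N^-1)))).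
Definition ddplateau (N lo hi r : R) :=
  N * (N * dbump (N * (r - (lo + N^-1)))) + (- 1) * (N * (N * dbump (N * (r - (hi - 4 * N^-1))))).

Lemma plateau_derive (N lo hi r : R) : is_derive r 1 (plateau N lo hi) (dplateau N lo hi r).
Proof.
apply: (@is_derive_comb _ (fun r => bstep (N * (r - (lo + N^-1)))) (fun r => bstep (N * (r - (hi - 4 * N^-1))))
  (fun r => N * bump (N * (r - (lo + N^-1)))) (fun r => N * bump (N * (r - (hi - 4 * N^-1)))));
  apply: is_derive_affine; exact: bstep_derive.
Qed.

Lemma dplateau_derive (N lo hi r : R) : is_derive r 1 (dplateau N lo hi) (ddplateau N lo hi r).
Proof.
have h (c : R) : is_derive r 1 (fun r => N * bump (N * (r - c))) (N * (N * dbump (N * (r - c)))).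
  apply: is_deriveZ; apply: is_derive_affine; exact: bump_derive.
apply: (@is_derive_comb _ (fun r => N * bump (N * (r - (lo + N^-1)))) (fun r => N * bump (N * (r - (hi - 4 * N^-1))))
  (fun r => N * (N * dbump (N * (r - (lo + N^-1))))) (fun r => N * (N * dbump (N * (r - (hi - 4 * N^-1)))))); exact: h.
Qed.

Lemma ddplateau_continuous N lo hi : continuous (ddplateau N lo hi).
Proof.
have h c : continuous (fun r => N * (N * dbump (N * (r - c)))).
  move=> r; apply: cvgM; first exact: cvg_cst.
  apply: cvgM; first exact: cvg_cst.
  apply: (@continuous_comp _ _ _ (fun r => N * (r - c)) (@dbump R)); last exact: dbump_continuous.
  apply: cvgM; first exact: cvg_cst.
  by apply: cvgB; [exact: cvg_id|exact: cvg_cst].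
by move=> r; apply: cvgD; [exact: h|apply: cvgM; [exact: cvg_cst|exact: h]].
Qed.

(** Each ramp has width 3 / N: the rise takes place on [lo + 1/N, lo + 4/N] and the fall on
    [hi - 4/N, hi - 1/N]. The margins 1/N keep the support inside the open interval, and
    [5 * N^-1 <= hi - lo] says that the fall does not start before the rise. *)
Lemma plateau_supp N lo hi r : 0 < N -> 5 * N^-1 <= hi - lo ->
  ~~ (lo + N^-1 <= r <= hi - N^-1) -> plateau N lo hi r = 0.
Proof.
move=> N0 Nh; have NV : N * N^-1 = 1 by rewrite mulfV// gt_eqF.
have Ni : 0 < N^-1 by rewrite invr_gt0.
rewrite negb_and -!ltNge => /orP[h|h]; rewrite /plateau.
  rewrite !bstep_lo ?mulr0 ?addr0// mulr_ge0_le0 ?ltW//; lra.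
rewrite !bstep_hi ?mulr1 ?subrr//.
  have : N * (3 * N^-1) <= N * (r - (hi - 4 / N)) by rewrite ler_pM2l//; lra.
  by rewrite mulrCA NV mulr1.
have : N * (3 * N^-1) <= N * (r - (lo + N^-1)) by rewrite ler_pM2l//; lra.
by rewrite mulrCA NV mulr1.
Qed.

Lemma plateau_bound N lo hi r : `|plateau N lo hi r| <= 4.
Proof.
rewrite /plateau mulN1r (le_trans (ler_normB _ _))//.
by have := bstep_bound (N * (r - (lo + N^-1))); have := bstep_bound (N * (r - (hi - 4 * N^-1))); lra.
Qed.

Lemma plateau_lim (N0 lo hi r : R) : 0 < N0 -> lo < hi ->
  (fun n : nat => plateau (N0 + n%:R) lo hi r) @ \oo --> ((lo < r < hi)%R%:R : R).
Proof.
move=> N00 lh.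
have big (e : R) : 0 < e -> \forall n \near \oo, 4 <= (N0 + n%:R) * e.
  move=> e0; near=> n; rewrite -ler_pdivrMr// (le_trans _ (_ : n%:R <= _))//; last by rewrite lerDr ltW.
  near: n; exact: nbhs_infty_ger.
suff : \forall n \near \oo, plateau (N0 + n%:R) lo hi r = (lo < r < hi)%R%:R.
  by move=> h; exact: cvg_near_cst h.
(* In this form the margins are shifts independent of N. At r = lo the first argument is -1 and at r
   = hi the second is 4, so the limit is 0 at both end points and the convergence holds
   everywhere. *)
have key n : let N := N0 + n%:R in
   plateau N lo hi r = bstep (N * (r - lo) - 1) - bstep (4 - N * (hi - r)).
  have NN0 : N0 + n%:R != 0 by rewrite gt_eqF// ltr_wpDr.
  rewrite /plateau mulN1r /=; congr (bstep _ - bstep _); by field.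
have [rlo|lor] := leP r lo => /=.
  have e0 : 0 < hi - r by lra.
  near=> n; rewrite key !bstep_lo ?subrr//.
    by rewrite subr_le0; near: n; exact: big.
  rewrite subr_le0 (le_trans _ ler01)// mulr_ge0_le0//; last lra.
  by rewrite addr_ge0// ltW.
have e1 : 0 < r - lo by lra.
have [rhi|hir] := ltP r hi => /=.
  have e2 : 0 < hi - r by lra.
  near=> n; rewrite key bstep_hi; last first.
    rewrite lerBrDr; have -> : 3 + 1 = 4 :> R by ring.
    by near: n; exact: big.
  rewrite bstep_lo ?subr0//.
  by rewrite subr_le0; near: n; exact: big.
near=> n; rewrite key !bstep_hi ?subrr//.
  rewrite (@le_trans _ _ 4)//; first lra.
  rewrite lerBrDl gerDr mulr_ge0_le0//; last lra.
  by rewrite addr_ge0// ltW.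
rewrite lerBrDr; have -> : 3 + 1 = 4 :> R by ring.
by near: n; exact: big.
Unshelve. all: by end_near. Qed.

(** The value eta separates the two factors: on the support 0 < x - y < eta < x + y, which forces 0
    < y < x. In the limit the rectangle has its corner (eta, 0) on the line y = 0, where the kernel
    vanishes. *)
Lemma plateau_test (N eta xi : R) : 0 < N -> 0 < eta -> 5 * N^-1 <= eta -> 5 * N^-1 <= xi - eta ->
  test_function (@open_sector R) (charprod (plateau N eta xi) (plateau N 0 eta)).
Proof.
move=> N0 e0 h1 h2; have Ni : 0 < N^-1 by rewrite invr_gt0.
have sm lo hi : smooth 2 (plateau N lo hi).
  have c0 := derive_continuous (@plateau_derive N lo hi).
  have c1 := derive_continuous (@dplateau_derive N lo hi).
  split => //; exists (dplateau N lo hi); first exact: plateau_derive.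
  split => //; exists (ddplateau N lo hi); first exact: dplateau_derive.
  by split => //; exact: ddplateau_continuous.
split; first exact: charprod_class.
pose A := [set p : R * R | (eta + N^-1 <= p.1 + p.2 <= xi - N^-1) /\ (N^-1 <= p.1 - p.2 <= eta - N^-1)].
exists A.
  split; last by move=> [x y] [/= /andP[? ?] /andP[? ?]]; rewrite /open_sector/=; apply/andP; split; lra.
  apply: (@subclosed_compact _ _ ([set` `[0, xi + eta]] `*` [set` `[0, xi + eta]])).
  - have -> : A = (fun p : R * R => p.1 + p.2) @^-1` [set` `[eta + N^-1, xi - N^-1]] `&`
       (fun p : R * R => p.1 - p.2) @^-1` [set` `[N^-1, eta - N^-1]].
      by apply/seteqP; split => p /=; rewrite !in_itv/= => -[].
    apply: closedI; apply: preimage_closed; try exact: interval_closed.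
      by move=> p _; apply: cvgD; [exact: cvg_fst|exact: cvg_snd].
    by move=> p _; apply: cvgB; [exact: cvg_fst|exact: cvg_snd].
  - by apply: compact_setX; exact: segment_compact.
  - by move=> [x y] [/= /andP[? ?] /andP[? ?]]; rewrite /= !in_itv/=; split; apply/andP; split; lra.
move=> x y nA; rewrite /charprod.
have [h|h] := boolP (eta + N^-1 <= x + y <= xi - N^-1); last by rewrite plateau_supp// mul0r.
rewrite [X in _ * X]plateau_supp ?mulr0//; first by rewrite subr0.
by apply/negP => h'; apply: nA; split => //=; move: h'; rewrite add0r.
Qed.
End test_functions.

(** * Borel measurability and scaling in the plane *)

Section plane.
Variable R : realType.
Notation mu := (@lebesgue_measure R).
Notation mu2 := (@mu2 R).
Local Notation TR := (measurableTypeR R).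
Local Notation TR2 := (measurableTypeR R * measurableTypeR R)%type.

Lemma open_measurable2 (U : set (R * R)) : open U -> measurable (U : set TR2).
Proof.
move=> oU.
pose B (i : rat * rat * nat) : set (R * R) :=
  ball (ratr i.1.1 : R) (i.2.+1%:R^-1 : R) `*` ball (ratr i.1.2 : R) (i.2.+1%:R^-1 : R).
(* The intersection with a constant set selects the rational squares contained in U while the union
   still runs over a countable type. *)
have -> : U = \bigcup_i (B i `&` [set _ | B i `<=` U]).
  apply/seteqP; split; last by move=> p [i _ [h1 h2]]; exact: h2.
  move=> [x y] Uxy.
  have /nbhs_ballP[e /= e0 be] : nbhs (x, y) U by apply: open_nbhs_nbhs; split.
  have [n hn] : exists n : nat, n.+1%:R^-1 < e / 2.
    have : 0 < e / 2 by rewrite divr_gt0.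
    by move/ltr_add_invr => /= [n]; rewrite add0r => hn; exists n.
  have n0 : (0 : R) < n.+1%:R^-1 by rewrite invr_gt0.
  have rx (z : R) : exists a : rat, `|ratr a - z| < n.+1%:R^-1.
    have /rat_in_itvoo[a] : z < z + n.+1%:R^-1 by rewrite ltrDl.
    rewrite in_itv/= => /andP[h1 h2]; exists a; by rewrite ger0_norm ?subr_ge0 ?ltW// ltrBlDl.
  have [a ha] := rx x; have [b hb] := rx y.
  exists (a, b, n) => //; split; first by split; rewrite /ball/=.
  move=> -[u v] [/= h1 h2]; apply: be; rewrite /ball/=.
  move: h1 h2; rewrite /ball/= => h1 h2; split => /=; rewrite /ball/=.
    have -> : x - u = (x - ratr a) + (ratr a - u) by ring.
    rewrite (le_lt_trans (ler_normD _ _))// [ltRHS](splitr e) ltrD// ?(lt_trans h1 hn)//.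
    by rewrite (lt_trans _ hn)// distrC.
  have -> : y - v = (y - ratr b) + (ratr b - v) by ring.
  rewrite (le_lt_trans (ler_normD _ _))// [ltRHS](splitr e) ltrD// ?(lt_trans h2 hn)//.
  by rewrite (lt_trans _ hn)// distrC.
apply: countable_bigcupT_measurable => // i.
have [h|h] := pselect (B i `<=` U); last first.
  by rewrite (_ : _ `&` _ = set0)//; apply/seteqP; split => // z [].
rewrite (_ : _ `&` _ = B i); last by apply/seteqP; split => z // [].
by apply: measurableX; apply: open_measurable; exact: ball_open.
Qed.

Lemma continuous_mfun2 (k : R * R -> R) : continuous k -> measurable_fun [set: TR2] (k : TR2 -> R).
Proof.
move=> /continuousP ck; apply: (measurability _ (RGenOpens.measurableE R)).
move=> _ [_ [a [b ->] <-]]; rewrite setTI; apply: open_measurable2.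
exact/ck/interval_open.
Qed.

Lemma continuous_comp2 d (T : measurableType d) (k : R -> R -> R) (f g : T -> R) :
  continuous (fun z : R * R => k z.1 z.2) ->
  measurable_fun setT f -> measurable_fun setT g ->
  measurable_fun setT (fun z => k (f z) (g z)).
Proof.
move=> ck mf mg.
exact: (measurableT_comp (continuous_mfun2 ck) (measurable_fun_pair mf mg)).
Qed.

Lemma int2_scale F (c d e : R) : 0 < e -> bs2 F ->
  \int[mu2]_z F z = e ^+ 2 * \int[mu2]_z F (e * z.1 + c, e * z.2 + d).
Proof.
move=> e0 bF.
have e0' : e != 0 by rewrite gt_eqF.
have bF' : bs2 (fun z => F (e * z.1 + c, e * z.2 + d)).
  have := bF; move=> [mF [B [M H]]]; split.
    apply: (measurableT_comp mF); apply: measurable_fun_pair => //;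
      apply: measurable_funD => //; apply: measurable_funM => //.
  exists B, ((`|M| + `|c| + `|d|) / e) => z.
  have [h1 h2] := H (e * z.1 + c, e * z.2 + d); split => // h; apply: h2.
  apply: contra h => /= /andP[u v].
  have w (x t : R) : `|e * x + t| <= M -> `|t| <= `|c| + `|d| -> `|x| <= (`|M| + `|c| + `|d|) / e.
    move=> h1' h2'; rewrite ler_pdivlMr// mulrC -[X in X * _](gtr0_norm e0) -normrM.
    have -> : e * x = e * x + t - t by ring.
    rewrite (le_trans (ler_normB _ _))// -addrA lerD// (le_trans h1')// ler_norm//.
  by rewrite (w _ c)// ?(w _ d)// ?lerDl ?lerDr.
rewrite (fubini12 bF) (fubini12 bF') /=.
rewrite (int_affine c e0); last exact: bs2_fubini_bs1.
have h x : \int[mu]_y F (x, y) = e * \int[mu]_y F (x, e * y + d).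
  by rewrite (int_affine d e0)//; exact: bs2_section1.
under eq_Rintegral do rewrite h.
rewrite int1Z ?mulrA ?expr2//.
exact: (bs2_fubini_bs1 bF').
Qed.
End plane.

Ltac mfun := repeat lazymatch goal with
  | |- measurable_fun _ (fun _ => ?a) => exact: measurable_cst
  | |- measurable_fun _ (fun z => (@?f z) - (@?g z)) => apply: (@measurable_funB _ _ _ _ f g)
  | |- measurable_fun _ (fun z => (@?f z) + (@?g z)) => apply: (@measurable_funD _ _ _ _ f g)
  | |- measurable_fun _ (fun z => (@?f z) * (@?g z)) => apply: (@measurable_funM _ _ _ _ f g)
  | |- measurable_fun _ (fun z => (@?f z) && (@?g z)) => apply: (@measurable_and _ _ _ f g)
  | |- measurable_fun _ (fun z => (@?f z) <= (@?g z)) => apply: (@measurable_fun_ler _ _ _ _ f g)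
  | |- measurable_fun _ (fun z => (@?f z) < (@?g z)) => apply: (@measurable_fun_ltr _ _ _ _ f g)
  | |- measurable_fun _ (fun z => z) => exact: measurable_id
  | |- measurable_fun _ (fun z => fst z) => exact: measurable_fst
  | |- measurable_fun _ (fun z => snd z) => exact: measurable_snd
  | |- measurable_fun _ fst => exact: measurable_fst
  | |- measurable_fun _ snd => exact: measurable_snd
  | |- _ => first [assumption | apply: measurable_fun_ifT]
  end.

(** * From the weak wave equation to integral identities *)

Section weak_form.
Variable R : realType.
Notation mu := (@lebesgue_measure R).
Notation mu2 := (@mu2 R).
Local Notation TR := (measurableTypeR R).
Local Notation TR2 := (measurableTypeR R * measurableTypeR R)%type.
Variables (k : R -> R -> R) (C : R).
Hypothesis ck : continuous (fun z : R * R => k z.1 z.2).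
Hypothesis bk : forall x y, `|k x y| <= C.

Let C0 : 0 <= C. Proof. exact: le_trans (bk 0 0). Qed.

Let mbump d (T : measurableType d) (f : T -> R) : measurable_fun setT f ->
  measurable_fun setT (fun z => bump (f z)).
Proof. by move=> mf; exact: (measurableT_comp (continuous_mfun (@bump_continuous R)) mf). Qed.

Lemma bump_out (u : R) : ~~ (`|u| <= 3) -> bump u = 0.
Proof.
by rewrite ler_norml negb_and -!ltNge => /orP[h|h]; [apply: bump_lo|apply: bump_hi]; lra.
Qed.

Definition bump2 (z : R * R) : R := bump z.1 * bump z.2.

Lemma bs2_bump2 : bs2 bump2.
Proof.
split; first by apply: measurable_funM; exact: mbump.
exists 4, 3 => z; split.
  rewrite /bump2 normrM; have := bump_le z.1; have := bump_le z.2 => h1 h2.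
  rewrite (_ : 4 = 2 * 2 :> R); last by ring.
  by rewrite ler_pM.
by rewrite negb_and /bump2 => /orP[|] /bump_out ->; rewrite ?mulr0 ?mul0r.
Qed.

Lemma int_bump2 : \int[mu2]_z bump2 z = 1.
Proof.
rewrite (fubini12 bs2_bump2) /bump2 /=.
rewrite (_ : (fun x => _) = @bump R) ?int_bump//.
by apply/funext => x; rewrite int1Z ?int_bump ?mulr1//; exact: bs1_bump.
Qed.

(** The mean of k, weighted by [bump2], at scale e around the point with x + y = c and x - y = d.
    The scale sits in the argument of k, so that it can tend to 0 under the integral by continuity
    of k. *)
Definition corner (c d e : R) : R :=
  \int[mu2]_z (k ((c + d + e * (z.1 + z.2)) / 2) ((c - d + e * (z.1 - z.2)) / 2) * bump2 z).

Lemma corner_cvg (c_ d_ e_ : nat -> R) (c d : R) :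
  c_ @ \oo --> c -> d_ @ \oo --> d -> e_ @ \oo --> 0 ->
  (fun n => corner (c_ n) (d_ n) (e_ n)) @ \oo --> k ((c + d) / 2) ((c - d) / 2).
Proof.
move=> cc cd ce.
have [mb [B [M H]]] := bs2_bump2.
have [||||_] := @int2_dct R (fun n z => k ((c_ n + d_ n + e_ n * (z.1 + z.2)) / 2)
   ((c_ n - d_ n + e_ n * (z.1 - z.2)) / 2) * bump2 z)
   (fun z => k ((c + d) / 2) ((c - d) / 2) * bump2 z) (C * B) M.
- move=> n; apply: measurable_funM; last exact: mb.
  by apply: (continuous_comp2 ck); mfun.
- by apply: measurable_funM; [exact: measurable_cst|exact: mb].
- move=> n z; have [h1 h2] := H z; split; first by rewrite normrM ler_pM.
  by move/h2 => ->; rewrite mulr0.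
- move=> z; apply: cvgM; last exact: cvg_cst.
  have h1 : (fun n => (c_ n + d_ n + e_ n * (z.1 + z.2)) / 2) @ \oo --> (c + d) / 2.
    apply: cvgM; last exact: cvg_cst.
    rewrite -[X in _ --> X]addr0; apply: cvgD; first exact: cvgD.
    by rewrite -[X in _ --> X](mul0r (z.1 + z.2)); apply: cvgM => //; exact: cvg_cst.
  have h2 : (fun n => (c_ n - d_ n + e_ n * (z.1 - z.2)) / 2) @ \oo --> (c - d) / 2.
    apply: cvgM; last exact: cvg_cst.
    rewrite -[X in _ --> X]addr0; apply: cvgD; first exact: cvgB.
    by rewrite -[X in _ --> X](mul0r (z.1 - z.2)); apply: cvgM => //; exact: cvg_cst.
  have := @cvg_comp _ _ _ _ (fun z : R * R => k z.1 z.2) _ _ _ (cvg_pair h1 h2) (@ck (((c + d) / 2), ((c - d) / 2))).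
  exact.
- by rewrite int2Z ?int_bump2 ?mulr1//; exact: bs2_bump2.
Qed.

Definition kbump (N c d : R) (z : R * R) : R :=
  k z.1 z.2 * bump2 (N * (z.1 + z.2 - c), N * (z.1 - z.2 - d)).

Lemma bs2_kbump N c d : 0 < N -> bs2 (kbump N c d).
Proof.
move=> N0; have N0' : N != 0 by rewrite gt_eqF.
split.
  apply: measurable_funM; first exact: continuous_mfun2.
  by apply: measurable_funM; apply: mbump => /=; mfun.
have [_ [B [M H]]] := bs2_bump2.
exists (C * B), ((`|M| / N + `|c| + `|d|)) => z.
have [h1 h2] := H (N * (z.1 + z.2 - c), N * (z.1 - z.2 - d)); split.
  by rewrite normrM ler_pM.
move=> h; rewrite /kbump h2 ?mulr0//; apply: contra h => /= /andP[].
rewrite !normrM (gtr0_norm N0) => h3 h4.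
have g3 : `|z.1 + z.2 - c| <= `|M| / N by rewrite ler_pdivlMr// mulrC (le_trans h3)// ler_norm.
have g4 : `|z.1 - z.2 - d| <= `|M| / N by rewrite ler_pdivlMr// mulrC (le_trans h4)// ler_norm.
move: g3 g4; have := ler_norm c; have := ler_norm (- c); have := ler_norm d; have := ler_norm (- d).
rewrite !normrN !ler_norml => h5 h6 h7 h8 /andP[? ?] /andP[? ?].
by apply/andP; split; apply/andP; split; lra.
Qed.

Lemma int_kbump N c d : 0 < N ->
  \int[mu2]_z kbump N c d z = (2 * N ^+ 2)^-1 * corner c d N^-1.
Proof.
move=> N0; have N0' : N != 0 by rewrite gt_eqF.
have bk' := bs2_kbump c d N0.
rewrite (int2_char bk') (int2_scale c d (_ : 0 < N^-1)) ?invr_gt0//; last exact: (bs2_char bk').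
rewrite mulrA; congr (_ * _); first by field.
apply: eq_Rintegral => z _; rewrite /kbump /=; congr (k _ _ * bump2 (_, _)); by field.
Qed.

Variables (p : R -> R).
Hypothesis mp : measurable_fun [set: TR] (p : TR -> R).
Hypothesis bp : forall x, `|p x| <= C.
Hypothesis p0 : forall x, ~~ (0 <= x <= 1) -> p x = 0.

(* the wave equation tested against f (x + y) g (x - y), for which the box
   operator is 4 f' g' *)
Definition plateau_wave_equation := forall N eta xi : R, 0 < N -> 0 < eta -> 5 * N^-1 <= eta ->
  5 * N^-1 <= xi - eta -> xi + eta <= 4 ->
  \int[mu2]_z (k z.1 z.2 * (4 * charprod (dplateau N eta xi) (dplateau N 0 eta) z.1 z.2)
    - p z.1 * k z.1 z.2 * charprod (plateau N eta xi) (plateau N 0 eta) z.1 z.2) = 0.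

Definition rect (eta xi : R) (z : R * R) : bool :=
  (eta < z.1 + z.2 < xi) && (0 < z.1 - z.2 < eta).

Lemma mplateau N lo hi d (T : measurableType d) (f : T -> R) : measurable_fun setT f ->
  measurable_fun setT (fun z => plateau N lo hi (f z)).
Proof.
move=> mf; apply: measurableT_comp mf; apply: continuous_mfun.
exact: derive_continuous (@plateau_derive R N lo hi).
Qed.

(** The product f' g' consists of four approximate point masses with signs +, -, -, + at the corners
    (eta, 0), (eta, eta), (xi, 0), (xi, eta) in the coordinates (x + y, x - y). The left-hand side
    is the mixed difference of k over these corners; on the right the plateaus tend to the indicator
    of the rectangle. *)
Lemma rect_identity (eta xi : R) : plateau_wave_equation -> 0 < eta -> eta < xi -> xi + eta <= 4 ->
  2 * (k (eta / 2) (eta / 2) - k eta 0 - k (xi / 2) (xi / 2) + k ((xi + eta) / 2) ((xi - eta) / 2))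
  = \int[mu2]_z ((rect eta xi z)%:R * (p z.1 * k z.1 z.2)).
Proof.
move=> W e0 ex x4.
(* Any N >= N0 satisfies both conditions 5 / N <= eta and 5 / N <= xi - eta of
   [plateau_wave_equation]. *)
pose N0 : R := 5 / eta + 5 / (xi - eta).
have d0 : 0 < xi - eta by rewrite subr_gt0.
have N00 : 0 < N0 by rewrite addr_gt0// divr_gt0.
pose N n : R := N0 + n%:R.
have Np n : 0 < N n by rewrite ltr_wpDr.
have NV : (fun n => (N n)^-1) @ \oo --> (0 : R).
  apply: (@squeeze_cvgr _ _ _ _ (cst 0) (fun n => n%:R^-1)); last 2 first.
  - exact: cvg_cst.
  - apply/gtr0_cvgV0; first by near=> n; rewrite ltr0n; near: n; exact: nbhs_infty_gt.
    exact: cvgr_idn.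
  near=> n; rewrite invr_ge0 ltW//= lef_pV2 ?posrE// ?lerDr ?ltW//.
  by rewrite ltr0n; near: n; exact: nbhs_infty_gt.
have Ne n : 5 * (N n)^-1 <= eta.
  rewrite ler_pdivrMr// mulrC -ler_pdivrMr// /N /N0.
  have : 0 <= 5 / (xi - eta) by rewrite divr_ge0// ltW.
  by have : 0 <= n%:R :> R by []; lra.
have Nx n : 5 * (N n)^-1 <= xi - eta.
  rewrite ler_pdivrMr// mulrC -ler_pdivrMr// /N /N0.
  have : 0 <= 5 / eta by rewrite divr_ge0// ltW.
  by have : 0 <= n%:R :> R by []; lra.
pose B n z := p z.1 * k z.1 z.2 * charprod (plateau (N n) eta xi) (plateau (N n) 0 eta) z.1 z.2.
have Bb n z : `|B n z| <= C * C * 16 /\ (~~ ((`|z.1| <= 4) && (`|z.2| <= 4)) -> B n z = 0).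
  have Ni : 0 < (N n)^-1 by rewrite invr_gt0.
  split.
    rewrite /B /charprod !normrM (_ : 16 = 4 * 4); last by ring.
    rewrite !ler_pM ?mulr_ge0// ?plateau_bound//.
  move=> h; rewrite /B /charprod.
  have [h1|h1] := boolP (eta + (N n)^-1 <= z.1 + z.2 <= xi - (N n)^-1); last by rewrite plateau_supp// mul0r mulr0.
  rewrite [X in _ * (_ * X)]plateau_supp ?mulr0// ?subr0//.
  apply: contra h; rewrite add0r => h2; rewrite !ler_norml.
  move/andP : h1 => [? ?]; move/andP : h2 => [? ?].
  by apply/andP; split; apply/andP; split; lra.
have mB n : measurable_fun [set: TR2] (B n : TR2 -> R).
  apply: measurable_funM; first apply: measurable_funM.
  - exact: measurableT_comp.
  - exact: continuous_mfun2.
  - by apply: measurable_funM; apply: mplateau; mfun.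
have bB n : bs2 (B n) by split => //; exists (C * C * 16), 4; exact: Bb.
pose L z : R := (rect eta xi z)%:R * (p z.1 * k z.1 z.2).
have mL : measurable_fun [set: TR2] (L : TR2 -> R).
  apply: measurable_funM; last first.
    by apply: measurable_funM; [exact: measurableT_comp|exact: continuous_mfun2].
  rewrite (_ : (fun z => (rect eta xi z)%:R) = (fun z => if rect eta xi z then 1 else 0)); last first.
    by apply/funext => z; case: rect.
  by apply: measurable_fun_ifT => //; mfun.
have [//|//|||_ cB] := @int2_dct R B L (C * C * 16) 4.
  exact: Bb.
  move=> z; rewrite /B /L /rect /charprod -mulnb natrM [X in _ --> X]mulrC.
  apply: cvgM; first exact: cvg_cst.
  by apply: cvgM; apply: plateau_lim.
(* The factor 2 is 4 N^2, from the wave operator and the two inner derivatives, times (2 N^2)^-1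
   from [int_kbump]. *)
have eqn n : \int[mu2]_z B n z = 2 * (corner (eta + (N n)^-1) (0 + (N n)^-1) (N n)^-1
  - corner (eta + (N n)^-1) (eta - 4 * (N n)^-1) (N n)^-1
  - corner (xi - 4 * (N n)^-1) (0 + (N n)^-1) (N n)^-1
  + corner (xi - 4 * (N n)^-1) (eta - 4 * (N n)^-1) (N n)^-1).
  have := W _ _ _ (Np n) e0 (Ne n) (Nx n) x4.
  pose kb c d := kbump (N n) c d.
  have bkb c d : bs2 (kb c d) by exact: bs2_kbump.
  pose c1 := eta + (N n)^-1; pose c2 := xi - 4 * (N n)^-1.
  pose d1 := 0 + (N n)^-1; pose d2 := eta - 4 * (N n)^-1.
  have -> : (fun z => k z.1 z.2 * (4 * charprod (dplateau (N n) eta xi) (dplateau (N n) 0 eta) z.1 z.2)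
    - p z.1 * k z.1 z.2 * charprod (plateau (N n) eta xi) (plateau (N n) 0 eta) z.1 z.2) =
    (fun z => (4 * N n ^+ 2) * (kb c1 d1 z - kb c1 d2 z - kb c2 d1 z + kb c2 d2 z) - B n z).
    apply/funext => z; congr (_ - _).
    by rewrite /kb /kbump /charprod /dplateau /bump2 /= -/c1 -/c2 -/d1 -/d2; ring.
  have bs : bs2 (fun z => kb c1 d1 z - kb c1 d2 z - kb c2 d1 z + kb c2 d2 z).
    by apply: bs2_add => //; apply: bs2_sub => //; exact: bs2_sub.
  rewrite int2B; [|exact: bs2_scale|exact: bB].
  move/eqP; rewrite subr_eq0 => /eqP <-.
  rewrite int2Z// int2D//; last by apply: bs2_sub => //; exact: bs2_sub.
  rewrite int2B//; last exact: bs2_sub.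
  rewrite int2B// !int_kbump//.
  have N0' : N n != 0 by rewrite gt_eqF.
  by field.
apply/esym; apply: (cvg_unique _ cB); first exact: Rhausdorff.
rewrite (funext eqn).
have cst4 x : (fun n => x - 4 * (N n)^-1) @ \oo --> x.
  rewrite -[X in _ --> X]subr0; apply: cvgB; first exact: cvg_cst.
  by rewrite -[X in _ --> X](mulr0 4); apply: cvgM => //; exact: cvg_cst.
have cst1 x : (fun n => x + (N n)^-1) @ \oo --> x.
  by rewrite -[X in _ --> X]addr0; apply: cvgD => //; exact: cvg_cst.
apply: cvgM; first exact: cvg_cst.
apply: cvgD; first apply: cvgB; first apply: cvgB.
- have := corner_cvg (cst1 eta) (cst1 0) NV; rewrite addr0 subr0; exact.
- have := corner_cvg (cst1 eta) (cst4 eta) NV; rewrite subrr mul0r (_ : (eta + eta) / 2 = eta); [exact|by field].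
- have := corner_cvg (cst4 xi) (cst1 0) NV; rewrite addr0 subr0; exact.
- exact: corner_cvg (cst4 xi) (cst4 eta) NV.
Unshelve. all: by end_near. Qed.

End weak_form.

(** * From the characteristic rectangle to strips and cones *)

Section cones.
Variable R : realType.
Notation mu := (@lebesgue_measure R).
Notation mu2 := (@mu2 R).
Local Notation TR := (measurableTypeR R).
Local Notation TR2 := (measurableTypeR R * measurableTypeR R)%type.

Lemma measurable_natb d (T : measurableType d) (b : T -> bool) :
  measurable_fun setT b -> measurable_fun setT (fun z => (b z)%:R : R).
Proof.
move=> mb; rewrite (_ : (fun z => _) = (fun z => if b z then 1 else 0)); last first.
  by apply/funext => z; case: (b z).
exact: measurable_fun_ifT.
Qed.

Lemma ae_notin (l : seq R) : {ae mu, forall t, t \notin l}.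
Proof.
elim: l => [|x l IH]; first exact: aeW.
by apply: (aeS2 IH (ae_neq x)) => t h1 h2; rewrite inE negb_or h2.
Qed.

Variables (p : R -> R) (k : R -> R -> R) (C : R).
Hypothesis ck : continuous (fun z : R * R => k z.1 z.2).
Hypothesis bk : forall x y, `|k x y| <= C.
Hypothesis mp : measurable_fun [set: TR] (p : TR -> R).
Hypothesis bp : forall x, `|p x| <= C.
Hypothesis p0 : forall x, ~~ (0 <= x <= 1) -> p x = 0.
Hypothesis kodd : forall s t, k s (- t) = - k s t.

Let C0 : 0 <= C. Proof. exact: le_trans (bk 0 0). Qed.

Definition pk (z : R * R) := p z.1 * k z.1 z.2.

Lemma measurable_pk : measurable_fun [set: TR2] (pk : TR2 -> R).
Proof.
apply: measurable_funM; first exact: (measurableT_comp mp measurable_fst).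
exact: continuous_mfun2.
Qed.

Lemma bs2_pk (w : R * R -> R) (B M : R) : measurable_fun [set: TR2] (w : TR2 -> R) ->
  (forall z, `|w z| <= B) -> (forall z, 0 <= z.1 <= 1 -> ~~ (`|z.2| <= M) -> w z = 0) ->
  bs2 (fun z => w z * pk z).
Proof.
move=> mw wB wM; split; first by apply: measurable_funM => //; exact: measurable_pk.
exists (B * (C * C)), (Num.max 1 M) => z; split.
  by rewrite !normrM ler_pM ?mulr_ge0// ler_pM.
rewrite negb_and => /orP[h|h].
  rewrite /pk p0 ?mul0r ?mulr0//; apply: contra h => /andP[h1 h2].
  by rewrite le_max ger0_norm// h2.
have [h1|h1] := boolP (0 <= z.1 <= 1); last by rewrite /pk p0// mul0r mulr0.
by rewrite wM ?mul0r//; apply: contra h => h; rewrite le_max h orbT.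
Qed.

(** On each line x = s the integrand is an even factor times a function odd in t. The list [l s]
    holds the boundary points of the sections, where the mixture of strict and weak inequalities
    would spoil evenness. *)
Lemma int_even0 (w : R * R -> R) (l : R -> seq R) (e : R -> R -> R) :
  bs2 (fun z => w z * pk z) ->
  (forall s t, t \notin l s -> w (s, t) = e s t) -> (forall s t, e s (- t) = e s t) ->
  \int[mu2]_z (w z * pk z) = 0.
Proof.
move=> bw we ee; rewrite (fubini12 bw).
rewrite (_ : (fun s => _) = (fun=> 0)) ?Rintegral_cst ?mul0r//.
apply/funext => s; pose g t := w (s, t) * pk (s, t).
have bg : bs1 g by exact: (bs2_section1 s bw).
suff : \int[mu]_t g t = - \int[mu]_t g t.
  by move=> /eqP; rewrite -addr_eq0 -mulr2n mulrn_eq0/= => /eqP.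
rewrite {1}(int_opp bg) -mulN1r -int1Z//.
apply: ae_int1; [exact: bs1_opp|exact: bs1_scale|].
apply: (aeS (ae_notin (l s ++ map -%R (l s)))) => t.
rewrite mem_cat negb_or => /andP[h1 h2].
have h3 : - t \notin l s.
  by apply: contra h2 => h; apply/mapP; exists (- t) => //; rewrite opprK.
by rewrite /g we// we// ee /pk /= kodd; ring.
Qed.

Lemma int_reflect (w : R * R -> R) : bs2 (fun z => w z * pk z) ->
  \int[mu2]_z (w (z.1, - z.2) * pk z) = - \int[mu2]_z (w z * pk z).
Proof.
move=> bw.
have bw' : bs2 (fun z => w (z.1, - z.2) * pk z).
  have [mw [B [M H]]] := bw.
  have mf : measurable_fun [set: TR2] (fun z : R * R => (z.1, - z.2) : TR2).
    apply: measurable_fun_pair => //; exact: (measurableT_comp (@measurable_oppR R) measurable_snd).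
  have E : (fun z => w (z.1, - z.2) * pk z) = (fun z => - (w (z.1, - z.2) * pk (z.1, - z.2))).
    by apply/funext => z; rewrite /pk/= kodd; ring.
  split.
    rewrite E; apply: (measurableT_comp (@measurable_oppR R)).
    exact: (measurableT_comp mw mf).
  exists B, M => z; have [h1 h2] := H (z.1, - z.2).
  rewrite (congr1 (fun f => f z) E) normrN; split => // h; rewrite h2 ?oppr0//=.
  by rewrite normrN.
rewrite (fubini12 bw) (fubini12 bw') -mulN1r -int1Z; last exact: (bs2_fubini_bs1 bw).
apply: eq_Rintegral => s _; rewrite (int_opp (bs2_section1 s bw)).
rewrite -int1Z; last exact: (bs1_opp (bs2_section1 s bw)).
by apply: eq_Rintegral => t _; rewrite /pk /= kodd; ring.
Qed.

Lemma bs1_p : bs1 p.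
Proof.
split => //; exists C, 1 => x; split => // h; apply: p0; apply: contra h => /andP[h1 h2].
by rewrite ger0_norm.
Qed.

Definition Qp (x : R) := \int[mu]_(t in `[0, x]) p t.

Lemma int_itv (f : R -> R) (u v : R) :
  \int[mu]_(t in `[u, v]) f t = \int[mu]_t ((u <= t <= v)%R%:R * f t).
Proof.
rewrite Rintegral_mkcond; apply: eq_Rintegral => t _; rewrite patchE.
by case: ifPn; rewrite ?inE ?notin_setE/= in_itv/= => h; [rewrite h mul1r|move/negP/negbTE : h => ->; rewrite mul0r].
Qed.

Lemma measurable_between (u v : R) d (T : measurableType d) (f : T -> R) :
  measurable_fun setT f -> measurable_fun setT (fun t => (u <= f t <= v)%R%:R : R).
Proof. by move=> mf; apply: measurable_natb; mfun. Qed.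

Lemma natb_le1 (b : bool) : `|b%:R : R| <= 1.
Proof. by case: b; rewrite ?normr1 ?normr0. Qed.

Lemma bs1_between (u v : R) f : bs1 f -> bs1 (fun t => (u <= t <= v)%R%:R * f t).
Proof.
apply: (@bs1_mul _ _ _ 1); last by move=> x; exact: natb_le1.
by apply: measurable_between; exact: measurable_id.
Qed.

Lemma bs1_betweeno (u v : R) f : bs1 f -> bs1 (fun t => (u < t < v)%R%:R * f t).
Proof.
apply: (@bs1_mul _ _ _ 1); last by move=> x; exact: natb_le1.
by apply: measurable_natb; mfun.
Qed.

Lemma int_prim_diff (f : R -> R) (u v : R) : bs1 f -> 0 <= u -> u <= v ->
  \int[mu]_(t in `[0, v]) f t - \int[mu]_(t in `[0, u]) f t =
  \int[mu]_t ((u < t < v)%R%:R * f t).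
Proof.
move=> bf u0 uv; rewrite !int_itv -int1B; [|exact: bs1_between..].
apply: ae_int1; [apply: bs1_sub; exact: bs1_between|exact: bs1_betweeno|].
apply: (aeS (ae_neq v)) => t tv; rewrite -mulrBl; congr (_ * _).
have [h1|h1] := leP 0 t; have [h2|h2] := leP t v; have [h3|h3] := leP t u => /=;
  rewrite ?subrr ?subr0//; try lra.
- by rewrite lt_neqAle tv h2.
- by rewrite ltNge (ltW h2).
Qed.

(** The integral of [pk] along the characteristic x + y = r, from the diagonal to the line x = a.
    The condition [0 <= r / 2] makes its support in r bounded, as [bs1] demands. *)
Definition Ek (a r : R) := \int[mu]_s (((0 <= r / 2)%R && (r / 2 <= s <= a)%R)%:R * pk (s, r - s)).
(* [gam a] is the density of the function [Gk a] for which the homogeneous part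
   of k on x <= a is Gk a (x + y) - Gk a (x - y), see [kernel_backE] *)
Definition gam (a r : R) := 4^-1 * p (r / 2) + 2^-1 * Ek a r.
Definition Gk (a x : R) := \int[mu]_(r in `[0, x]) gam a r.

Definition strip (eta xi a : R) (z : R * R) : bool := (eta < z.1 + z.2 < xi) && (z.2 <= z.1 <= a).

Lemma bs2_Ek a : bs2 (fun z : R * R => ((0 <= z.1 / 2)%R && (z.1 / 2 <= z.2 <= a)%R)%:R * pk (z.2, z.1 - z.2)).
Proof.
split.
  apply: measurable_funM; first by apply: measurable_natb; mfun.
  apply: (measurableT_comp measurable_pk); apply: measurable_fun_pair; mfun.
exists (1 * (C * C)), 2 => z; split.
  by rewrite normrM ler_pM ?natb_le1// /pk normrM ler_pM.
have [h1|] := boolP (0 <= z.2 <= 1); last by move=> h1 _; rewrite /pk p0 ?mul0r ?mulr0.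
move=> h; rewrite (_ : _ && _ = false) ?mul0r//; apply/negP => /andP[h2 /andP[h3 h4]].
move/negP: h; apply; move/andP : h1 => [h1 h5]; rewrite !ler_norml.
by apply/andP; split; apply/andP; split; lra.
Qed.

Lemma bs1_Ek a : bs1 (Ek a).
Proof. exact: (bs2_fubini_bs1 (bs2_Ek a)). Qed.

Lemma bs1_p2 : bs1 (fun r => p (r / 2)).
Proof.
have := @bs1_affine R 2^-1 0 p _ bs1_p; rewrite invr_eq0 pnatr_eq0 => /(_ isT).
by under [X in bs1 X -> _]eq_fun do rewrite addr0 mulrC.
Qed.

Lemma bs1_gam a : bs1 (gam a).
Proof. by apply: bs1_add; apply: bs1_scale; [exact: bs1_p2|exact: bs1_Ek]. Qed.

Lemma bs2_strip eta xi a : bs2 (fun z => (strip eta xi a z)%:R * pk z).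
Proof.
apply: (@bs2_pk _ 1 (`|eta| + `|xi| + 1)) => [|z|z]; last 2 first.
- exact: natb_le1.
- move=> /andP[z0 z1] h; rewrite (_ : strip _ _ _ _ = false)//; apply/negP => /andP[/andP[h1 h2] _].
  move/negP : h; apply; rewrite ler_norml.
  have := ler_norm eta; have := ler_norm (- eta); have := ler_norm xi; have := ler_norm (- xi).
  have := normr_ge0 eta; have := normr_ge0 xi.
  by rewrite !normrN; move=> *; apply/andP; split; lra.
by apply: measurable_natb; rewrite /strip; mfun.
Qed.

Lemma gam_strip (a eta xi : R) : 0 <= eta -> eta <= xi ->
  2 * \int[mu]_r ((eta < r < xi)%R%:R * gam a r) =
  Qp (xi / 2) - Qp (eta / 2) + \int[mu2]_z ((strip eta xi a z)%:R * pk z).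
Proof.
move=> e0 ex; rewrite (int2_shear (bs2_strip eta xi a)).
rewrite int_prim_diff ?divr_ge0//; [|exact: bs1_p|lra].
rewrite -int1Z; last exact: bs1_betweeno (bs1_gam a).
have -> : \int[mu]_t ((eta / 2 < t < xi / 2)%R%:R * p t) =
  \int[mu]_r (2^-1 * ((eta < r < xi)%R%:R * p (r / 2))).
  rewrite int1Z; last exact: bs1_betweeno bs1_p2.
  rewrite (@int_affine R 2^-1 0) ?invr_gt0//; last exact: bs1_betweeno bs1_p.
  congr (_ * _); apply: eq_Rintegral => r _; rewrite addr0 (mulrC 2^-1 r).
  by congr (_%:R * _); congr (_ && _); rewrite ltr_pM2r ?invr_gt0.
rewrite -int1D; last first.
- have := bs2_fubini_bs1 (bs2_swap (bs2_shear (bs2_strip eta xi a))).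
  exact.
- by apply: bs1_scale; exact: bs1_betweeno bs1_p2.
apply: eq_Rintegral => r _; rewrite /gam.
have -> : \int[mu]_s ((strip eta xi a (s, r - s))%:R * pk (s, r - s)) = (eta < r < xi)%R%:R * Ek a r.
  rewrite -int1Z; last exact: (bs2_section1 r (bs2_Ek a)).
  apply: eq_Rintegral => s _; rewrite mulrA; congr (_ * _); rewrite -natrM mulnb /strip /=.
  congr (_%:R); rewrite addrC subrK; case: (ltP eta r) => //= h; congr (_ && _).
  have -> : 0 <= r / 2 by rewrite divr_ge0// ltW// (le_lt_trans e0).
  by rewrite /= lerBlDr ler_pdivrMr// mulr_natr.
by field.
Qed.


Hypothesis W : plateau_wave_equation k p.
Hypothesis kdiag : forall x, 0 <= x <= 2 -> k x x = 2^-1 * Qp x.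

Lemma Qp0 : Qp 0 = 0.
Proof. by rewrite /Qp set_itv1 Rintegral_set1. Qed.

Lemma k0 x : k x 0 = 0.
Proof. by have := kodd x 0; rewrite oppr0 => /eqP; rewrite -addr_eq0 -mulr2n mulrn_eq0/= => /eqP. Qed.

(** Two corners of the rectangle lie on the diagonal and yield primitives of p; the corner on y = 0
    yields nothing. For y = x and y = 0 the rectangle is empty and the identity is one of the
    boundary conditions. *)
Lemma kernel_rect x y : 0 <= y <= x -> x <= 2 ->
  2 * k x y = Qp ((x + y) / 2) - Qp ((x - y) / 2) +
    \int[mu2]_z ((rect (x - y) (x + y) z)%:R * pk z).
Proof.
move=> /andP[y0 yx] x2.
have e0 u v : (forall z, rect u v z = false) -> \int[mu2]_z ((rect u v z)%:R * pk z) = 0.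
  move=> h; rewrite (_ : (fun z => _) = (fun=> 0)) ?Rintegral_cst ?mul0r//.
  by apply/funext => z; rewrite h mul0r.
have [yx'|xy] := eqVneq y x.
  rewrite yx' subrr e0; last first.
    by move=> z; apply/negP => /andP[_ /andP[? ?]]; lra.
  rewrite mul0r Qp0 subr0 addr0 kdiag; last by apply/andP; split; lra.
  by rewrite mulrA mulfV ?mul1r; [congr Qp; by field|].
have {}yx : y < x by rewrite lt_neqAle xy.
have [->|yn0] := eqVneq y 0.
  rewrite k0 subr0 addr0 subrr add0r mulr0 e0//.
  by move=> z; apply/negP => /andP[/andP[? ?] _]; lra.
have {yn0}y0 : 0 < y by rewrite lt_neqAle eq_sym yn0.
have := @rect_identity R k C ck bk p mp bp (x - y) (x + y) W.
rewrite subr_gt0 => /(_ yx) h; rewrite /pk -h; [|lra..].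
rewrite k0 !kdiag; [|apply/andP; split; lra..].
rewrite (_ : (x + y + (x - y)) / 2 = x); last by field.
rewrite (_ : (x + y - (x - y)) / 2 = y); last by field.
by field.
Qed.

Definition dcone (a x y : R) (z : R * R) : bool := (x <= z.1 <= a) && (`|z.2 - y| <= z.1 - x).
Definition fcone (a x y : R) (z : R * R) : bool := (a < z.1 <= x) && (`|z.2 - y| <= x - z.1).

Lemma measurable_absd (y : R) : measurable_fun [set: TR2] (fun z : TR2 => `|z.2 - y|).
Proof. by apply: (measurableT_comp (@normr_measurable R setT)); mfun. Qed.

Lemma measurable_dcone a x y : measurable_fun [set: TR2] (dcone a x y : TR2 -> bool).
Proof.
apply: measurable_and; first by mfun.
by apply: measurable_fun_ler; [exact: measurable_absd|mfun].
Qed.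

Lemma measurable_fcone a x y : measurable_fun [set: TR2] (fcone a x y : TR2 -> bool).
Proof.
apply: measurable_and; first by mfun.
by apply: measurable_fun_ler; [exact: measurable_absd|mfun].
Qed.

Lemma bs2_dcone a x y : bs2 (fun z => (dcone a x y z)%:R * pk z).
Proof.
apply: (@bs2_pk _ 1 (`|y| + 1 + `|x|)) => [|z|z]; last 2 first.
- exact: natb_le1.
- move=> /andP[z0 z1] h; rewrite (_ : dcone _ _ _ _ = false)//; apply/negP => /andP[_ h1].
  move/negP : h; apply; rewrite -(subrK y z.2) (le_trans (ler_normD _ _))//.
  by have := ler_norm (- x); rewrite normrN => *; lra.
exact: measurable_natb (measurable_dcone a x y).
Qed.

Lemma bs2_fcone a x y : bs2 (fun z => (fcone a x y z)%:R * pk z).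
Proof.
apply: (@bs2_pk _ 1 (`|y| + 1 + `|x|)) => [|z|z]; last 2 first.
- exact: natb_le1.
- move=> /andP[z0 z1] h; rewrite (_ : fcone _ _ _ _ = false)//; apply/negP => /andP[_ h1].
  move/negP : h; apply; rewrite -(subrK y z.2) (le_trans (ler_normD _ _))//.
  by have := ler_norm (x); move=> *; lra.
exact: measurable_natb (measurable_fcone a x y).
Qed.

Lemma bs2_rect eta xi : bs2 (fun z => (rect eta xi z)%:R * pk z).
Proof.
apply: (@bs2_pk _ 1 (`|eta| + `|xi| + 1)) => [|z|z]; last 2 first.
- exact: natb_le1.
- move=> /andP[z0 z1] h; rewrite (_ : rect _ _ _ = false)//; apply/negP => /andP[/andP[h1 h2] _].
  move/negP : h; apply; rewrite ler_norml.
  have := ler_norm eta; have := ler_norm (- eta); have := ler_norm xi; have := ler_norm (- xi).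
  have := normr_ge0 eta; have := normr_ge0 xi.
  by rewrite !normrN; move=> *; apply/andP; split; lra.
by apply: measurable_natb; rewrite /rect; mfun.
Qed.

Lemma sym_between (m t : R) : (- m < - t < m) = (- m < t < m).
Proof. by apply/andP/andP => -[? ?]; split; lra. Qed.

Lemma int_three (b1 b2 b3 : R * R -> bool) (l : R -> seq R) (e : R -> R -> R) :
  bs2 (fun z => (b1 z)%:R * pk z) -> bs2 (fun z => (b2 z)%:R * pk z) ->
  bs2 (fun z => (b3 z)%:R * pk z) ->
  (forall s t, t \notin l s -> (b1 (s, t))%:R - (b2 (s, t))%:R - (b3 (s, t))%:R = e s t) ->
  (forall s t, e s (- t) = e s t) ->
  \int[mu2]_z ((b1 z)%:R * pk z) =
  \int[mu2]_z ((b2 z)%:R * pk z) + \int[mu2]_z ((b3 z)%:R * pk z).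
Proof.
move=> h1 h2 h3 he ee; apply/eqP; rewrite -subr_eq0 opprD addrA; apply/eqP.
rewrite -int2B// -int2B//; last exact: bs2_sub.
have E : (fun z => (b1 z)%:R * pk z - (b2 z)%:R * pk z - (b3 z)%:R * pk z) =
    (fun z => ((b1 z)%:R - (b2 z)%:R - (b3 z)%:R) * pk z).
  by apply/funext => z; ring.
rewrite E; apply: (int_even0 _ he ee); rewrite -E.
by apply: bs2_sub => //; exact: bs2_sub.
Qed.

(** The sections of rectangle and strip differ by the symmetric interval |t| < s - eta, which an odd
    integrand does not see. Both cones rely on this for s up to the smaller of x and a. *)
Lemma strip_rect (s t eta xi a : R) : 0 <= eta -> eta + xi >= 2 * s -> eta <= xi -> s <= a ->
  t != s -> t != s - eta ->
  (rect eta xi (s, t))%:R - (strip eta xi a (s, t))%:R = - (eta - s < t < s - eta)%R%:R :> R.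
Proof.
move=> en0 sx ex sa ts te; rewrite /rect /strip /= sa andbT.
have [h|h|h] := ltgtP t (s - eta); last by rewrite h eqxx in te.
- rewrite (_ : (0 < s - t < eta) = false); last by apply/negP => /andP[? ?]; lra.
  rewrite andbF sub0r; congr (- (nat_of_bool _)%:R).
  by rewrite andbT; apply/idP/idP => [/andP[/andP[h1 h2] h3]|h1]; [lra|apply/andP; split; [apply/andP; split; lra|lra]].
- rewrite andbF; have [tl|tl] := ltP t s.
    rewrite (_ : (0 < s - t < eta) = true); last by apply/andP; split; lra.
    by rewrite (ltW tl) subrr oppr0.
  rewrite (_ : (t <= s) = false); last by apply/negP => h'; move/negP: ts; apply; apply/eqP; lra.
  rewrite (_ : (0 < s - t < eta) = false); last by apply/negP => /andP[? ?]; lra.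
  by rewrite !andbF subrr oppr0.
Qed.

Lemma half_diff (K Q1 Q2 G r s d : R) :
  2 * K = Q1 - Q2 + r -> 2 * G = Q1 - Q2 + s -> r = s + d -> K = G + 2^-1 * d.
Proof. lra. Qed.

Lemma kernel_back a x y : 0 <= y <= x -> x <= a -> a <= 2 ->
  k x y = \int[mu]_r ((x - y < r < x + y)%R%:R * gam a r) +
    2^-1 * \int[mu2]_z ((dcone a x y z)%:R * pk z).
Proof.
move=> yx xa a2; have [y0 yx'] := andP yx.
have h1 := kernel_rect yx (le_trans xa a2).
have := @gam_strip a (x - y) (x + y); rewrite subr_ge0 => /(_ yx') h2.
have {}h2 := h2 ltac:(lra).
suff : \int[mu2]_z ((rect (x - y) (x + y) z)%:R * pk z) =
    \int[mu2]_z ((strip (x - y) (x + y) a z)%:R * pk z) +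
    \int[mu2]_z ((dcone a x y z)%:R * pk z).
  by move=> h3; exact: (half_diff h1 h2 h3).
(* For x < s <= a the rectangle is empty, and the sections of strip and cone abut at t = x + y - s;
   together they fill the symmetric interval |t| < y + s - x. *)
clear h1 h2; pose e s t : R := if s <= x then - ((x - y) - s < t < s - (x - y))%R%:R
  else if s <= a then - (- (y + s - x) < t < y + s - x)%R%:R else 0.
apply: (int_three (l := fun s => [:: s; s - (x - y); x + y - s; y]) (e := e));
  [exact: bs2_rect|exact: bs2_strip|exact: bs2_dcone| |].
- move=> s t; rewrite !inE !negb_or => /and4P[t1 t2 t3 t4]; rewrite /e.
  have [sx|sx] := leP s x.
    rewrite (_ : dcone _ _ _ _ = false) ?subr0.
      by apply: strip_rect => //; lra.
    apply/negP => /andP[/= /andP[h3 h4] h5]; have sx' : s = x by lra.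
    by move: h5; rewrite sx' subrr normr_le0 subr_eq0 => h5; rewrite h5 in t4.
  rewrite (_ : rect _ _ _ = false); last first.
    by apply/negP => /andP[/= /andP[? ?] /andP[? ?]]; lra.
  have [sa|sa] := leP s a; last first.
    rewrite /strip /dcone /= !(leNgt _ a) sa !andbF /= subrr//.
    by rewrite subr0.
  rewrite /strip /dcone /= sa (ltW sx) /= andbT sub0r -opprD; congr (- _).
  rewrite ler_norml; have [h|h] := ltP t (x + y - s).
    rewrite (_ : (_ && (t - y <= s - x)) = false); last by apply/negP => /andP[? ?]; lra.
    rewrite addr0; congr ((nat_of_bool _)%:R); apply/idP/idP => [/andP[/andP[? ?] ?]|/andP[? ?]].
      by apply/andP; split; lra.
    by apply/andP; split; [apply/andP; split; lra|lra].
  rewrite (_ : (x - y < s + t < x + y) && _ = false); last first.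
    by apply/negP => /andP[/andP[? ?] ?]; lra.
  rewrite add0r; congr ((nat_of_bool _)%:R); apply/idP/idP => [/andP[h3 h4]|/andP[? ?]]; apply/andP; split; try lra.
- move=> s t; rewrite /e; case: ifP => _; last case: ifP => // _.
    by rewrite -(opprB s (x - y)) sym_between.
  by rewrite sym_between.
Qed.

(** For x beyond the line, the rectangle exceeds the strip instead, and the excess is the cone that
    looks back from (x, y) to x = a. The condition [y + (x - a) <= a] keeps the base of this cone
    below the diagonal point (a, a). *)
Lemma kernel_fwd a x y : 0 <= y -> a <= x -> x <= 2 -> y + (x - a) <= a ->
  k x y = \int[mu]_r ((x - y < r < x + y)%R%:R * gam a r) +
    2^-1 * \int[mu2]_z ((fcone a x y z)%:R * pk z).
Proof.
move=> y0 ax x2 ya; have yx : 0 <= y <= x by apply/andP; split; lra.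
have h1 := kernel_rect yx x2.
have := @gam_strip a (x - y) (x + y) ltac:(lra) ltac:(lra) => h2.
suff : \int[mu2]_z ((rect (x - y) (x + y) z)%:R * pk z) =
    \int[mu2]_z ((strip (x - y) (x + y) a z)%:R * pk z) +
    \int[mu2]_z ((fcone a x y z)%:R * pk z).
  by move=> h3; exact: (half_diff h1 h2 h3).
(* For a < s <= x the strip is empty, and the section of the cone exceeds that of the rectangle by
   the symmetric interval |t| < x - y - s, up to end points. *)
clear h1 h2; pose e s t : R := if s <= a then - ((x - y) - s < t < s - (x - y))%R%:R
  else if s <= x then - (- (x - y - s) < t < x - y - s)%R%:R else 0.
apply: (int_three (l := fun s => [:: s; s - (x - y); x + y - s; x - y - s]) (e := e));
  [exact: bs2_rect|exact: bs2_strip|exact: bs2_fcone| |].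
- move=> s t; rewrite !inE !negb_or => /and4P[t1 t2 t3 t4]; rewrite /e.
  have [sx|sx] := leP s a.
    rewrite (_ : fcone _ _ _ _ = false) ?subr0.
      by apply: strip_rect => //; lra.
    by apply/negP => /andP[/= /andP[h3 h4] h5]; lra.
  rewrite (_ : strip _ _ _ _ = false); last by apply/negP => /andP[/= _ /andP[? ?]]; lra.
  have [sa|sa] := leP s x; last first.
    rewrite /fcone /= !(leNgt _ x) sa !andbF /= subr0.
    rewrite (_ : rect _ _ _ = false) ?subr0//.
    by apply/negP => /andP[/= /andP[? ?] /andP[? ?]]; lra.
  rewrite /fcone /= sa sx /= subr0 /rect/= ler_norml.
  have [h|h] := boolP (s - (x - y) <= t <= x + y - s); last first.
    rewrite (_ : (- (x - s) <= t - y <= x - s) = false); last first.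
      by apply/negP => /andP[? ?]; move/negP: h; apply; apply/andP; split; lra.
    rewrite (_ : (x - y < s + t < x + y) && _ = false); last first.
      by apply/negP => /andP[/andP[? ?] /andP[? ?]]; move/negP: h; apply; apply/andP; split; lra.
    rewrite (_ : (_ < t < _) = false) ?subrr ?oppr0//.
    by apply/negP => /andP[? ?]; move/negP: h; apply; apply/andP; split; lra.
  have [h3 h4] := andP h.
  rewrite (_ : (- (x - s) <= t - y <= x - s) = true); last by apply/andP; split; lra.
  have [h5|h5] := ltP (x - y - s) t.
    rewrite (_ : (x - y < s + t < x + y) && _ = true); last first.
      have t2' : s - (x - y) < t by rewrite lt_neqAle eq_sym t2.
      have t3' : t < x + y - s by rewrite lt_neqAle t3.
      by apply/andP; split; apply/andP; split; lra.
    by rewrite subrr (_ : (_ < t < _) = false) ?oppr0//; apply/negP => /andP[? ?]; lra.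
  rewrite (_ : (x - y < s + t < x + y) && _ = false); last first.
    by apply/negP => /andP[/andP[? ?] /andP[? ?]]; lra.
  rewrite (_ : (_ < t < _) = true) ?sub0r//.
  have t2' : s - (x - y) < t by rewrite lt_neqAle eq_sym t2.
  have t4' : t < x - y - s by rewrite lt_neqAle t4.
  by apply/andP; split; lra.
- move=> s t; rewrite /e; case: ifP => _; last case: ifP => // _.
    by rewrite -(opprB s (x - y)) sym_between.
  by rewrite sym_between.
Qed.
End cones.

(** * Derivatives of the kernel on a line and the fixed-point equations *)

Section calculus.
Variable R : realType.
Notation mu := (@lebesgue_measure R).
Local Notation TR := (measurableTypeR R).

Lemma ae_scale (P : R -> Prop) (c d : R) : 0 < c -> {ae mu, forall x, P x} ->
  {ae mu, forall x, P (c * x + d)}.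
Proof.
move=> c0 [N [mN N0 PN]]; exists ((fun x => c * x + d) @^-1` N); split.
- by have := @measurable_affine R c d measurableT N mN; rewrite setTI.
- have := affine_lebesgue d c0 mN; rewrite [LHS]N0 => /esym/eqP.
  by rewrite mule_eq0 eqe gt_eqF//= => /eqP.
- by move=> x h; exact: PN.
Qed.

Lemma ae_opp (P : R -> Prop) : {ae mu, forall x, P x} -> {ae mu, forall x, P (- x)}.
Proof.
move=> [N [mN N0 PN]]; exists (-%R @^-1` N); split.
- by have := @measurable_oppR R measurableT N mN; rewrite setTI.
- by have := opp_lebesgue mN; rewrite [LHS]N0.
- by move=> x h; exact: PN.
Qed.

Lemma is_derive_small (f : R -> R) (a B : R) :
  (\forall x \near a, `|f x| <= B * (x - a) ^+ 2) -> is_derive a 1 f 0.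
Proof.
move=> fB.
have fa : f a = 0.
  by have := nbhs_singleton fB; rewrite subrr expr0n/= mulr0 normr_le0 => /eqP.
apply: is_derive_lim; rewrite fa.
apply/cvgr0Pnorm_le => e e0.
have fB' : \forall h \near (0 : R)^', `|f (h + a)| <= B * (h + a - a) ^+ 2.
  apply: nbhs_dnbhs.
  have ca : (fun h : R => h + a) @ 0 --> a.
    by rewrite -[X in _ --> X]add0r; apply: cvgD; [exact: cvg_id|exact: cvg_cst].
  exact: (ca _ fB).
have B0 : 0 < `|B| + 1 by rewrite ltr_wpDl.
near=> h.
have h0 : h != 0 by near: h; exact: nbhs_dnbhs_neq.
have hB : `|f (h + a)| <= B * (h + a - a) ^+ 2 by near: h.
rewrite addrK in hB; rewrite subr0 normrM normfV mulrC ler_pdivrMr ?normr_gt0//.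
rewrite (le_trans hB)// -normr_id -[h ^+ 2]real_normK ?num_real// normr_id expr2 mulrA.
apply: ler_wpM2r => //; rewrite (@le_trans _ _ ((`|B| + 1) * `|h|))//.
  by rewrite ler_wpM2r// (le_trans (ler_norm B))// lerDl.
rewrite mulrC -ler_pdivlMr//; near: h; apply: dnbhs0_le; by rewrite divr_gt0.
Unshelve. all: by end_near. Qed.
End calculus.

Section derivatives.
Variable R : realType.
Notation mu := (@lebesgue_measure R).
Notation mu2 := (@mu2 R).
Local Notation TR := (measurableTypeR R).
Local Notation TR2 := (measurableTypeR R * measurableTypeR R)%type.
Variables (p : R -> R) (k : R -> R -> R) (C : R).
Hypothesis ck : continuous (fun z : R * R => k z.1 z.2).
Hypothesis bk : forall x y, `|k x y| <= C.
Hypothesis mp : measurable_fun [set: TR] (p : TR -> R).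
Hypothesis bp : forall x, `|p x| <= C.
Hypothesis p0 : forall x, ~~ (0 <= x <= 1) -> p x = 0.
Hypothesis kodd : forall s t, k s (- t) = - k s t.
Hypothesis W : plateau_wave_equation k p.
Hypothesis kdiag : forall x, 0 <= x <= 2 -> k x x = 2^-1 * Qp p x.

Let C0 : 0 <= C. Proof. exact: le_trans (bk 0 0). Qed.

Local Notation pk := (pk p k).
Local Notation gam := (gam p k).
Local Notation Gk := (Gk p k).

Lemma bound_pk z : `|pk z| <= C * C.
Proof. by rewrite normrM ler_pM. Qed.

Lemma cone_bound (b : R * R -> bool) (u y d : R) : 0 <= d ->
  bs2 (fun z => (b z)%:R * pk z) ->
  (forall z, b z -> u <= z.1 <= u + d /\ y - d <= z.2 <= y + d) ->
  `|\int[mu2]_z ((b z)%:R * pk z)| <= 2 * (C * C) * d ^+ 2.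
Proof.
move=> d0 bb bd; rewrite (fubini12 bb).
have -> : 2 * (C * C) * d ^+ 2 = (C * C * (2 * d)) * d by ring.
have bf : bs1 (fun x => \int[mu]_y0 ((b (x, y0))%:R * pk (x, y0))) := bs2_fubini_bs1 bb.
apply: (bs1_le bf d0 _ (u := u)).
  move=> s; have bs := bs2_section1 s bb.
  apply: (bs1_le bs _ _ (u := y - d)); first by rewrite mulr_ge0.
    move=> t; rewrite normrM -[leRHS]mul1r ler_pM//; [exact: natb_le1|exact: bound_pk].
  move=> t h; case bE : (b (s, t)); last by rewrite mul0r.
  by have [_ h2] := bd _ bE; move/negP : h; case; move: h2 => /= /andP[? ?]; apply/andP; split; lra.
move=> s h; rewrite (_ : (fun t => _) = (fun=> 0)) ?Rintegral_cst ?mul0r//.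
apply/funext => t; case bE : (b (s, t)); last by rewrite mul0r.
by have [h2 _] := bd _ bE; rewrite h2 in h.
Qed.

Lemma dcone_bound a x y : x <= a ->
  `|\int[mu2]_z ((dcone a x y z)%:R * pk z)| <= 2 * (C * C) * (a - x) ^+ 2.
Proof.
move=> xa; apply: (@cone_bound _ x y); [lra|exact: (bs2_dcone ck bk mp bp p0)|].
move=> z /andP[/andP[h1 h2]]; rewrite ler_norml => /andP[h3 h4]; split; apply/andP; split; lra.
Qed.

Lemma fcone_bound a x y : a <= x ->
  `|\int[mu2]_z ((fcone a x y z)%:R * pk z)| <= 2 * (C * C) * (x - a) ^+ 2.
Proof.
move=> xa; apply: (@cone_bound _ a y); [lra|exact: (bs2_fcone ck bk mp bp p0)|].
move=> z /andP[/andP[h1 h2]]; rewrite ler_norml => /andP[h3 h4]; split; apply/andP; split; lra.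
Qed.

Let bgam a : bs1 (gam a). Proof. exact: (bs1_gam ck bk mp bp p0). Qed.

Lemma Gk_diff a u v : 0 <= u -> u <= v ->
  Gk a v - Gk a u = \int[mu]_r ((u < r < v)%R%:R * gam a r).
Proof. by move=> u0 uv; exact: int_prim_diff. Qed.

Lemma dcone_opp (a x y : R) (z : R * R) : dcone a x (- y) z = dcone a x y (z.1, - z.2).
Proof. by rewrite /dcone /= opprK -normrN opprD. Qed.

Lemma kernel_backE a x y : `|y| <= x -> x <= a -> a <= 2 ->
  k x y = Gk a (x + y) - Gk a (x - y) + 2^-1 * \int[mu2]_z ((dcone a x y z)%:R * pk z).
Proof.
move=> yx xa a2; have [y0|y0] := leP 0 y.
  rewrite (ger0_norm y0) in yx; rewrite Gk_diff; [|lra..].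
  by apply: (kernel_back ck bk mp bp p0 kodd W kdiag) => //; apply/andP; split.
have y0' : 0 <= - y by lra.
rewrite ltr0_norm// in yx.
have := kernel_back ck bk mp bp p0 kodd W kdiag (_ : 0 <= - y <= x) xa a2.
rewrite y0' yx => /(_ isT); rewrite kodd opprK -Gk_diff; [|lra..].
have -> : \int[mu2]_z ((dcone a x (- y) z)%:R * pk z) = - \int[mu2]_z ((dcone a x y z)%:R * pk z).
  rewrite -(int_reflect kodd (bs2_dcone ck bk mp bp p0 a x y)).
  by apply: eq_Rintegral => z _; rewrite dcone_opp.
move: (\int[mu2]_z _) (Gk a _) (Gk a _) (k x y) => i g1 g2 kk; lra.
Qed.

Lemma kernel_line a y : `|y| <= a -> a <= 2 -> k a y = Gk a (a + y) - Gk a (a - y).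
Proof.
move=> ya a2; rewrite (kernel_backE ya (lexx a) a2).
have := dcone_bound y (lexx a); rewrite subrr expr0n/= mulr0 normr_le0 => /eqP ->.
by rewrite mulr0 addr0.
Qed.

(** The profile [Gk a] is attached to the line and not to the point, and the same profile serves for
    x <= a and for x >= a. With different profiles only one-sided derivatives in x would result. *)
Lemma kernel_remainder a y x : a <= 1 -> `|y| + `|x - a| <= a ->
  `|k x y - (Gk a (x + y) - Gk a (x - y))| <= C * C * (x - a) ^+ 2.
Proof.
move=> a1 yx.
wlog y0 : y yx / 0 <= y.
  move=> h; have [/h|y0] := leP 0 y; first exact.
  have := h (- y); rewrite normrN => /(_ yx); rewrite kodd opprK => h'.
  by rewrite -normrN (le_trans _ (h' _))//; [rewrite le_eqVlt; apply/orP; left; apply/eqP; congr (`|_|); ring|lra].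
rewrite (ger0_norm y0) in yx.
have [xa|xa] := leP x a.
  rewrite (ler0_norm (_ : x - a <= 0)) in yx; last lra.
  rewrite (@kernel_backE a) //; [|rewrite ger0_norm; lra|lra].
  have -> : forall u v : R, u + v - u = v by move=> u v; rewrite addrAC subrr add0r.
  rewrite normrM gtr0_norm ?invr_gt0//; have := dcone_bound y xa.
  rewrite -(sqrrN (a - x)) opprB; move: (`|_|) ((x - a) ^+ 2) => i u; lra.
rewrite (gtr0_norm (_ : 0 < x - a)) in yx; last lra.
rewrite (kernel_fwd ck bk mp bp p0 kodd W kdiag y0 (ltW xa)) //; [|lra].
rewrite Gk_diff; [|lra..].
have -> : forall u v : R, u + v - u = v by move=> u v; rewrite addrAC subrr add0r.
rewrite normrM gtr0_norm ?invr_gt0//; have := fcone_bound y (ltW xa).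
by move: (`|_|) ((x - a) ^+ 2) => i u; lra.
Qed.

Definition regular_point (a y : R) := [/\ `|y| < a, is_derive (a + y) 1 (Gk a) (gam a (a + y))
  & is_derive (a - y) 1 (Gk a) (gam a (a - y))].

Lemma ae_Gk (a : R) : {ae mu, forall r : R, 0 < r -> is_derive r 1 (Gk a) (gam a r)}.
Proof.
have ig := bs1_integrable (bgam a).
have := @FTC1 R (gam a) (BLeft 0).
move=> h; have := h _ _; move=> {}h.
have h1 : forall y : R, mu.-integrable [set` Interval (BLeft 0) (BRight y)] (EFin \o gam a).
  by move=> y; apply: integrableS ig => //; exact: (@measurable_itv R).
have h2 : locally_integrable [set: R] (gam a).
  by apply: open_integrable_locally => //; exact: openT.
apply: (aeS (h h1 h2)) => r hr r0.
have [d1 d2] : derivable (Gk a) r 1 /\ derive1 (Gk a) r = gam a r.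
  by apply: hr; rewrite lte_fin.
apply: DeriveDef; first exact: d1.
by rewrite -derive1E.
Qed.

Lemma ae_regular_point (a : R) : {ae mu, forall y : R, `|y| < a -> regular_point a y}.
Proof.
have h1 := @ae_scale R _ 1 a ltr01 (ae_Gk a).
have h2 := ae_opp h1.
apply: (aeS2 h1 h2) => y; rewrite !mul1r => g1 g2 ya; move: (ya); rewrite ltr_norml => /andP[? ?].
split => //.
  by rewrite addrC; apply: g1; lra.
by rewrite addrC; apply: g2; lra.
Qed.

Lemma kernel_dx a y : a <= 1 -> regular_point a y ->
  is_derive a 1 (k^~ y) (gam a (a + y) - gam a (a - y)).
Proof.
move=> a1 [ya d1 d2].
have e1 : is_derive a 1 (fun x => Gk a (x + y)) (gam a (a + y)).
  have s : is_derive a 1 (fun x : R => x + y) 1.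
    by have := is_deriveD (is_derive_id a (1 : R)) (is_derive_cst y a 1); rewrite addr0; exact.
  by have := @is_derive1_comp R (Gk a) (fun x => x + y) a _ 1 d1 s; rewrite mulr1; exact.
have e2 : is_derive a 1 (fun x => Gk a (x - y)) (gam a (a - y)).
  have s : is_derive a 1 (fun x : R => x - y) 1.
    by have := is_deriveD (is_derive_id a (1 : R)) (is_derive_cst (- y) a 1); rewrite addr0; exact.
  by have := @is_derive1_comp R (Gk a) (fun x => x - y) a _ 1 d2 s; rewrite mulr1; exact.
have e3 : is_derive a 1 (fun x => k x y - (Gk a (x + y) - Gk a (x - y))) 0.
  apply: (@is_derive_small _ _ _ (C * C)); near=> x; apply: kernel_remainder => //.
  rewrite -lerBrDl; near: x; apply/nbhs_ballP; exists (a - `|y|); first by rewrite /= subr_gt0.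
  by move=> z; rewrite /ball/= distrC => /ltW.
have := is_deriveD e3 (is_deriveB e1 e2); rewrite add0r.
congr (is_derive a 1 _ _); apply/funext => x; rewrite !fctE /=.
by rewrite subrK.
Unshelve. all: by end_near. Qed.

Lemma kernel_dy a y : a <= 1 -> regular_point a y ->
  is_derive y 1 (k a) (gam a (a + y) + gam a (a - y)).
Proof.
move=> a1 [ya d1 d2].
have e1 : is_derive y 1 (fun x => Gk a (a + x)) (gam a (a + y)).
  have s : is_derive y 1 (fun x : R => a + x) 1.
    by have := is_deriveD (is_derive_cst a y 1) (is_derive_id y (1 : R)); rewrite add0r; exact.
  by have := @is_derive1_comp R (Gk a) (fun x => a + x) y _ 1 d1 s; rewrite mulr1; exact.
have e2 : is_derive y 1 (fun x => Gk a (a - x)) (- gam a (a - y)).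
  have s : is_derive y 1 (fun x : R => a - x) (- 1).
    by have := is_deriveB (is_derive_cst a y 1) (is_derive_id y (1 : R)); rewrite sub0r; exact.
  by have := @is_derive1_comp R (Gk a) (fun x => a - x) y _ (- 1) d2 s; rewrite mulrN1; exact.
have := is_deriveB e1 e2; rewrite opprK.
apply: near_eq_is_derive; near=> x; rewrite !fctE /= kernel_line//; last lra.
apply: ltW; near: x.
by apply: (@cvgr_norm_lt _ _ _ _ _ id y) => //; exact: cvg_id.
Unshelve. all: by end_near. Qed.

Section data.
Variables (a : R) (d1 d2 : R -> R).
Hypothesis a01 : 0 < a <= 1.
Hypothesis d1E : forall y, `|y| <= a -> d1 y = k a y.
Hypothesis d2E : {ae mu, forall y, `|y| < a -> d2 y = gam a (a + y) - gam a (a - y)}.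
Hypothesis md2 : measurable_fun `]- a, a[ d2.

Lemma data_dy y : regular_point a y -> derive1 d1 y = gam a (a + y) + gam a (a - y).
Proof.
move=> g; have [ya _ _] := g; move: a01 => /andP[_ a1].
rewrite derive1E; have := kernel_dy a1 g.
have E : \forall x \near y, k a x = d1 x.
  near=> x; rewrite d1E//; apply: ltW; near: x.
  by apply: (@cvgr_norm_lt _ _ _ _ _ id y) => //; exact: cvg_id.
by move=> /(near_eq_is_derive E) h; exact: derive_val.
Unshelve. all: by end_near. Qed.

(** In K_y + K_x the density at a - y cancels and twice the density at a + y remains. With y = 2 x -
    a this is the density at 2 x, namely p x / 4 plus half the integral of [pk] along the
    characteristic through (x, x), which is the integral in the first component of W. *)
Lemma first_equation : {ae mu, forall x, 0 < x < a ->
  p x = 2 * (derive1 d1 (2 * x - a) + d2 (2 * x - a)) +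
   - 2 * \int[mu]_(s in `[x, a]) (p s * k s (2 * x - s))}.
Proof.
have h1 := @ae_scale R _ 2 (- a) (ltr0n _ 2) (ae_regular_point a).
have h2 := @ae_scale R _ 2 (- a) (ltr0n _ 2) d2E.
apply: (aeS2 h1 h2) => x g1 g2 /andP[x0 xa].
have ya : `|2 * x - a| < a by rewrite ltr_norml; apply/andP; split; lra.
rewrite (g2 ya) (data_dy (g1 ya)).
have -> : a + (2 * x - a) = 2 * x by ring.
have -> : forall u v : R, u + v + (u - v) = 2 * u by move=> u v; ring.
rewrite /gam /Ek int_itv mulrAC mulfV// mul1r.
have -> : \int[mu]_s (([&& 0 <= x, x <= s & s <= a])%:R * pk (s, 2 * x - s)) =
   \int[mu]_t ((x <= t <= a)%R%:R * (p t * k t (2 * x - t))).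
  by apply: eq_Rintegral => s _; rewrite (ltW x0).
move: (Rintegral _ _ _) (p x) => i u; lra.
Qed.

(** D'Alembert's formula: d1 is Gk (a + t) - Gk (a - t), while d2 has the primitive Gk (a + t) + Gk
    (a - t). Of the values of [Gk a] at the two end points of integration only those at x + y and x
    - y survive. *)
Lemma second_equation x y : `|y| <= x -> x <= a ->
  k x y = (d1 (y + x - a) + d1 (y - x + a)) / 2
     - 2^-1 * (\int[mu]_(t in `[y + x - a, y - x + a]) d2 t) +
     2^-1 * \int[mu2]_z ((dcone a x y z)%:R * pk z).
Proof.
move=> yx xa; have [a0 a1] := andP a01.
have := yx; rewrite ler_norml => /andP[y1 y2].
rewrite (kernel_backE yx xa); last lra.
congr (_ + _).
have t1a : - a <= y + x - a by lra.
have t2a : y - x + a <= a by lra.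
rewrite !d1E; [|rewrite ler_norml; apply/andP; split; lra..].
rewrite !kernel_line; [|try (rewrite ler_norml; apply/andP; split); lra..].
pose g t := gam a (a + t) - gam a (a - t).
have bg1 : bs1 (fun t => gam a (a + t)).
  have := @bs1_affine R 1 a _ (oner_neq0 _) (bgam a).
  by under [X in bs1 X -> _]eq_fun do rewrite mul1r addrC.
have bg2 : bs1 (fun t => gam a (a - t)).
  by have := bs1_opp bg1.
have bg : bs1 g by exact: bs1_sub.
have md2' : measurable_fun `]y + x - a, y - x + a[ d2.
  apply: measurable_funS md2; first exact: measurable_itv.
  by move=> t /=; rewrite !in_itv/= => /andP[? ?]; apply/andP; split; lra.
have E : \int[mu]_(t in `[y + x - a, y - x + a]) d2 t = \int[mu]_t ((y + x - a < t < y - x + a)%R%:R * g t).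
  have -> : \int[mu]_t ((y + x - a < t < y - x + a)%R%:R * g t) = \int[mu]_(t in `]y + x - a, y - x + a[) g t.
    rewrite [RHS]Rintegral_mkcond; apply: eq_Rintegral => t _; rewrite patchE.
    by case: ifPn; rewrite ?inE ?notin_setE/= in_itv/= => h; [rewrite h mul1r|move/negP/negbTE : h => ->; rewrite mul0r].
  rewrite /Rintegral; congr fine; rewrite integral_itv_bndoo; last exact/measurable_EFinP.
  apply: ae_eq_integral.
  - exact: (@measurable_itv R).
  - exact/measurable_EFinP.
  - by apply/measurable_EFinP; apply: measurable_funTS; case: bg.
  - apply: (aeS d2E) => t h /=; rewrite in_itv/= => /andP[h1 h2].
    by rewrite h// ltr_norml; apply/andP; split; lra.
rewrite E /g.
under eq_Rintegral do rewrite mulrBr.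
rewrite int1B; [|exact: bs1_betweeno..].
have -> : \int[mu]_t ((y + x - a < t < y - x + a)%R%:R * gam a (a + t)) =
    Gk a (a + (y - x + a)) - Gk a (a + (y + x - a)).
  rewrite Gk_diff; [|lra..].
  rewrite [RHS](int_shift a); last exact: bs1_betweeno.
  apply: eq_Rintegral => t _; rewrite (addrC t); congr (_%:R * _); congr (_ && _).
    by rewrite ltrD2l.
  by rewrite ltrD2l.
have -> : \int[mu]_t ((y + x - a < t < y - x + a)%R%:R * gam a (a - t)) =
    Gk a (a - (y + x - a)) - Gk a (a - (y - x + a)).
  rewrite Gk_diff; [|lra..].
  rewrite [RHS](int_shift a); last exact: bs1_betweeno.
  rewrite [RHS]int_opp; last first.
    have := @bs1_affine R 1 a _ (oner_neq0 _) (bs1_betweeno (a - (y - x + a)) (a - (y + x - a)) (bgam a)).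
    by under [X in bs1 X -> _]eq_fun do rewrite mul1r.
  apply: eq_Rintegral => t _; rewrite (addrC (- t)); congr (_%:R * _).
  by rewrite !ltrD2l !ltrN2 andbC.
have -> : a + (y + x - a) = x + y by ring.
have -> : a - (y - x + a) = x - y by ring.
move: (Gk a _) (Gk a _) (Gk a _) (Gk a _) => g1 g2 g3 g4; lra.
Qed.
End data.
End derivatives.

(** * Measurability of the Cauchy data *)

Section measurable_limits.
Variable R : realType.

(** Where the limit does not exist, [lim] returns the default [point], so it is Borel once the set
    of convergence is. Agreement almost everywhere with a Borel function would not suffice, since
    states are required to be Borel. *)
Lemma measurable_lim (F : R -> R -> R) (S : set R) (Fl : set_system R) :
  ProperFilter Fl ->
  open S -> (forall m : nat, S (m.+1%:R^-1)) ->
  (forall A : set R, Fl A <-> exists m : nat, forall h, S h -> `|h| < m.+1%:R^-1 -> A h) ->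
  (forall h, S h -> measurable_fun [set: R] (F h)) ->
  (forall y h, S h -> {for h, continuous (F^~ y)}) ->
  measurable_fun [set: R] (fun y => lim (F^~ y @ Fl)).
Proof.
move=> FF oS S1 FlE mF cF.
pose Q (i : rat * rat) (m : nat) := [/\ S (ratr i.1), S (ratr i.2),
  `|ratr i.1| < (m.+1%:R^-1 : R) & `|ratr i.2| < (m.+1%:R^-1 : R)].
pose A n (i : rat * rat) : set R := [set y | `|F (ratr i.1) y - F (ratr i.2) y| <= n.+1%:R^-1].
(* Cauchy's criterion restricted to rational parameters, hence built from countably many Borel
   sets. *)
pose E : set R := \bigcap_n \bigcup_m \bigcap_(i in [set i | Q i m]) A n i.
have mA n i m : Q i m -> measurable (A n i).
  move=> [h1 h2 _ _].
  have mf : measurable_fun [set: R] (fun y => `|F (ratr i.1) y - F (ratr i.2) y|).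
    by apply: measurableT_comp => //; apply: measurable_funB; exact: mF.
  have := measurable_fun_le measurableT mf (measurable_cst (n.+1%:R^-1 : R)).
  by rewrite setTI.
have mE : measurable E.
  apply: bigcapT_measurable => n; apply: bigcupT_measurable => m.
  rewrite bigcap_mkcond.
  have -> : \bigcap_(i : rat * rat) (if i \in [set i | Q i m] then A n i else setT) =
     ~` (\bigcup_(i : rat * rat) ~` (if i \in [set i | Q i m] then A n i else setT)).
    by rewrite setC_bigcup; apply: eq_bigcapr => i _; rewrite setCK.
  apply: measurableC; apply: countable_bigcupT_measurable => // i; apply: measurableC.
  by case: ifPn => // /set_mem; exact: mA.
have EP y : E y <-> cvg (F^~ y @ Fl).
  split.
    move=> Ey; apply: cauchy_cvg; apply: cauchy_exP => e /= e0.
    have [n hn] : exists n : nat, n.+1%:R^-1 < e.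
      by move/ltr_add_invr : e0 => [n]; rewrite add0r => hn; exists n.
    have [m _ hm] := Ey n I.
    exists (F (m.+2%:R^-1) y); apply/FlE; exists m => h Sh hlt; rewrite /ball/=.
    apply: le_lt_trans hn.
    have Sm : S (m.+2%:R^-1) by exact: S1.
    have mlt : `|m.+2%:R^-1 : R| < m.+1%:R^-1.
      by rewrite ger0_norm// ltf_pV2 ?posrE// ltr_nat.
    (* rational points are enough by continuity *)
    rewrite leNgt; apply/negP => hgt.
    have cont u : S u -> `|u| < m.+1%:R^-1 ->
      \forall v \near u, S v /\ `|v| < m.+1%:R^-1.
      move=> Su ult; near=> v; split; near: v; first exact: open_nbhs_nbhs.
      by apply: (@cvgr_norm_lt _ _ _ _ _ id u) => //; exact: cvg_id.
    have dens (u : R) (P : set R) : (\forall v \near u, P v) -> exists a : rat, P (ratr a).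
      move=> /nbhs_ballP[d /= d0 dP].
      have /rat_in_itvoo[a] : u < u + d by rewrite ltrDl.
      rewrite in_itv/= => /andP[h1 h2]; exists a; apply: dP; rewrite /ball/= distrC.
      by rewrite ger0_norm ?subr_ge0 ?ltW// ltrBlDl.
    pose d := `|F (m.+2%:R^-1) y - F h y| - n.+1%:R^-1.
    have d0 : 0 < d by rewrite subr_gt0.
    have c1 : \forall v \near (m.+2%:R^-1 : R), `|F (m.+2%:R^-1) y - F v y| < d / 2.
      by have /cvgrPdist_lt := cF y _ Sm; apply; rewrite divr_gt0.
    have c2 : \forall v \near h, `|F h y - F v y| < d / 2.
      by have /cvgrPdist_lt := cF y _ Sh; apply; rewrite divr_gt0.
    have [a [[a1 a2] a3]] := dens _ _ (filterI (cont _ Sm mlt) c1).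
    have [b [[b1 b2] b3]] := dens _ _ (filterI (cont _ Sh hlt) c2).
    have /= := hm (a, b) (And4 a1 b1 a2 b2); rewrite /A /=.
    have : `|F (m.+2%:R^-1) y - F h y| <= `|F (m.+2%:R^-1) y - F (ratr a) y| +
       `|F (ratr a) y - F (ratr b) y| + `|F h y - F (ratr b) y|.
      have -> : F (m.+2%:R^-1) y - F h y = (F (m.+2%:R^-1) y - F (ratr a) y) +
        (F (ratr a) y - F (ratr b) y) - (F h y - F (ratr b) y) by ring.
      by rewrite (le_trans (ler_normB _ _))// lerD2r ler_normD.
    move: a3 b3; rewrite /d; move: `|_ - F h y| `|_ - F (ratr a) y| `|_ - F (ratr b) y|.
    move: `|_| (n.+1%:R^-1 : R) => x1 x2 x3 x4 x5; clear; lra.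
  move=> /cvg_ex[l /= hl] n _.
  have /FlE[m hm] : Fl [set h | `|l - F h y| < n.+1%:R^-1 / 2].
    by have /cvgrPdist_lt := hl; apply; rewrite divr_gt0.
  exists m => // -[a b] [/= a1 b1 a2 b2]; rewrite /A /=.
  have h1 := hm _ a1 a2; have h2 := hm _ b1 b2; rewrite /= in h1 h2.
  have -> : F (ratr a) y - F (ratr b) y = (l - F (ratr b) y) - (l - F (ratr a) y) by ring.
  apply: (le_trans (ler_normB _ _)); move: h1 h2.
  by move: `|_ - F (ratr a) y| `|_ - F (ratr b) y| (n.+1%:R^-1 : R) => x1 x2 x3; clear; lra.
(* A sequence of Borel functions whose limit is right everywhere: the values at h = 1/(n+1) on E,
   the default off E. *)
pose g (n : nat) (y : R) : R := \1_E y * F (n.+1%:R^-1) y + (1 - \1_E y) * (point : R).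
have : forall y, setT y -> g ^~ y @ \oo --> (lim (F^~ y @ Fl) : R).
  move=> y _; rewrite /g indicE; have [/set_mem Ey|nE] := boolP (y \in E).
    have cy := (EP y).1 Ey; rewrite /=.
    under eq_fun do rewrite mul1r subrr mul0r addr0.
    apply/cvgrPdist_lt => e e0.
    have /FlE[m hm] : Fl [set h | `|lim (F^~ y @ Fl) - F h y| < e].
      by have /cvgrPdist_lt := cy; exact.
    near=> n; apply: hm; first exact: S1.
    rewrite ger0_norm ?invr_ge0// ltf_pV2 ?posrE// ltr_nat ltnS; near: n.
    by exists m.+1.
  have -> : lim (F^~ y @ Fl) = point.
    by apply: dvgP => /EP /mem_set; rewrite (negbTE nE).
  under eq_fun do rewrite mul0r subr0 mul1r add0r.
  exact: cvg_cst.
move/measurable_fun_cvg; apply.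
move=> n; apply: measurable_funD; apply: measurable_funM => //.
- exact: mF.
- by apply: measurable_funB.
Unshelve. all: by end_near. Qed.
End measurable_limits.

(** * Parameter integrals and exponential weights *)

Section parameters.
Variable R : realType.
Notation mu := (@lebesgue_measure R).
Notation mu2 := (@mu2 R).
Local Notation TR := (measurableTypeR R).
Local Notation TR2 := (measurableTypeR R * measurableTypeR R)%type.

Lemma measurable_param d (T : measurableType d) (f : T * TR -> R) :
  measurable_fun setT f -> measurable_fun setT (fun x => \int[mu]_y f (x, y)).
Proof.
move=> mf; rewrite /Rintegral.
apply: (measurableT_comp (@fine_measurable R _ measurableT)).
have mF : measurable_fun setT (EFin \o f) by exact/measurable_EFinP.
have mp := @measurable_fun_fubini_tonelli_F _ _ _ _ R mu _ (measurable_funepos mF) (fun z => funepos_ge0 _ z).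
have mn := @measurable_fun_fubini_tonelli_F _ _ _ _ R mu _ (measurable_funeneg mF) (fun z => funeneg_ge0 _ z).
have -> : (fun x => \int[mu]_y (f (x, y))%:E)%E =
  (fun x => fubini_F mu (EFin \o f)^\+ x - fubini_F mu (EFin \o f)^\- x)%E.
  apply/funext => x; rewrite integralE /fubini_F; congr (_ - _)%E; apply: eq_integral => y _.
    by rewrite !funeposE.
  by rewrite !funenegE.
exact: emeasurable_funB.
Qed.

Lemma ae_le_int (f g : R -> R) : bs1 f -> bs1 g -> {ae mu, forall x, `|f x| <= g x} ->
  `|\int[mu]_x f x| <= \int[mu]_x g x.
Proof.
move=> bf bg fg; have ig := bs1_integrable bg; have jf := bs1_integrable bf.
rewrite -lee_fin EFin_normr_Rintegral//.
apply: (le_trans (le_abse_integral _ measurableT (measurable_int _ jf))) => /=.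
have -> : ((\int[mu]_x g x)%:E = \int[mu]_x `|(EFin \o g) x|)%E.
  rewrite -integral_bs1//; apply: ae_eq_integral => //.
  - exact: measurable_int ig.
  - exact: measurable_int (integrable_abse ig).
  - by apply: (aeS fg) => x /= h _; rewrite ger0_norm//; exact: le_trans h.
apply: ae_ge0_le_integral => //.
- exact: measurable_int (integrable_abse jf).
- exact: measurable_int (integrable_abse ig).
- by apply: (aeS fg) => x /= h _; rewrite lee_fin (le_trans h)// ler_norm.
Qed.

Lemma int_itv_cst (u v c : R) : u <= v -> \int[mu]_s ((u <= s <= v)%R%:R * c) = c * (v - u).
Proof.
move=> uv; rewrite -(int_itv (fun=> c)) /Rintegral integral_cst//= lebesgue_measure_itv/= lte_fin.
have [uv1|vu] := ltP u v; first by rewrite -EFinD -EFinM.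
by rewrite mule0 (_ : v = u) ?subrr ?mulr0//; apply/eqP; rewrite eq_le vu uv.
Qed.

Lemma bs1_itv (u v : R) (f : R -> R) (C : R) : measurable_fun [set: TR] (f : TR -> R) ->
  (forall s, u <= s <= v -> `|f s| <= C) -> bs1 (fun s => (u <= s <= v)%R%:R * f s).
Proof.
move=> mf fC; split.
  by apply: measurable_funM => //; apply: measurable_between; mfun.
exists `|C|, (`|u| + `|v|) => s; have [us|us] := boolP (u <= s <= v).
  rewrite mul1r; split; first by rewrite (le_trans (fC _ us))// ler_norm.
  move=> /negP []; move/andP : us => [us sv]; rewrite ler_norml; apply/andP; split.
    by have := ler_norm (- u); have := normr_ge0 v; rewrite normrN; lra.
  by have := ler_norm v; have := normr_ge0 u; lra.
by rewrite mul0r normr0.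
Qed.

(* reflecting [x, a] turns s - x into a - s *)
Lemma int_itv_lin (x a : R) : x <= a ->
  \int[mu]_s ((x <= s <= a)%R%:R * (2 * (s - x))) = (a - x) ^+ 2.
Proof.
move=> xa; pose f s := (x <= s <= a)%R%:R * (2 * (s - x)).
have bf : bs1 f.
  apply: (@bs1_itv _ _ _ (2 * (a - x))) => [|s /andP[h1 h2]]; first by mfun.
  by rewrite ger0_norm; lra.
have bf2 := bs1_opp bf; have bf3 : bs1 (fun s => f (- (s + - (a + x)))).
  have := @bs1_affine R (-1) (a + x) f _ bf; rewrite oppr_eq0 oner_eq0 => /(_ isT).
  by under eq_fun do rewrite mulN1r; under [X in _ -> bs1 X]eq_fun do rewrite opprB addrC.
have E : \int[mu]_s f s = \int[mu]_s f (- (s + - (a + x))).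
  by rewrite (int_opp bf) (int_shift (- (a + x)) bf2).
have : \int[mu]_s f s + \int[mu]_s f s = 2 * (a - x) ^+ 2.
  have -> : 2 * (a - x) ^+ 2 = 2 * (a - x) * (a - x) by ring.
  rewrite {2}E -int1D// -(int_itv_cst _ xa).
  apply: eq_Rintegral => s _; rewrite /f.
  have -> : (x <= - (s + - (a + x)) <= a) = (x <= s <= a).
    by apply/idP/idP => /andP[? ?]; apply/andP; split; lra.
  case: (x <= s <= a); rewrite ?mul0r ?mul1r//; ring.
by move: (Rintegral _ _ _) => i; lra.
Qed.

(** Integration of the weight from x to a gains a factor 1 / l, up to a term of favourable sign;
    this is the source of the contraction. *)
Lemma int_itv_exp (x a l : R) : x <= a ->
  \int[mu]_s ((x <= s <= a)%R%:R * (l * expR (l * (a - s)))) = expR (l * (a - x)) - 1.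
Proof.
rewrite le_eqVlt => /predU1P[->|xa].
  rewrite subrr mulr0 expR0 subrr -(int_itv (fun s => l * expR (l * (a - s)))).
  by rewrite set_itv1 Rintegral_set1.
rewrite -(int_itv (fun s => l * expR (l * (a - s)))).
have D (s : R) : is_derive s 1 (fun s => - expR (l * (a - s)) : R) (l * expR (l * (a - s))).
  apply: is_derive_eq.
  rewrite /GRing.scale/=; ring.
have cF : continuous (fun s => - expR (l * (a - s)) : R).
  move=> s; apply: differentiable_continuous; apply/derivable1_diffP.
  exact: ex_derive.
have cf : continuous (fun s => l * expR (l * (a - s)) : R).
  move=> s; apply: differentiable_continuous; apply/derivable1_diffP.
  exact: ex_derive.
rewrite /Rintegral (@continuous_FTC2 _ _ (fun s => - expR (l * (a - s)))) //=.
- by rewrite subrr mulr0 expR0; ring.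
- exact: continuous_subspaceT.
- split.
  + by move=> s _; exact: ex_derive.
  + by apply: cvg_at_right_filter; exact: cF.
  + by apply: cvg_at_left_filter; exact: cF.
- by move=> s _; rewrite derive1E derive_val.
Qed.
End parameters.

(** * The map W on bounded states *)

Section borel_states.
Variable R : realType.
Notation mu := (@lebesgue_measure R).
Notation mu2 := (@mu2 R).
Local Notation TR := (measurableTypeR R).
Local Notation TR2 := (measurableTypeR R * measurableTypeR R)%type.

Lemma measurable_bool_set d (T : measurableType d) (f : T -> bool) :
  measurable_fun setT f -> measurable [set x | f x].
Proof. by move=> mf; have := mf measurableT [set true] I; rewrite setTI. Qed.

Lemma measurable_Delta (b a : R) : measurable (Delta b a : set TR2).
Proof.
have -> : Delta b a = [set z : TR2 | (b <= z.1 <= a) && (`|z.2| <= z.1)].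
  by apply/seteqP; split => z /=; [move=> [-> ->]|move=> /andP].
apply: measurable_bool_set; apply: measurable_and; first by mfun.
by apply: measurable_fun_ler; mfun; apply: (measurableT_comp (@normr_measurable R setT)); mfun.
Qed.

Lemma D_regionE (a x y : R) : D_region a x y = [set z | dcone a x y z].
Proof. by apply/seteqP; split => z /=; [move=> [h1 h2]; apply/andP|move=> /andP]. Qed.

Lemma measurable_D_region (a x y : R) : measurable (D_region a x y : set TR2).
Proof. by rewrite D_regionE; apply: measurable_bool_set; exact: measurable_dcone. Qed.

Lemma ae_fst (P : R -> Prop) : {ae mu, forall x, P x} -> {ae mu2, forall z, P z.1}.
Proof.
move=> [N [mN N0 PN]]; exists (N `*` setT); split.
- by apply: measurableX.
- by rewrite /mu2 product_measure1E//= N0 mul0e.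
- by move=> z /= nP; split => //; exact: PN.
Qed.

Lemma measurable_fun_comp_fst (A : set TR) (B : set TR2) (f : TR -> R) : measurable A ->
  (forall z, B z -> A z.1) -> measurable_fun A f -> measurable_fun B (fun z : TR2 => f z.1).
Proof.
move=> mA BA mf; apply: (measurable_comp mA _ mf).
  by move=> _ [z Bz <-]; exact: BA.
by apply: measurable_funTS; exact: measurable_fst.
Qed.

Lemma measurable_comp2 d (T : measurableType d) (v : R -> R -> R) (f g : T -> R) :
  measurable_fun setT (fun z : TR2 => v z.1 z.2) ->
  measurable_fun setT f -> measurable_fun setT g -> measurable_fun setT (fun x => v (f x) (g x)).
Proof. by move=> mv mf mg; exact: (measurableT_comp mv (measurable_fun_pair mf mg)). Qed.

Variables (b a : R).
Hypothesis ba : [/\ 0 <= b, b < a & a <= 1].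

(** The two components have separate bounds because W multiplies them: the size of W U is governed
    by P * k. *)
Definition bounded_state (P k : R) (U : state R) : Prop :=
  [/\ measurable_fun `[b, a] (U.1 : TR -> R),
      measurable_fun (Delta b a) (fun z : TR2 => U.2 z.1 z.2),
      {ae mu, forall x, b <= x <= a -> `|U.1 x| <= P}
    & forall x y, b <= x <= a -> `|y| <= x -> `|U.2 x y| <= k].

(* u and v are everywhere defined versions of the components of U, so that
   integrals of U can be treated by Fubini's theorem *)
Definition borel_rep (P k : R) (U : state R) (u : R -> R) (v : R -> R -> R) : Prop :=
  [/\ measurable_fun setT (u : TR -> R) /\ (forall x, `|u x| <= P),
      measurable_fun setT (fun z : TR2 => v z.1 z.2),
      forall x y, `|v x y| <= k,
      {ae mu, forall x, b <= x <= a -> U.1 x = u x}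
    & forall x y, b <= x <= a -> `|y| <= x -> U.2 x y = v x y].

Lemma bounded_state_rep P k U : 0 <= P -> 0 <= k -> bounded_state P k U -> exists u v, borel_rep P k U u v.
Proof.
move=> P0 k0 [m1 m2 b1 b2].
pose f0 x := if b <= x <= a then U.1 x else 0.
exists (fun x => if `|f0 x| <= P then f0 x else 0).
exists (fun x y => if (b <= x <= a) && (`|y| <= x) then U.2 x y else 0).
have mf0 : measurable_fun setT (f0 : TR -> R).
  apply: measurable_fun_if => //; first by mfun.
  by apply: measurable_funS m1 => // x [_].
split.
- split; last by move=> x; case: ifPn; rewrite ?normr0.
  apply: measurable_fun_ifT => //.
  by apply: measurable_fun_ler; mfun; exact: (measurableT_comp (@normr_measurable R setT)).
- apply: measurable_fun_if => //.
    apply: measurable_and; first by mfun.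
    by apply: measurable_fun_ler; mfun; apply: (measurableT_comp (@normr_measurable R setT)); mfun.
  by apply: measurable_funS m2 => // [|x [_ /andP]//]; exact: measurable_Delta.
- by move=> x y; case: ifPn => [/andP[h1 h2]|]; [exact: b2|rewrite normr0].
- by apply: (aeS b1) => x h xab; rewrite /f0 xab h.
- by move=> x y xab yx; rewrite xab yx.
Qed.

Definition line_integral (u : R -> R) (v : R -> R -> R) x :=
  \int[mu]_s ((x <= s <= a)%R%:R * (u s * v s (2 * x - s))).
Definition cone_integral (u : R -> R) (v : R -> R -> R) x y :=
  \int[mu2]_z ((dcone a x y z)%:R * (u z.1 * v z.1 z.2)).

(** The potential may be changed on a null set of s. The second component has to agree with v at
    every point, because the segment (s, 2 x - s) is a null set in the plane. *)
Lemma W1E P k U u v x : borel_rep P k U u v -> measurable_fun `[b, a] (U.1 : TR -> R) ->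
  b <= x <= a -> (W a U).1 x = - 2 * line_integral u v x.
Proof.
move=> [[mu_ bu] mv bv E1 E2] mU /andP[bx xa]; have [b0 _ _] := ba; congr (_ * _).
rewrite /line_integral -(int_itv (fun s => u s * v s (2 * x - s))).
have -> : \int[mu]_(s in `[x, a]) (U.1 s * U.2 s (2 * x - s)) =
    \int[mu]_(s in `[x, a]) (U.1 s * v s (2 * x - s)).
  apply: eq_Rintegral => s; rewrite inE/= in_itv/= => /andP[h1 h2].
  rewrite E2//; first by rewrite h2 (le_trans bx h1).
  by rewrite ler_norml; apply/andP; split; lra.
have mv' : measurable_fun `[x, a] (fun s : TR => v s (2 * x - s)).
  apply: measurable_funTS; apply: (measurable_comp2 mv); mfun.
rewrite /Rintegral; congr fine; apply: ae_eq_integral.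
- exact: (@measurable_itv R).
- apply/measurable_EFinP; apply: measurable_funM mv'.
  apply: measurable_funS mU; first exact: measurable_itv.
  by move=> s /=; rewrite !in_itv/= => /andP[h1 h2]; rewrite h2 (le_trans bx h1).
- by apply/measurable_EFinP; apply: measurable_funM mv'; exact: measurable_funTS.
- apply: (aeS E1) => s h /=; rewrite in_itv/= => /andP[h1 h2].
  by rewrite h// h2 (le_trans bx h1).
Qed.

Lemma W2E P k U u v x y : borel_rep P k U u v -> measurable_fun `[b, a] (U.1 : TR -> R) ->
  b <= x <= a -> `|y| <= x -> (W a U).2 x y = 2^-1 * cone_integral u v x y.
Proof.
move=> [[mu_ bu] mv bv E1 E2] mU /andP[bx xa] yx; have [b0 _ _] := ba; congr (_ * _).
have Dab z : D_region a x y z -> b <= z.1 <= a /\ `|z.2| <= z.1.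
  move=> [/andP[h1 h2]]; rewrite !ler_norml => /andP[h3 h4]; split; first by rewrite h2 (le_trans bx h1).
  move: yx; rewrite !ler_norml => /andP[h5 h6]; apply/andP; split; lra.
have -> : \int[mu2]_(z in D_region a x y) (U.1 z.1 * U.2 z.1 z.2) =
    \int[mu2]_(z in D_region a x y) (u z.1 * v z.1 z.2).
  rewrite (_ : \int[mu2]_(z in D_region a x y) (U.1 z.1 * U.2 z.1 z.2) =
      \int[mu2]_(z in D_region a x y) (U.1 z.1 * v z.1 z.2)); last first.
    by apply: eq_Rintegral => z; rewrite inE => /Dab[h1 h2]; rewrite E2.
  rewrite /Rintegral; congr fine; apply: ae_eq_integral.
  - exact: measurable_D_region.
  - apply/measurable_EFinP; apply: measurable_funM; last exact: measurable_funTS.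
    by apply: (measurable_fun_comp_fst _ _ mU) => // z /Dab[]; rewrite /= in_itv.
  - apply/measurable_EFinP; apply: measurable_funTS; apply: measurable_funM => //.
    by apply: (measurableT_comp mu_); exact: measurable_fst.
  - have [N [mN N0 PN]] := ae_fst E1; exists N; split => // z nz; apply: PN => /= h.
    by apply: nz => /Dab[h1 h2]; rewrite h.
rewrite /cone_integral Rintegral_mkcond; apply: eq_Rintegral => z _; rewrite patchE D_regionE.
by case: ifPn; rewrite ?inE ?notin_setE/= => h; [rewrite h mul1r|move/negP/negbTE : h => ->; rewrite mul0r].
Qed.

Lemma measurable_line_integral P k U u v : borel_rep P k U u v -> measurable_fun setT (line_integral u v : TR -> R).
Proof.
move=> [[mu_ bu] mv bv E1 E2].
pose f (z : TR * TR) := (z.1 <= z.2 <= a)%R%:R * (u z.2 * v z.2 (2 * z.1 - z.2)).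
apply: (@measurable_param _ _ _ f); apply: measurable_funM.
  by apply: measurable_natb; mfun.
apply: measurable_funM; first by apply: (measurableT_comp mu_); exact: measurable_snd.
by apply: (measurable_comp2 mv); mfun.
Qed.

Lemma bs2_cone P x y (F : R * R -> R) : measurable_fun setT (F : TR2 -> R) ->
  (forall z, `|F z| <= P) -> bs2 (fun z => (dcone a x y z)%:R * F z).
Proof.
move=> mF bF; split.
  by apply: measurable_funM => //; apply: measurable_natb; exact: measurable_dcone.
exists P, (`|x| + `|a| + `|y|) => z; split.
  by case: (dcone _ _ _ _); rewrite ?mul1r ?mul0r// normr0; exact: le_trans (bF z).
have [D|_ _] := boolP (dcone a x y z); last by rewrite mul0r.
move=> /negP[]; move/andP : D => [/andP[h1 h2]]; rewrite ler_norml => /andP[h3 h4].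
have n1 := ler_norm x; have n2 := ler_norm (- x); have n3 := ler_norm a.
have n4 := ler_norm (- a); have n5 := ler_norm y; have n6 := ler_norm (- y).
by rewrite !normrN in n2 n4 n6; rewrite !ler_norml; apply/andP; split; apply/andP; split; lra.
Qed.

(** The plane integral is unfolded into two successive parameter integrals, the cone being
    measurable jointly in its vertex and in the point of integration. *)
Lemma measurable_cone_integral P k U u v : borel_rep P k U u v ->
  measurable_fun setT (fun z : TR2 => cone_integral u v z.1 z.2).
Proof.
move=> [[mu_ bu] mv bv E1 E2].
pose F (z : R * R) := u z.1 * v z.1 z.2.
have mF : measurable_fun setT (F : TR2 -> R).
  by apply: measurable_funM => //; apply: (measurableT_comp mu_); exact: measurable_fst.
have bF z : `|F z| <= P * k by rewrite normrM ler_pM.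
have -> : (fun z : TR2 => cone_integral u v z.1 z.2) =
    (fun z => \int[mu]_s \int[mu]_t ((dcone a z.1 z.2 (s, t))%:R * F (s, t))).
  by apply/funext => z; rewrite /cone_integral (fubini12 (bs2_cone z.1 z.2 mF bF)).
pose f (w : TR2 * TR) := \int[mu]_t ((dcone a w.1.1 w.1.2 (w.2, t))%:R * F (w.2, t)).
apply: (@measurable_param _ _ _ f).
pose g (w : TR2 * TR * TR) := (dcone a w.1.1.1 w.1.1.2 (w.1.2, w.2))%:R * F (w.1.2, w.2).
apply: (@measurable_param _ _ _ g); rewrite /g.
have m1 : measurable_fun setT (fun w : TR2 * TR * TR => w.1.1.1 : R).
  apply: (@measurableT_comp _ _ _ _ _ _ fst _ (fun w : TR2 * TR * TR => w.1.1)); mfun.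
  by apply: (@measurableT_comp _ _ _ _ _ _ fst _ (fun w : TR2 * TR * TR => w.1)); mfun.
have m2 : measurable_fun setT (fun w : TR2 * TR * TR => w.1.1.2 : R).
  apply: (@measurableT_comp _ _ _ _ _ _ snd _ (fun w : TR2 * TR * TR => w.1.1)); mfun.
  by apply: (@measurableT_comp _ _ _ _ _ _ fst _ (fun w : TR2 * TR * TR => w.1)); mfun.
have m3 : measurable_fun setT (fun w : TR2 * TR * TR => w.1.2 : R).
  by apply: (@measurableT_comp _ _ _ _ _ _ snd _ (fun w : TR2 * TR * TR => w.1)); mfun.
have m4 : measurable_fun setT (fun w : TR2 * TR * TR => w.2 : R) by mfun.
apply: measurable_funM; last first.
  by apply: (measurableT_comp mF); apply: measurable_fun_pair.
apply: measurable_natb; apply: measurable_and.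
  by apply: measurable_and; apply: measurable_fun_ler.
apply: measurable_fun_ler; last exact: measurable_funB.
by apply: (measurableT_comp (@normr_measurable R setT)); exact: measurable_funB.
Qed.

Lemma line_estimate (F : R -> R -> R) (w : R -> R) (M M' x : R) : b <= x <= a ->
  measurable_fun setT (fun z : TR2 => F z.1 z.2) -> (forall s t, `|F s t| <= M) ->
  measurable_fun setT (w : TR -> R) -> (forall s, x <= s <= a -> `|w s| <= M') ->
  {ae mu, forall s, b <= s <= a -> forall t, `|t| <= s -> `|F s t| <= w s} ->
  `|\int[mu]_s ((x <= s <= a)%R%:R * F s (2 * x - s))| <=
   \int[mu]_s ((x <= s <= a)%R%:R * w s).
Proof.
move=> /andP[bx xa] mF bF mw bw Fw; have [b0 _ _] := ba; apply: ae_le_int.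
- apply: (@bs1_itv _ _ _ _ M) => //.
  by apply: (measurable_comp2 mF); mfun.
- exact: bs1_itv bw.
- apply: (aeS Fw) => s h; case: (boolP (x <= s <= a)) => [/andP[h1 h2]|]; last by rewrite !mul0r normr0.
  rewrite !mul1r; apply: h; first by rewrite h2 (le_trans bx h1).
  by rewrite ler_norml; apply/andP; split; lra.
Qed.

(** The section of the cone at s is an interval of length 2 (s - x), and since |y| <= x it stays in
    the sector |t| <= s, where the bound on F is available. *)
Lemma cone_estimate (F : R -> R -> R) (w : R -> R) (M M' x y : R) : b <= x <= a -> `|y| <= x ->
  measurable_fun setT (fun z : TR2 => F z.1 z.2) -> (forall s t, `|F s t| <= M) ->
  measurable_fun setT (w : TR -> R) -> (forall s, x <= s <= a -> `|w s| <= M') ->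
  {ae mu, forall s, b <= s <= a -> forall t, `|t| <= s -> `|F s t| <= w s} ->
  `|\int[mu2]_z ((dcone a x y z)%:R * F z.1 z.2)| <=
   \int[mu]_s ((x <= s <= a)%R%:R * (2 * (s - x) * w s)).
Proof.
move=> /andP[bx xa] yx mF bF mw bw Fw; have [b0 _ _] := ba.
have bG := bs2_cone x y mF (fun z => bF z.1 z.2).
rewrite (fubini12 bG); apply: ae_le_int.
- exact: (bs2_fubini_bs1 bG).
- apply: (@bs1_itv _ _ _ _ (2 * (a - x) * M')); first by mfun.
  move=> s sx; have := bw s sx; move/andP : sx => [h1 h2] h3.
  by rewrite normrM ler_pM// ger0_norm; lra.
- apply: (aeS Fw) => s h; have [/andP[h1 h2]|nx] := boolP (x <= s <= a); last first.
    rewrite mul0r (_ : \int[mu]_t _ = 0) ?normr0//.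
    by rewrite /Rintegral integral0_eq// => t _; rewrite /dcone/= (negbTE nx) mul0r.
  rewrite mul1r mulrC; have hs := h _; have sab : b <= s <= a by rewrite h2 (le_trans bx h1).
  have w0 : 0 <= w s by rewrite (le_trans (normr_ge0 (F s 0)))// h// normr0; lra.
  apply: (@bs1_le _ _ _ _ (bs2_section1 s bG) _ _ (y - (s - x))); first lra.
    move=> t /=; have [/andP[_ /= D]|_] := boolP (dcone a x y (s, t)); last by rewrite mul0r normr0.
    rewrite mul1r; apply: h => //; move: D yx; rewrite !ler_norml => /andP[? ?] /andP[? ?].
    by apply/andP; split; lra.
  move=> t nt; rewrite /dcone/= (_ : (`|t - y| <= s - x) = false) ?andbF ?mul0r//.
  apply: contraNF nt; rewrite ler_norml => /andP[? ?]; apply/andP; split; lra.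
Qed.
End borel_states.

Section estimates.
Variable R : realType.
Notation mu := (@lebesgue_measure R).
Notation mu2 := (@mu2 R).
Local Notation TR := (measurableTypeR R).
Local Notation TR2 := (measurableTypeR R * measurableTypeR R)%type.
Variables (b a : R).
Hypothesis ba : [/\ 0 <= b, b < a & a <= 1].
Local Notation bounded_state := (bounded_state b a).
Local Notation borel_rep := (borel_rep b a).

Lemma borel_rep_measurable_mul P k U u v : borel_rep P k U u v ->
  measurable_fun setT (fun z : TR2 => u z.1 * v z.1 z.2).
Proof.
move=> [[mu_ bu] mv bv E1 E2]; apply: measurable_funM => //.
by apply: (measurableT_comp mu_); exact: measurable_fst.
Qed.

Lemma borel_rep_bound_mul P k U u v s t : borel_rep P k U u v -> `|u s * v s t| <= P * k.
Proof. by move=> [[mu_ bu] mv bv E1 E2]; rewrite normrM ler_pM. Qed.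

(** The segment of integration has length a - x and the triangle D_xy has area (a - x)^2; the
    factors 2 and 2^-1 are those of W. *)
Lemma bounded_state_W P k U : 0 <= P -> 0 <= k -> bounded_state P k U ->
  bounded_state (2 * (a - b) * (P * k)) (2^-1 * (a - b) ^+ 2 * (P * k)) (W a U).
Proof.
move=> P0 k0 gU; have [b0 ltba a1] := ba.
have [u [v r]] := bounded_state_rep P0 k0 gU; have [mU _ _ _] := gU.
have Pk0 : 0 <= P * k by exact: mulr_ge0.
have cst_w : {ae lebesgue_measure, forall s, b <= s <= a -> forall t : R, `|t| <= s ->
    `|u s * v s t| <= P * k}.
  by apply: aeW => s _ t _; exact: borel_rep_bound_mul r.
split.
- apply: (@eq_measurable_fun _ _ TR _ _ (fun x => - 2 * line_integral a u v x)) => [x|].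
    by rewrite inE/= in_itv/= => xab; rewrite -(W1E ba r mU xab).
  by apply: measurable_funTS; apply: measurable_funM => //; exact: measurable_line_integral r.
- apply: (@eq_measurable_fun _ _ TR2 _ _ (fun z => 2^-1 * cone_integral a u v z.1 z.2)) => [z|].
    by rewrite inE => -[zab yx]; rewrite -(W2E ba r mU).
  by apply: measurable_funTS; apply: measurable_funM => //; exact: measurable_cone_integral r.
- apply: aeW => x xab; rewrite (W1E ba r mU xab) normrM normrN normr_nat -mulrA ler_pM2l//.
  have := line_estimate ba xab (borel_rep_measurable_mul r) (fun s t => borel_rep_bound_mul s t r) (measurable_cst (P * k))
    (fun s _ => lexx `|P * k|) cst_w.
  move=> /le_trans; apply; case/andP : xab => bx xa; rewrite int_itv_cst// mulrC ler_wpM2r//; lra.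
- move=> x y xab yx; rewrite (W2E ba r mU xab yx) normrM normfV normr_nat -mulrA ler_pM2l ?invr_gt0//.
  have := cone_estimate ba xab yx (borel_rep_measurable_mul r) (fun s t => borel_rep_bound_mul s t r) (measurable_cst (P * k))
    (fun s _ => lexx `|P * k|) cst_w.
  move=> /le_trans; apply; case/andP : xab => bx xa.
  have -> : \int[mu]_s ((x <= s <= a)%R%:R * (2 * (s - x) * (P * k))) = P * k * (a - x) ^+ 2.
    rewrite -int_itv_lin// -int1Z; last first.
      apply: (@bs1_itv _ _ _ _ (2 * (a - x))) => [|s /andP[h1 h2]]; first by mfun.
      by rewrite ger0_norm; lra.
    by apply: eq_Rintegral => s _; ring.
  by rewrite mulrC ler_wpM2r// lerXn2r ?nnegrE; lra.
Qed.

Lemma bounded_state_add P k P' k' (U V : state R) : bounded_state P k U -> bounded_state P' k' V ->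
  bounded_state (P + P') (k + k') (state_add U V).
Proof.
move=> [m1 m2 b1 b2] [m1' m2' b1' b2']; split.
- exact: measurable_funD.
- exact: measurable_funD.
- by apply: (aeS2 b1 b1') => x h h' xab; rewrite (le_trans (ler_normD _ _))// lerD ?h ?h'.
- by move=> x y xab yx; rewrite (le_trans (ler_normD _ _))// lerD ?b2 ?b2'.
Qed.

Definition weighted_close (M : R) (w : R -> R) (U V : state R) : Prop :=
  {ae mu, forall x, b <= x <= a -> `|U.1 x - V.1 x| <= M * w x} /\
  forall x y, b <= x <= a -> `|y| <= x -> `|U.2 x y - V.2 x y| <= M * w x.

(** The product of the components changes by at most M E w. Integrating the weight with rate 4 M
    leaves E / 4 times w, and the factor 2 in the first component of W turns this into E / 2. For
    the second component, 2^-1 times the section length 2 (s - x) is at most 1. *)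
Lemma W_halves P k P' k' (U V : state R) (M E : R) : 0 <= P -> 0 <= k -> 0 <= P' -> 0 <= k' ->
  bounded_state P k U -> bounded_state P' k' V -> P + k' <= M -> 0 < M -> 0 <= E ->
  let w x := expR (4 * M * (a - x)) in
  weighted_close E w U V -> weighted_close (E / 2) w (W a U) (W a V).
Proof.
move=> P0 k0 P0' k0' gU gV PkM M0 E0 w [c1 c2]; have [b0 ltba a1] := ba.
have [u [v r]] := bounded_state_rep P0 k0 gU; have [mU _ _ _] := gU.
have [u' [v' r']] := bounded_state_rep P0' k0' gV; have [mV _ _ _] := gV.
pose F s t := u s * v s t - u' s * v' s t.
have mF : measurable_fun setT (fun z : TR2 => F z.1 z.2).
  by apply: measurable_funB; [exact: borel_rep_measurable_mul r|exact: borel_rep_measurable_mul r'].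
have bF s t : `|F s t| <= P * k + P' * k'.
  by rewrite (le_trans (ler_normB _ _))// lerD//; [exact: borel_rep_bound_mul r|exact: borel_rep_bound_mul r'].
pose W0 x := M * E * w x.
have mw : measurable_fun setT (w : TR -> R).
  apply: (measurableT_comp (@measurable_expR R)); mfun.
have mW0 : measurable_fun setT (W0 : TR -> R) by apply: measurable_funM.
have w0 x : 0 <= w x by exact: expR_ge0.
have bW0 x s : x <= s <= a -> `|W0 s| <= W0 x.
  move=> /andP[h1 h2]; rewrite ger0_norm ?mulr_ge0 ?(ltW M0)// ler_wpM2l ?mulr_ge0 ?(ltW M0)//.
  rewrite ler_expR ler_wpM2l; lra.
have Fw : {ae mu, forall s, b <= s <= a -> forall t, `|t| <= s -> `|F s t| <= W0 s}.
  have [[mu_ bu] mv bv e1 e2] := r; have [[mu_' bu'] mv' bv' e1' e2'] := r'.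
  apply: (aeS2 c1 (aeS2 e1 e1' (fun s h1 h2 => conj h1 h2))) => s h [h1 h2] sab t ts.
  (* In this splitting only the bound P of the potential of U and the bound k' of the kernel of V
     occur, whence the hypothesis on P + k'. *)
  have -> : F s t = u s * (v s t - v' s t) + (u s - u' s) * v' s t by rewrite /F; ring.
  rewrite -e2// -e2'//.
  have d2 := c2 _ _ sab ts; have d1 := h sab; rewrite -h1// -h2//.
  rewrite (le_trans (ler_normD _ _))// !normrM.
  apply: (@le_trans _ _ (P * (E * w s) + (E * w s) * k')).
    rewrite lerD//; first by rewrite h1// ler_pM.
    by rewrite e2'// ler_pM.
  rewrite (mulrC (E * w s)) -mulrDl /W0 -mulrA ler_wpM2r// mulr_ge0//.
have IM x : b <= x <= a -> \int[mu]_s ((x <= s <= a)%R%:R * W0 s) <= E / 4 * w x.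
  move=> /andP[bx xa].
  have -> : \int[mu]_s ((x <= s <= a)%R%:R * W0 s) = E / 4 * (w x - 1).
    rewrite -int_itv_exp// -int1Z; last first.
      apply: (@bs1_itv _ _ _ _ (4 * M * w x)).
        by apply: measurable_funM => //.
      move=> s /andP[h1 h2]; rewrite ger0_norm ?mulr_ge0 ?expR_ge0 ?(ltW M0)// ler_wpM2l ?mulr_ge0 ?(ltW M0)//.
      by rewrite ler_expR ler_wpM2l; lra.
    apply: eq_Rintegral => s _; by rewrite /W0 /w; field.
  by rewrite ler_wpM2l ?divr_ge0// gerBl.
split.
- apply: aeW => x xab; rewrite (W1E ba r mU xab) (W1E ba r' mV xab) -mulrBr normrM normrN normr_nat.
  have -> : line_integral a u v x - line_integral a u' v' x = \int[mu]_s ((x <= s <= a)%R%:R * F s (2 * x - s)).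
    rewrite -int1B.
    - by apply: eq_Rintegral => s _; rewrite /F mulrBr.
    - apply: (@bs1_itv _ _ _ _ (P * k)) => [|s _]; last exact: borel_rep_bound_mul r.
      by apply: (measurable_comp2 (v := fun s t => u s * v s t) (borel_rep_measurable_mul r)); mfun.
    - apply: (@bs1_itv _ _ _ _ (P' * k')) => [|s _]; last exact: borel_rep_bound_mul r'.
      by apply: (measurable_comp2 (v := fun s t => u' s * v' s t) (borel_rep_measurable_mul r')); mfun.
  have := le_trans (line_estimate ba xab mF bF mW0 (bW0 x) Fw) (IM _ xab).
  move: `|_| (w x) => i e; clear; lra.
- move=> x y xab yx; rewrite (W2E ba r mU xab yx) (W2E ba r' mV xab yx) -mulrBr normrM normfV normr_nat.
  have -> : cone_integral a u v x y - cone_integral a u' v' x y = \int[mu2]_z ((dcone a x y z)%:R * F z.1 z.2).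
    rewrite -int2B.
    - by apply: eq_Rintegral => s _; rewrite /F mulrBr.
    - exact: (bs2_cone _ _ _ (borel_rep_measurable_mul r) (fun z => borel_rep_bound_mul z.1 z.2 r)).
    - exact: (bs2_cone _ _ _ (borel_rep_measurable_mul r') (fun z => borel_rep_bound_mul z.1 z.2 r')).
  (* Here s - x <= 1 reduces the cone estimate to the line estimate [IM]. *)
  have I : \int[mu]_s ((x <= s <= a)%R%:R * (2 * (s - x) * W0 s)) <= 2 * (E / 4 * w x).
    have bb : bs1 (fun s => (x <= s <= a)%R%:R * W0 s) by apply: (bs1_itv mW0 (bW0 x)).
    apply: (@le_trans _ _ (2 * \int[mu]_s ((x <= s <= a)%R%:R * W0 s))); last first.
      by rewrite ler_pM2l// IM.
    rewrite -int1Z//; apply: le_trans (ler_norm _) _; apply: ae_le_int.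
    - apply: (@bs1_itv _ _ _ _ (2 * W0 x)); first by apply: measurable_funM => //; mfun.
      move=> s sxa; rewrite normrM ler_pM ?bW0//; case/andP : sxa => h1 h2; case/andP : xab => ? ?.
      rewrite ger0_norm; lra.
    - exact: bs1_scale.
    - apply: aeW => s; case: (boolP (x <= s <= a)) => [/andP[h1 h2]|]; last by rewrite !mul0r normr0 mulr0.
      have W00 : 0 <= W0 s by rewrite !mulr_ge0// ltW.
      rewrite !mul1r normrM (ger0_norm W00) ler_wpM2r// ger0_norm; lra.
  have := le_trans (cone_estimate ba xab yx mF bF mW0 (bW0 x) Fw) I.
  have := w0 x; move: E0; move: `|_| (w x) => i e; clear; nra.
Qed.
End estimates.

(** * Convergence of the iteration *)

Section iteration_scheme.
Variable R : realType.
Notation mu := (@lebesgue_measure R).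
Local Notation TR := (measurableTypeR R).
Local Notation TR2 := (measurableTypeR R * measurableTypeR R)%type.

Lemma lebesgue_setT_gt0 : (0 < mu setT)%E.
Proof.
apply: (@lt_le_trans _ _ (mu `[0, 1]%classic)).
  by rewrite lebesgue_measure_itv/= lte_fin ltr01 oppr0 adde0 lte01.
by apply: le_measure; rewrite ?inE//; exact: (@measurable_itv R).
Qed.

Lemma ess_norm_le (b a c : R) (f : R -> R) : 0 <= c ->
  {ae mu, forall x, b <= x <= a -> `|f x| <= c} -> (ess_norm `[b, a] f <= c%:E)%E.
Proof.
move=> c0 h; apply/ess_supP; apply: (aeS h) => x hx; rewrite lee_fin indicE.
case: (boolP (x \in _)) => [|_]; last by rewrite mul0r.
by rewrite inE/= in_itv/= mul1r; exact: hx.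
Qed.

Lemma ess_norm_ge0 (A : set R) (f : R -> R) : (0 <= ess_norm A f)%E.
Proof.
apply: ess_sup_gee; first exact: lebesgue_setT_gt0.
by apply: aeW => x; rewrite lee_fin mulr_ge0.
Qed.

Lemma ae_le_ess_norm (b a c : R) (f : R -> R) : (ess_norm `[b, a] f <= c%:E)%E ->
  {ae mu, forall x, b <= x <= a -> `|f x| <= c}.
Proof.
move=> /ess_supP h; apply: (aeS h) => x + xab; rewrite lee_fin indicE mem_set ?mul1r//.
Qed.

Variables (b a : R).
Hypothesis ba : [/\ 0 <= b, b < a & a <= 1].
Local Notation bounded_state := (bounded_state b a).

Lemma bounded_state_in_L P k U : 0 <= P -> bounded_state P k U -> in_L b a U /\ (L_norm b a U <= (P + k)%:E)%E.
Proof.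
move=> P0 [m1 m2 b1 b2].
have n : (L_norm b a U <= (P + k)%:E)%E.
  rewrite EFinD; apply: leeD; first exact: ess_norm_le.
  by apply: ge_ereal_sup => _ [[x y] [xab yx] <-]; rewrite lee_fin; exact: b2.
split => //; split => //; last exact: (le_lt_trans n (ltry _)).
apply: measurable_funS m1; first exact: measurable_itv.
by move=> x /=; rewrite !in_itv/= => /andP[h1 h2]; rewrite !ltW.
Qed.

Lemma bounded_state_of_norm (r : R) U : measurable_fun `[b, a] (U.1 : TR -> R) ->
  measurable_fun (Delta b a) (fun z : TR2 => U.2 z.1 z.2) -> (L_norm b a U <= r%:E)%E ->
  exists P k, [/\ 0 <= P, 0 <= k, P + k <= r & bounded_state P k U].
Proof.
move=> m1 m2; rewrite /L_norm; set e1 := ess_norm _ _; set e2 := ereal_sup _ => n.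
have [b0 ltba a1] := ba.
have e10 : (0 <= e1)%E by exact: ess_norm_ge0.
(* The point (a, 0) belongs to [Delta b a]; the supremum of an empty set would be -oo. *)
have e20 : (0 <= e2)%E.
  apply: (@le_trans _ _ `|U.2 a 0|%:E); first by rewrite lee_fin.
  by apply: ereal_sup_ubound; exists (a, 0) => //; split; rewrite /= ?lexx ?(ltW ltba)// normr0; lra.
have f1 : e1 \is a fin_num.
  by rewrite ge0_fin_numE//; apply: le_lt_trans (ltry r); apply: le_trans n; rewrite leeDl.
have f2 : e2 \is a fin_num.
  by rewrite ge0_fin_numE//; apply: le_lt_trans (ltry r); apply: le_trans n; rewrite leeDr.
exists (fine e1), (fine e2); split; [exact: fine_ge0|exact: fine_ge0| |].
  by rewrite -lee_fin EFinD !fineK.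
split => //; first by apply: ae_le_ess_norm; rewrite fineK.
move=> x y xab yx; rewrite -lee_fin fineK//; apply: ereal_sup_ubound; exists (x, y) => //.
Qed.

(** The two bounds for W add up to (5/2) (a - b) P k, because (a - b)^2 <= a - b on a step of length
    at most 1. With 4 P k <= (P + k)^2 <= rt^2 this is at most (5/8) (a - b) rt^2, which the first
    entry of [mu_step] keeps below rt - r. *)
Lemma step_ball (P k Ph kh r rt : R) : 0 <= P -> 0 <= k -> P + k <= rt -> Ph + kh <= r ->
  r < rt -> 0 < rt -> a - b < mu_step r rt ->
  2 * (a - b) * (P * k) + Ph + (2^-1 * (a - b) ^+ 2 * (P * k) + kh) <= rt.
Proof.
move=> P0 k0 Pk Phk rrt rt0; have [b0 ltba a1] := ba.
rewrite /mu_step lt_min => /andP[+ _]; rewrite ltr_pdivlMr ?mulr_gt0 ?exprn_gt0// => h.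
have h1 : 2^-1 * (a - b) ^+ 2 * (P * k) <= 2^-1 * (a - b) * (P * k).
  rewrite ler_wpM2r ?mulr_ge0// ler_pM2l ?invr_gt0// expr2 ler_piMl; lra.
have h2 : 4 * (P * k) <= rt ^+ 2.
  apply: (@le_trans _ _ ((P + k) ^+ 2)); first by rewrite -subr_ge0 (_ : _ - _ = (P - k) ^+ 2) ?sqr_ge0//; ring.
  by rewrite lerXn2r// nnegrE ?addr_ge0// ltW.
have h3 : (a - b) * (4 * (P * k)) <= (a - b) * rt ^+ 2 by rewrite ler_wpM2l//; lra.
move: h h1 h2 h3 Phk rrt; clear.
rewrite (_ : 2 * (a - b) * (P * k) = 2 * ((a - b) * (P * k))); last by ring.
rewrite (_ : 2^-1 * (a - b) * (P * k) = 2^-1 * ((a - b) * (P * k))); last by ring.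
rewrite (_ : (a - b) * (4 * (P * k)) = 4 * ((a - b) * (P * k))); last by ring.
rewrite (_ : (a - b) * (5 * rt ^+ 2) = 5 * ((a - b) * rt ^+ 2)); last by ring.
move: ((a - b) * (P * k)) ((a - b) * rt ^+ 2) (2^-1 * (a - b) ^+ 2 * (P * k)) => A B D; lra.
Qed.

Lemma measurable_state_sub P k P' k' (U V : state R) : bounded_state P k U -> bounded_state P' k' V ->
  measurable_fun `[b, a] ((state_sub U V).1 : TR -> R) /\
  measurable_fun (Delta b a) (fun z : TR2 => (state_sub U V).2 z.1 z.2).
Proof. by move=> [m1 m2 _ _] [m1' m2' _ _]; split; exact: measurable_funB. Qed.

Lemma weighted_close_norm (M E : R) (w : R -> R) (U V : state R) : 0 <= E ->
  (forall x, b <= x <= a -> 0 <= w x <= M) -> 0 <= M ->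
  weighted_close b a E w U V -> (L_norm b a (state_sub U V) <= (2 * E * M)%:E)%E.
Proof.
move=> E0 wM M0 [c1 c2]; have EM0 : 0 <= E * M by exact: mulr_ge0.
have Ew x : b <= x <= a -> E * w x <= E * M by move=> /wM/andP[_ h]; exact: ler_wpM2l.
rewrite (_ : 2 * E * M = E * M + E * M); last by ring.
rewrite EFinD; apply: leeD.
  apply: ess_norm_le => //; apply: (aeS c1) => x h xab.
  by rewrite (le_trans (h xab))// Ew.
apply: ge_ereal_sup => _ [[x y] [xab yx] <-]; rewrite lee_fin.
by rewrite (le_trans (c2 _ _ xab yx))// Ew.
Qed.

Theorem iteration (h V : state R) (P' k' r rt : R) (U : nat -> state R) :
  0 <= P' -> 0 <= k' -> bounded_state P' k' V -> measurable_fun `]b, a[ (h.1 : TR -> R) ->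
  {ae mu, forall x, b <= x <= a -> V.1 x = (W a V).1 x + h.1 x} ->
  (forall x y, b <= x <= a -> `|y| <= x -> V.2 x y = (W a V).2 x y + h.2 x y) ->
  (L_norm b a h <= r%:E)%E -> r < rt -> a - b < mu_step r rt ->
  U 0%N = h -> (forall n, U n.+1 = state_add (W a (U n)) h) ->
  converges_in_L b a U V /\ geometric_rate_in_L b a U V.
Proof.
move=> P0' k0' gV mh1 V1 V2 nh rrt ab U0 US; have [b0 ltba a1] := ba.
have gW := bounded_state_W ba P0' k0' gV.
(* On [Delta b a] the fixed-point equation gives h.2 as the difference of V.2 and (W V).2, so
   measurability needs no analysis of h itself. *)
have mh2 : measurable_fun (Delta b a) (fun z : TR2 => h.2 z.1 z.2).
  have [_ m2] := measurable_state_sub gV gW.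
  apply: eq_measurable_fun m2 => -[x y]; rewrite inE => -[/= xab yx].
  by rewrite V2// addrC addKr.
have [Ph [kh [Ph0 kh0 Phk gh]]] := bounded_state_of_norm (measurable_fun_itv_cc mh1) mh2 nh.
have rt0 : 0 < rt by apply: le_lt_trans rrt; apply: le_trans Phk; exact: addr_ge0.
have gU n : exists P k, [/\ 0 <= P, 0 <= k, P + k <= rt & bounded_state P k (U n)].
  elim: n => [|n [P [k [p0 k0 Pk g]]]]; first by exists Ph, kh; rewrite U0; split => //; apply: le_trans (ltW rrt).
  exists (2 * (a - b) * (P * k) + Ph), (2^-1 * (a - b) ^+ 2 * (P * k) + kh); split.
  - by rewrite addr_ge0// !mulr_ge0// subr_ge0 ltW.
  - by rewrite addr_ge0// !mulr_ge0// ?subr_ge0 ltW.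
  - exact: step_ball ab.
  - by rewrite US; apply: bounded_state_add gh; exact: bounded_state_W.
(* rt bounds the potentials of all iterates and k' the kernel of V, as [W_halves] requires; V itself
   may lie outside the ball of radius rt. *)
pose M := rt + k'; have M0 : 0 < M by rewrite ltr_pwDl.
pose w x := expR (4 * M * (a - x)).
have w1 x : x <= a -> 1 <= w x.
  by move=> xa; rewrite -expR0 ler_expR mulr_ge0// ?subr_ge0// mulr_ge0// ltW.
(* The initial distance: U 0 = h, so V - U 0 = W V, and E is the bound for W V. *)
pose E := 2 * (a - b) * (P' * k') + 2^-1 * (a - b) ^+ 2 * (P' * k').
have e1 : 0 <= 2 * (a - b) * (P' * k') by rewrite !mulr_ge0// subr_ge0 ltW.
have e2 : 0 <= 2^-1 * (a - b) ^+ 2 * (P' * k') by rewrite !mulr_ge0// ?subr_ge0 ltW.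
have E0 : 0 <= E by exact: addr_ge0.
have cancel (x y z : R) : x + z - (y + z) = x - y by ring.
have cl n : weighted_close b a (E / 2 ^+ n) w (U n) V.
  elim: n => [|n IH].
    have [_ _ w1' w2'] := gW; rewrite U0 expr0 divr1; split.
      apply: (aeS2 V1 w1') => x hx h1 xab; rewrite hx// opprD addrC subrK normrN.
      apply: (le_trans (h1 xab)); apply: (@le_trans _ _ (E * 1)); first by rewrite mulr1 lerDl.
      by rewrite ler_wpM2l// w1//; case/andP : xab.
    move=> x y xab yx; rewrite V2// opprD addrC subrK normrN.
    apply: (le_trans (w2' _ _ xab yx)); apply: (@le_trans _ _ (E * 1)); first by rewrite mulr1 lerDr.
    by rewrite ler_wpM2l// w1//; case/andP : xab.
  have [P [k [p0 k0 Pk g]]] := gU n.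
  have PM : P + k' <= M by rewrite lerD2r (le_trans _ Pk)// lerDl.
  have En : 0 <= E / 2 ^+ n by rewrite divr_ge0// exprn_ge0.
  have [c1 c2] := W_halves ba p0 k0 P0' k0' g gV PM M0 En IH.
  rewrite US exprSr invfM mulrA; split.
    apply: (aeS2 V1 c1) => x hx h1 xab.
    by rewrite hx// [X in `|X|](_ : _ = (W a (U n)).1 x - (W a V).1 x) ?h1//; exact: cancel.
  move=> x y xab yx.
  by rewrite V2// [X in `|X|](_ : _ = (W a (U n)).2 x y - (W a V).2 x y) ?c2//; exact: cancel.
pose A := expR (4 * M * (a - b)).
have nU n : (L_norm b a (state_sub (U n) V) <= (2 * E * A * 2^-1 ^+ n)%:E)%E.
  have -> : 2 * E * A * 2^-1 ^+ n = 2 * (E / 2 ^+ n) * A by rewrite exprVn; ring.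
  apply: weighted_close_norm (cl n); rewrite ?expR_ge0 ?divr_ge0 ?exprn_ge0//.
  move=> x /andP[bx xa]; rewrite expR_ge0 ler_expR ler_wpM2l ?mulr_ge0 ?(ltW M0)//.
  by rewrite lerD2l lerN2.
split; last by exists (2 * E * A), 2^-1; split => //; rewrite invr_ge0 ler0n invf_lt1// ltr1n.
split.
- by move=> n; have [P [k [p0 k0 _ g]]] := gU n; have [] := bounded_state_in_L p0 g.
- by have [] := bounded_state_in_L P0' gV.
- apply: (@squeeze_cvge _ _ _ _ (fun=> 0%E) _ (fun n => (2 * E * A * 2^-1 ^+ n)%:E)).
  + apply: nearW => n; rewrite nU andbT; apply: adde_ge0; first exact: ess_norm_ge0.
    apply: (@le_trans _ _ `|(state_sub (U n) V).2 a 0|%:E); first by rewrite lee_fin.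
    by apply: ereal_sup_ubound; exists (a, 0) => //; split; rewrite /= ?lexx ?(ltW ltba)// normr0; lra.
  + exact: cvg_cst.
  + apply: cvg_EFin; first by apply: nearW.
    by apply: cvg_geometric; rewrite ger0_norm ?invr_ge0// invf_lt1// ltr1n.
Qed.
End iteration_scheme.

(** * Reduction to everywhere defined potentials and kernels *)

Section reduction.
Variable R : realType.
Notation mu := (@lebesgue_measure R).
Notation mu2 := (@mu2 R).
Local Notation TR := (measurableTypeR R).
Local Notation TR2 := (measurableTypeR R * measurableTypeR R)%type.

Lemma dplateau_supp (N lo hi r : R) : 0 < N -> 5 * N^-1 <= hi - lo ->
  ~~ (lo + N^-1 <= r <= hi - N^-1) -> dplateau N lo hi r = 0.
Proof.
move=> N0 Nh; have NV : N * N^-1 = 1 by rewrite mulfV// gt_eqF.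
have Ni : 0 < N^-1 by rewrite invr_gt0.
rewrite negb_and -!ltNge => /orP[h|h]; rewrite /dplateau.
  rewrite !bump_lo ?mulr0 ?addr0// mulr_ge0_le0 ?ltW//; lra.
rewrite !bump_hi ?mulr0 ?addr0//.
  have : N * (3 * N^-1) <= N * (r - (hi - 4 / N)) by rewrite ler_pM2l//; lra.
  by rewrite mulrCA NV mulr1.
have : N * (3 * N^-1) <= N * (r - (lo + N^-1)) by rewrite ler_pM2l//; lra.
by rewrite mulrCA NV mulr1.
Qed.

(* Borel resp. continuous versions, defined and bounded everywhere, of q and K *)
Definition kernel_pair (C : R) (p : R -> R) (k : R -> R -> R) : Prop :=
  [/\ continuous (fun z : R * R => k z.1 z.2) /\ (forall x y, `|k x y| <= C),
      measurable_fun [set: TR] (p : TR -> R) /\ (forall x, `|p x| <= C),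
      forall x, ~~ (0 <= x <= 1) -> p x = 0,
      forall s t, k s (- t) = - k s t
    & plateau_wave_equation k p /\ (forall x, 0 <= x <= 2 -> k x x = 2^-1 * Qp p x)].

(** The bound x <= 2 leaves room to the right of every line x = a with a <= 1, as needed for
    two-sided difference quotients in x. It matches the condition [xi + eta <= 4] of
    [plateau_wave_equation], since x = (xi + eta) / 2 at the far corner of the rectangle. *)
Definition extends (q : R -> R) (K : R -> R -> R) (p : R -> R) (k : R -> R -> R) : Prop :=
  [/\ measurable_fun `[0 : R, 1] (q : TR -> R),
      {ae mu, forall x, 0 <= x -> q x = p x}
    & forall x y, x <= 2 -> `|y| <= x -> K x y = k x y].

Lemma plateau_box (N eta xi x y : R) :
  dx (dx (charprod (plateau N eta xi) (plateau N 0 eta))) x y -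
  dy (dy (charprod (plateau N eta xi) (plateau N 0 eta))) x y =
  4 * charprod (dplateau N eta xi) (dplateau N 0 eta) x y.
Proof.
exact: (charprod_box (plateau_derive N eta xi) (plateau_derive N 0 eta) (dplateau_derive N eta xi)
  (dplateau_derive N 0 eta) (@ddplateau_continuous _ N eta xi) (@ddplateau_continuous _ N 0 eta)).
Qed.

(* a retraction of the plane onto the triangle 0 <= y <= x <= 2 *)
Definition retract_triangle (z : R * R) : R * R :=
  let c := Num.max 0 (Num.min z.1 2) in (c, Num.max 0 (Num.min z.2 c)).

Lemma continuous_clamp (f g : R * R -> R) : continuous f -> continuous g ->
  continuous (fun z => Num.max 0 (Num.min (f z) (g z))).
Proof.
move=> cf cg z.
exact: (@continuous_max R _ (fun=> 0) (fun z => Num.min (f z) (g z)) z (cvg_cst _)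
  (@continuous_min R _ f g z (cf z) (cg z))).
Qed.

Lemma continuous_retract_triangle : continuous retract_triangle.
Proof.
have c1 : continuous (fun z : R * R => Num.max 0 (Num.min z.1 2)).
  by apply: continuous_clamp => z; [exact: cvg_fst|exact: cvg_cst].
have c2 : continuous (fun z : R * R => Num.max 0 (Num.min z.2 (Num.max 0 (Num.min z.1 2)))).
  by apply: continuous_clamp => // z; exact: cvg_snd.
by move=> z; exact: (cvg_pair (c1 z) (c2 z)).
Qed.

Lemma retract_triangle_sector z : (retract_triangle z).1 <= 2 /\ closed_sector (retract_triangle z).
Proof.
rewrite /retract_triangle/closed_sector/=; set c := Num.max 0 _.
have c0 : 0 <= c by rewrite /c le_max lexx.
have c2 : c <= 2 by rewrite /c ge_max ler0n ge_min lexx orbT.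
by rewrite c2 le_max lexx ge_max c0 ge_min lexx orbT.
Qed.

Lemma retract_triangle_id x y : 0 <= y <= x -> x <= 2 -> retract_triangle (x, y) = (x, y).
Proof.
move=> /andP[y0 yx] x2; have x0 := le_trans y0 yx; rewrite /retract_triangle/=.
by rewrite (min_l x2) (max_r x0) (min_l yx) (max_r y0).
Qed.

Lemma retract_triangle_neg x y : y <= 0 -> (retract_triangle (x, y)).2 = 0.
Proof.
move=> y0; rewrite /retract_triangle/=; apply: max_l; rewrite ge_min y0//.
Qed.

(** K is composed with the retraction onto the triangle and then made odd in y. For y <= 0 the
    retraction lands on the axis, where K vanishes, so of the two terms at y and -y only one
    contributes. The composition is invariant under the retraction, so its bound on a compact square
    holds on the whole plane. *)
Lemma kernel_extension (K : R -> R -> R) :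
  {within @closed_sector R, continuous (fun z : R * R => K z.1 z.2)} ->
  (forall x, 0 <= x -> K x 0 = 0) -> (forall x y, 0 <= y <= x -> K x (- y) = - K x y) ->
  exists (C : R) (k : R -> R -> R),
  [/\ continuous (fun z : R * R => k z.1 z.2), forall x y, `|k x y| <= C,
      forall s t, k s (- t) = - k s t &
      forall x y, x <= 2 -> `|y| <= x -> K x y = k x y].
Proof.
move=> cK K0 Kodd.
pose Kp (z : R * R) := K (retract_triangle z).1 (retract_triangle z).2.
have cKp : continuous Kp.
  move=> z; have /subspace_continuousP h := cK.
  have [_ tz] := retract_triangle_sector z.
  apply: (@cvg_comp _ _ _ retract_triangle (fun z : R * R => K z.1 z.2) _ (within (@closed_sector R) (nbhs (retract_triangle z)))).
    move=> A hA; have h1 : nbhs z [set w | closed_sector (retract_triangle w) -> A (retract_triangle w)] := @continuous_retract_triangle z _ hA.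
    by change (nbhs z (retract_triangle @^-1` A)); apply: filterS h1 => w /=; apply; have [] := retract_triangle_sector w.
  exact: h.
have [C bKp] : exists C, forall z, `|Kp z| <= C.
  have /compact_bounded : compact (Kp @` ([set` `[0 : R, 2]] `*` [set` `[0 : R, 2]])).
    apply: continuous_compact; first exact: continuous_subspaceT.
    by apply: compact_setX; exact: segment_compact.
  move=> [M [_ /(_ (M + 1))]]; rewrite ltrDl ltr01 => /(_ isT) h.
  exists (M + 1) => z; have [t2 /andP[t0 t1]] := retract_triangle_sector z.
  have -> : Kp z = Kp (retract_triangle z).
    by rewrite /Kp (_ : retract_triangle (retract_triangle z) = retract_triangle z)//; case: (retract_triangle z) t2 t0 t1 => x y /= *; rewrite retract_triangle_id//; apply/andP.
  apply: h; exists (retract_triangle z) => //; split; rewrite /= in_itv/=.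
    by rewrite t2 (le_trans t0 t1).
  by rewrite t0 (le_trans t1 t2).
exists (C + C), (fun x y => Kp (x, y) - Kp (x, - y)); split.
- move=> z; apply: cvgB; first by rewrite -surjective_pairing; under eq_fun do rewrite -surjective_pairing; exact: cKp.
  apply: (@cvg_comp _ _ _ (fun z : R * R => (z.1, - z.2)) Kp _ (nbhs (z.1, - z.2))); last exact: cKp.
  have h1 : continuous (fun z : R * R => z.1) by move=> w; exact: cvg_fst.
  have h2 : continuous (fun z : R * R => - z.2) by move=> w; apply: cvgN; exact: cvg_snd.
  exact: (cvg_pair (h1 z) (h2 z)).
- by move=> x y; rewrite (le_trans (ler_normB _ _))// lerD.
- by move=> s t; rewrite opprK opprB.
- move=> x y x2; rewrite ler_norml => /andP[y1 y2].
  have x0 : 0 <= x by lra.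
  have c0 : 0 <= Num.max 0 (Num.min x 2) by rewrite le_max lexx.
  rewrite /Kp; have [y0|y0] := leP 0 y.
    by rewrite (@retract_triangle_id x y) ?y0// (@retract_triangle_neg x (- y)) ?oppr_le0// K0 ?subr0.
  rewrite (@retract_triangle_neg x y) ?(ltW y0)// K0// sub0r (@retract_triangle_id x (- y))//=.
    by rewrite -Kodd ?opprK//; apply/andP; split; lra.
  by apply/andP; split; lra.
Qed.

(** Cutting q off at its essential supremum changes it on [0, 1] only in a null set and turns the
    essential bound into a bound at every point. *)
Lemma potential_truncation (q : R -> R) : admissible_potential q ->
  exists (C : R) (p : R -> R),
  [/\ measurable_fun [set: TR] (p : TR -> R), forall x, `|p x| <= C,
      forall x, ~~ (0 <= x <= 1) -> p x = 0, measurable_fun [set x : TR | 0 <= x] (q : TR -> R)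
    & {ae mu, forall x, 0 <= x -> q x = p x}].
Proof.
move=> [mq qC q1].
pose q0 x := if 0 <= x <= 1 then q x else 0.
have mq0 : measurable_fun [set: TR] (q0 : TR -> R).
  apply: measurable_fun_if => //; first by mfun.
  by apply: measurable_funS mq => // x [_].
pose c := fine (ess_norm `[0%R, 1%R] q).
have fc : ess_norm `[0%R, 1%R] q \is a fin_num by rewrite ge0_fin_numE// ess_norm_ge0.
exists c, (fun x => if `|q0 x| <= c then q0 x else 0); split.
- apply: measurable_fun_ifT => //.
  by apply: measurable_fun_ler; mfun; exact: (measurableT_comp (@normr_measurable R setT)).
- by move=> x; case: ifPn => //; rewrite normr0 fine_ge0// ess_norm_ge0.
- by move=> x /negbTE h; rewrite /q0 h; case: ifP.
- apply: (@eq_measurable_fun _ _ TR _ _ q0); last exact: measurable_funTS.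
  move=> x; rewrite inE/= /q0 => ->/=; case: (leP x 1) => // x1.
  by rewrite q1.
- have : (ess_norm `[0%R, 1%R] q <= c%:E)%E by rewrite fineK.
  move=> /ae_le_ess_norm h; apply: (aeS h) => x hx x0; rewrite /q0 x0/=.
  case: (leP x 1) => x1; last by rewrite q1// normr0; case: ifP.
  by rewrite hx ?x0.
Qed.

Theorem reduction (q : R -> R) (K : R -> R -> R) :
  admissible_potential q -> transformation_kernel q K ->
  exists C p k, [/\ 0 <= C, kernel_pair C p k & extends q K p k].
Proof.
move=> hq [cK _ wK dK zK oK].
have [C1 [p [mp bp p0 mq qp]]] := potential_truncation hq.
have [C2 [k [ck bk kodd Kk]]] := kernel_extension cK zK oK.
have C10 : 0 <= C1 by exact: le_trans (bp 0).
have C20 : 0 <= C2 by exact: le_trans (bk 0 0).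
exists (C1 + C2), p, k; split; first exact: addr_ge0.
  split.
  - by split => // x y; rewrite (le_trans (bk x y))// lerDr.
  - by split => // x; rewrite (le_trans (bp x))// lerDl.
  - exact: p0.
  - exact: kodd.
  - split; last first.
      move=> x /andP[x0 x2]; rewrite -Kk ?dK// ?ger0_norm//; congr (_ * _).
      rewrite /Qp /Rintegral; congr fine; apply: ae_eq_integral.
      + exact: (@measurable_itv R).
      + apply/measurable_EFinP; apply: measurable_funS mq.
          by rewrite -set_itvE; exact: measurable_itv.
        by move=> t /=; rewrite in_itv/= => /andP[].
      + by apply/measurable_EFinP; exact: measurable_funTS.
      + by apply: (aeS qp) => t h /=; rewrite in_itv/= => /andP[t0 _]; rewrite h.
    move=> N eta xi N0 e0 h1 h2 h3; have Ni : 0 < N^-1 by rewrite invr_gt0.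
    have e00 : 5 * N^-1 <= eta - 0 by rewrite subr0.
    have := wK _ (plateau_test N0 e0 h1 h2).
    set f := plateau N eta xi; set g := plateau N 0 eta.
    set f' := dplateau N eta xi; set g' := dplateau N 0 eta.
    have box x y : dx (dx (charprod f g)) x y - dy (dy (charprod f g)) x y = 4 * charprod f' g' x y.
      exact: plateau_box.
    (* Off A both products of plateaus vanish; on A, xi + eta <= 4 gives x <= 2, so K may be
       replaced by k. Comparing on A thus suffices for the whole sector. *)
    pose A (z : R * R) := (eta + N^-1 <= z.1 + z.2 <= xi - N^-1) && (0 + N^-1 <= z.1 - z.2 <= eta - N^-1).
    have out z : ~~ A z -> charprod f g z.1 z.2 = 0 /\ charprod f' g' z.1 z.2 = 0.
      rewrite negb_and /charprod /f /g /f' /g' => /orP[h|h].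
        by rewrite plateau_supp// dplateau_supp// !mul0r.
      by split; [rewrite (plateau_supp _ _ h)// mulr0|rewrite (dplateau_supp _ _ h)// mulr0].
    have inn z : A z -> open_sector z /\ K z.1 z.2 = k z.1 z.2.
      move=> /andP[/andP[a1 a2] /andP[a3 a4]]; split; first by apply/andP; split; lra.
      by apply: Kk; [lra|rewrite ler_norml; apply/andP; split; lra].
    move=> <-; symmetry.
    have mO : measurable (@open_sector R : set TR2).
      by apply: (@measurable_bool_set _ TR2 (fun z => 0 < z.2 < z.1)); mfun.
    have mf : measurable_fun setT (fun z : TR2 => charprod f g z.1 z.2).
      apply: (@continuous_mfun2 R (fun z => charprod f g z.1 z.2)); apply: charprod_continuous.
        exact: derive_continuous (plateau_derive N eta xi).
      exact: derive_continuous (plateau_derive N 0 eta).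
    have mf' : measurable_fun setT (fun z : TR2 => charprod f' g' z.1 z.2).
      apply: (@continuous_mfun2 R (fun z => charprod f' g' z.1 z.2)); apply: charprod_continuous.
        exact: derive_continuous (dplateau_derive N eta xi).
      exact: derive_continuous (dplateau_derive N 0 eta).
    have mk : measurable_fun setT (fun z : TR2 => k z.1 z.2) by exact: (continuous_mfun2 ck).
    have mqf : measurable_fun (@open_sector R) (fun z : TR2 => q z.1).
      apply: (measurable_fun_comp_fst _ _ mq); last by move=> z /andP[h h']; exact: ltW (lt_trans h h').
      by rewrite -set_itvE; exact: measurable_itv.
    transitivity (\int[mu2]_(z in @open_sector R) (k z.1 z.2 * (4 * charprod f' g' z.1 z.2)
       - q z.1 * k z.1 z.2 * charprod f g z.1 z.2)).
      apply: eq_Rintegral => z _; rewrite box.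
      have [/inn[_ ->]//|/out[-> ->]] := boolP (A z); by rewrite !mulr0.
    transitivity (\int[mu2]_(z in @open_sector R) (k z.1 z.2 * (4 * charprod f' g' z.1 z.2)
       - p z.1 * k z.1 z.2 * charprod f g z.1 z.2)).
      rewrite /Rintegral; congr fine; apply: ae_eq_integral => //.
      + apply/measurable_EFinP; apply: measurable_funB.
          by apply: measurable_funTS; apply: measurable_funM => //; apply: measurable_funM.
        by apply: measurable_funM; [apply: measurable_funM => //|]; exact: measurable_funTS.
      + apply/measurable_EFinP; apply: measurable_funTS; apply: measurable_funB.
          by apply: measurable_funM => //; apply: measurable_funM.
        apply: measurable_funM => //; apply: measurable_funM => //.
        by apply: (measurableT_comp mp); exact: measurable_fst.
      + have [M [mM M0 PM]] := ae_fst qp; exists M; split => // z nz; apply: PM => /= h.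
        by apply: nz => /andP[z1 z2]; rewrite h// ltW// (lt_trans z1 z2).
    rewrite Rintegral_mkcond; apply: eq_Rintegral => z _; rewrite patchE.
    case: ifPn => // /negP nz; have /out[-> ->] : ~~ A z by apply/negP => /inn[/mem_set].
    by rewrite !mulr0 subrr.
split => //.
apply: measurable_funS mq; first by rewrite -set_itvE; exact: measurable_itv.
by move=> t /=; rewrite in_itv/= => /andP[].
Qed.
End reduction.

(** * Limits of difference quotients as Borel functions *)

Section quotients.
Variable R : realType.
Notation mu := (@lebesgue_measure R).
Local Notation TR := (measurableTypeR R).

(** Countable bases in the form in which [measurable_lim] takes its filter; this one serves
    two-sided derivatives, the next one right-hand derivatives. *)
Lemma small_dnbhs (A : set R) :
  (0^' : set_system R) A <-> exists m : nat, forall h : R, h != 0 -> `|h| < m.+1%:R^-1 -> A h.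
Proof.
split.
  move=> [e /= e0 eA]; have [m] := ltr_add_invr e0; rewrite add0r => me.
  by exists m => h h0 hm; apply: eA => //=; rewrite sub0r normrN; exact: lt_trans me.
move=> [m hm]; exists m.+1%:R^-1; first by rewrite /= invr_gt0.
by move=> h /=; rewrite sub0r normrN => h1 h2; exact: hm.
Qed.

Lemma small_right (A : set R) :
  (0^'+ : set_system R) A <-> exists m : nat, forall h : R, 0 < h -> `|h| < m.+1%:R^-1 -> A h.
Proof.
split.
  move=> [e /= e0 eA]; have [m] := ltr_add_invr e0; rewrite add0r => me.
  by exists m => h h0 hm; apply: eA => //=; rewrite sub0r normrN; exact: lt_trans me.
move=> [m hm]; exists m.+1%:R^-1; first by rewrite /= invr_gt0.
by move=> h /=; rewrite sub0r normrN => h1 h2; exact: hm.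
Qed.

Lemma lim_near_eq (T : Type) (F : set_system T) (f g : T -> R) : Filter F ->
  (\forall x \near F, f x = g x) -> lim (f @ F) = lim (g @ F).
Proof.
move=> FF E; congr (lim _); apply/seteqP; split => A /= H; near=> x.
  by rewrite /= -(near E x)//; near: x.
by rewrite /= (near E x)//; near: x.
Unshelve. all: by end_near. Qed.

Lemma continuous_quot (f : R -> R) (c : R) : continuous f -> forall h : R, h != 0 ->
  {for h, continuous (fun t : R => t^-1 * (f t - c))}.
Proof.
move=> cf h h0; apply: cvgM; first by apply: cvgV => //; exact: cvg_id.
by apply: cvgB; [exact: cf|exact: cvg_cst].
Qed.

Variables (k : R -> R -> R).
Hypothesis ck : continuous (fun z : R * R => k z.1 z.2).

Lemma continuous_line (f g : R -> R) : continuous f -> continuous g ->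
  continuous (fun x => k (f x) (g x)).
Proof.
move=> cf cg x; exact: (@cvg_comp _ _ _ (fun x => (f x, g x)) (fun z : R * R => k z.1 z.2)
  _ _ _ (cvg_pair (cf x) (cg x)) (@ck (f x, g x))).
Qed.

Let ne0 : open [set h : R | h != 0].
Proof. exact: open_neq. Qed.

Let mk d (T : measurableType d) (f g : T -> R) : measurable_fun setT f ->
  measurable_fun setT g -> measurable_fun setT (fun x => k (f x) (g x)).
Proof. exact: continuous_comp2 ck. Qed.

Lemma measurable_dx a : measurable_fun setT ((fun y => derive1 (k^~ y) a) : TR -> R).
Proof.
apply: (@measurable_lim R (fun h y => h^-1 * (k (h + a) y - k a y)) [set h | h != 0]).
- exact: ne0.
- by move=> m /=; rewrite invr_eq0 pnatr_eq0.
- exact: small_dnbhs.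
- by move=> h _; apply: measurable_funM => //; apply: measurable_funB; apply: mk => //; mfun.
- move=> y h h0; apply: (@continuous_quot (fun h => k (h + a) y)) => //.
  apply: continuous_line => x; last exact: cvg_cst.
  by apply: cvgD; [exact: cvg_id|exact: cvg_cst].
Qed.

Lemma measurable_dy a : measurable_fun setT (derive1 (k a) : TR -> R).
Proof.
apply: (@measurable_lim R (fun h y => h^-1 * (k a (h + y) - k a y)) [set h | h != 0]).
- exact: ne0.
- by move=> m /=; rewrite invr_eq0 pnatr_eq0.
- exact: small_dnbhs.
- by move=> h _; apply: measurable_funM => //; apply: measurable_funB; [apply: (@mk _ TR (fun=> a) (fun y => h + y)) => //; mfun|apply: (@mk _ TR (fun=> a) id) => //; mfun].
- move=> y h h0; apply: (@continuous_quot (fun h => k a (h + y))) => //.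
  apply: continuous_line => x; first exact: cvg_cst.
  by apply: cvgD; [exact: cvg_id|exact: cvg_cst].
Qed.

Lemma measurable_right_dx a : measurable_fun setT
  ((fun y => lim ((fun h : R => h^-1 * (k (a + h) y - k a y)) @ 0^'+)) : TR -> R).
Proof.
apply: (@measurable_lim R (fun h y => h^-1 * (k (a + h) y - k a y)) [set h | 0 < h]).
- exact: open_gt.
- by move=> m /=; rewrite invr_gt0.
- exact: small_right.
- by move=> h _; apply: measurable_funM => //; apply: measurable_funB; apply: mk => //; mfun.
- move=> y h h0; apply: (@continuous_quot (fun h => k (a + h) y)); last by rewrite gt_eqF.
  apply: continuous_line => x; last exact: cvg_cst.
  by apply: cvgD; [exact: cvg_cst|exact: cvg_id].
Qed.

End quotients.

(** * Cauchy data on a line and the step carried out from it *)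

Section lines.
Variable R : realType.
Notation mu := (@lebesgue_measure R).
Notation mu2 := (@mu2 R).
Local Notation TR := (measurableTypeR R).
Local Notation TR2 := (measurableTypeR R * measurableTypeR R)%type.

Lemma derive1_near_eq (f g : R -> R) (a : R) : (\forall x \near a, f x = g x) ->
  derive1 f a = derive1 g a.
Proof.
move=> E; apply: lim_near_eq; have Ea := nbhs_singleton E.
have [e /= e0 eE] := E; exists e => //= h /=; rewrite sub0r normrN => he _.
by rewrite Ea eE//= opprD addrCA subrr addr0 normrN.
Qed.

Lemma is_derive_right (f : R -> R) (a l : R) : is_derive a 1 f l ->
  (fun h => h^-1 * (f (a + h) - f a)) @ 0^'+ --> l.
Proof.
move=> [df dl]; have : h^-1 *: (f (h *: 1 + a) - f a) @[h --> 0^'] --> l by rewrite -dl; exact: df.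
move=> H A /H /= /small_dnbhs[m hm]; apply/small_right; exists m => h h0 hm'.
by have := hm h (lt0r_neq0 h0) hm'; rewrite /= /GRing.scale/= mulr1 (addrC h).
Qed.

Variables (q : R -> R) (K : R -> R -> R) (C : R) (p : R -> R) (k : R -> R -> R).
Hypothesis hp : kernel_pair C p k.
Hypothesis he : extends q K p k.
Hypothesis C0 : 0 <= C.

(** What the free term reads of the data, stated so that the two-sided data of the first line and
    the right-hand data of later lines both satisfy it. All that follows about a step depends on the
    data only through this. *)
Definition line_data (a : R) (d : data R) : Prop :=
  [/\ forall y, `|y| <= a -> d.1 y = k a y,
      {ae mu, forall y, `|y| < a -> d.2 y = gam p k a (a + y) - gam p k a (a - y)},
      measurable_fun `]- a, a[ (d.2 : TR -> R)
    & measurable_fun `]- a, a[ (derive1 d.1 : TR -> R)].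

Lemma measurable_derive1_data a (d1 : R -> R) : (forall y, `|y| <= a -> d1 y = k a y) ->
  measurable_fun `]- a, a[ (derive1 d1 : TR -> R).
Proof.
have [[ck bk] _ _ _ _] := hp; move=> d1E.
apply: (@eq_measurable_fun _ _ TR _ _ (derive1 (k a))); last first.
  by apply: measurable_funTS; exact: measurable_dy.
move=> y; rewrite inE/= in_itv/= -ltr_norml => ya; symmetry; apply: derive1_near_eq.
near=> x; rewrite d1E//; apply: ltW; near: x.
by apply: (@cvgr_norm_lt _ _ _ _ _ id y) => //; exact: cvg_id.
Unshelve. all: by end_near. Qed.

Lemma near_extends (a y : R) : 0 < a <= 1 -> `|y| < a -> \forall x \near a, k x y = K x y.
Proof.
have [_ _ Kk] := he; move=> /andP[a0 a1] ya; near=> x; rewrite Kk//; apply: ltW; near: x.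
  by apply: lt_nbhsl; lra.
by apply: lt_nbhsr.
Unshelve. all: by end_near. Qed.

Lemma cauchy_line_data a : 0 < a <= 1 -> line_data a (cauchy_data K a).
Proof.
move=> a01; have [a0 a1] := andP a01; have [_ _ Kk] := he.
have [[ck bk] [mp bp] p0 kodd [W kd]] := hp.
have Ka y : `|y| <= a -> K a y = k a y by move=> ya; apply: Kk => //; lra.
split => //=; last exact: measurable_derive1_data.
- apply: (aeS (ae_regular_point ck bk mp bp p0 a)) => y g ya.
  have h := kernel_dx ck bk mp bp p0 kodd W kd a1 (g ya).
  by rewrite -(derive1_near_eq (near_extends a01 ya)) derive1E derive_val.
- apply: (@eq_measurable_fun _ _ TR _ _ (fun y => derive1 (k^~ y) a)); last first.
    by apply: measurable_funTS; exact: measurable_dx.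
  by move=> y; rewrite inE/= in_itv/= -ltr_norml => ya; apply: derive1_near_eq; exact: near_extends.
Qed.

Lemma right_line_data a : 0 < a <= 1 -> line_data a (right_cauchy_data K a).
Proof.
move=> a01; have [a0 a1] := andP a01; have [_ _ Kk] := he.
have [[ck bk] [mp bp] p0 kodd [W kd]] := hp.
have Ka y : `|y| <= a -> K a y = k a y by move=> ya; apply: Kk => //; lra.
have E y : `|y| < a -> lim ((fun h : R => h^-1 * (k (a + h) y - k a y)) @ 0^'+) =
    lim ((fun h : R => h^-1 * (K (a + h) y - K a y)) @ 0^'+).
  move=> ya; apply: lim_near_eq.
  (* For 0 < h < 1 and a <= 1 the point a + h stays below 2, where K and k agree. *)
  exists 1 => //= h /=; rewrite sub0r normrN => h1 h0.
  by have hl := ler_norm h; have ya' := ltW ya; rewrite !Kk//; lra.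
split => //=; last exact: measurable_derive1_data.
- apply: (aeS (ae_regular_point ck bk mp bp p0 a)) => y g ya.
  have h := kernel_dx ck bk mp bp p0 kodd W kd a1 (g ya).
  rewrite -E//; apply: cvg_lim; first exact: Rhausdorff.
  exact: (is_derive_right h).
- apply: (@eq_measurable_fun _ _ TR _ _ (fun y => lim ((fun h : R => h^-1 * (k (a + h) y - k a y)) @ 0^'+))).
    by move=> y; rewrite inE/= in_itv/= -ltr_norml => ya; exact: E.
  by apply: measurable_funTS; exact: measurable_right_dx.
Qed.

Section one_step.
Variables (b a : R) (d : data R).
Hypothesis ba : [/\ 0 <= b, b < a & a <= 1].
Hypothesis hd : line_data a d.

Lemma bounded_state_pair : bounded_state b a C C (q, K).
Proof.
have [b0 ltba a1] := ba; have [mq qp Kk] := he.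
have [[ck bk] [mp bp] p0 kodd [W kd]] := hp; split.
- apply: measurable_funS mq; first exact: measurable_itv.
  by move=> x /=; rewrite !in_itv/= => /andP[h1 h2]; apply/andP; split; lra.
- apply: (@eq_measurable_fun _ _ TR2 _ _ (fun z => k z.1 z.2)); last first.
    by apply: measurable_funTS; exact: (continuous_mfun2 ck).
  by move=> -[x y]; rewrite inE => -[/= /andP[_ h] yx]; rewrite Kk//; lra.
- by apply: (aeS qp) => x h /andP[h1 h2]; rewrite [(q, K).1 x]h//; lra.
- by move=> x y /andP[_ h] yx; rewrite [(q, K).2 x y]Kk//; lra.
Qed.

Lemma borel_rep_pair : borel_rep b a C C (q, K) p k.
Proof.
have [b0 ltba a1] := ba; have [mq qp Kk] := he.
have [[ck bk] [mp bp] p0 kodd [W kd]] := hp; split => //.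
- exact: (continuous_mfun2 ck).
- by apply: (aeS qp) => x h /andP[h1 h2]; rewrite [(q, K).1 x]h//; lra.
- by move=> x y /andP[_ h] yx; rewrite [(q, K).2 x y]Kk//; lra.
Qed.

Lemma free_term_measurable : measurable_fun `]b, a[ ((free_term a d).1 : TR -> R).
Proof.
have [b0 ltba a1] := ba; have [_ _ m1 m2] := hd.
have maff : measurable_fun `]b, a[ (fun x : TR => 2 * x - a).
  by apply: measurable_funTS; exact: measurable_affine.
have aff : (fun x : TR => 2 * x - a) @` `]b, a[ `<=` `]- a, a[.
  by move=> _ [x /= + <-]; rewrite !in_itv/= => /andP[? ?]; apply/andP; split; lra.
apply: measurable_funM; first exact: measurable_cst.
apply: measurable_funD.
  by apply: (measurable_comp _ aff m2 maff); exact: measurable_itv.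
by apply: (measurable_comp _ aff m1 maff); exact: measurable_itv.
Qed.

Lemma fixed_first : {ae mu, forall x, b <= x <= a ->
  (q, K).1 x = (W a (q, K)).1 x + (free_term a d).1 x}.
Proof.
have [b0 ltba a1] := ba; have [mq qp Kk] := he; have [d1E d2E m1 m2] := hd.
have [[ck bk] [mp bp] p0 kodd [wk kd]] := hp.
have a01 : 0 < a <= 1 by rewrite a1 andbT; lra.
have F := first_equation ck bk mp bp p0 kodd wk kd a01 d1E d2E.
(* The first equation is available for 0 < x < a; the end points 0 and a are discarded as null
   sets. *)
apply: (aeS2 F (aeS2 qp (aeS2 (ae_neq 0) (ae_neq a) (fun x h1 h2 => conj h1 h2))
  (fun x h1 h2 => conj h1 h2))) => x h1 [h2 [x0 xa]] bxa.
have [mU _ _ _] := bounded_state_pair.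
rewrite (W1E ba borel_rep_pair mU bxa) /line_integral -(int_itv (fun s => p s * k s (2 * x - s))).
case/andP : bxa => bx xa'; have x0' : 0 <= x by lra.
rewrite [LHS]h2// h1; first by rewrite addrC.
by rewrite !lt_neqAle eq_sym x0 x0' xa xa'.
Qed.

Lemma fixed_second x y : b <= x <= a -> `|y| <= x ->
  (q, K).2 x y = (W a (q, K)).2 x y + (free_term a d).2 x y.
Proof.
move=> bxa yx; have [b0 ltba a1] := ba; have [mq qp Kk] := he; have [d1E d2E m1 m2] := hd.
have [[ck bk] [mp bp] p0 kodd [wk kd]] := hp.
have a01 : 0 < a <= 1 by rewrite a1 andbT; lra.
have [mU _ _ _] := bounded_state_pair; rewrite (W2E ba borel_rep_pair mU bxa yx).
case/andP : bxa => bx xa; rewrite [LHS]Kk//; last lra.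
rewrite (second_equation ck bk mp bp p0 kodd wk kd a01 d1E d2E m1 yx xa) addrC//.
Qed.

Lemma step_converges (r rt : R) : (L_norm b a (free_term a d) <= r%:E)%E -> r < rt ->
  a - mu_step r rt < b ->
  converges_in_L b a (iterates a d) (q, K) /\ geometric_rate_in_L b a (iterates a d) (q, K).
Proof.
move=> nr rrt hb; apply: (@iteration _ _ _ ba (free_term a d) _ C C r rt) => //.
- exact: bounded_state_pair.
- exact: free_term_measurable.
- exact: fixed_first.
- exact: fixed_second.
- by rewrite ltrBlDr -ltrBlDl.
Qed.

(** The free term is read backwards from the fixed-point equation as (q, K) - W (q, K), so no
    derivative of the data has to be estimated. The components contribute C + 2 C^2 and C + C^2,
    independently of the line. *)
Lemma free_term_norm : (L_norm b a (free_term a d) <= (2 * C + 3 * (C * C))%:E)%E.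
Proof.
have [b0 ltba a1] := ba; have [_ _ b1 b2] := bounded_state_pair.
have [_ _ w1 w2] := bounded_state_W ba C0 C0 bounded_state_pair.
have CC : 0 <= C * C by exact: mulr_ge0.
have e1 : 2 * (a - b) * (C * C) <= 2 * (C * C) by rewrite ler_wpM2r//; lra.
have e2 : 2^-1 * (a - b) ^+ 2 * (C * C) <= C * C.
  rewrite ler_piMl// (_ : _ * _ ^+ 2 = (a - b) * ((a - b) * 2^-1)); last by ring.
  by apply: mulr_ile1; lra.
rewrite (_ : _ + _ = (C + 2 * (C * C)) + (C + C * C)); last by ring.
rewrite EFinD; apply: leeD.
  apply: ess_norm_le; first by rewrite addr_ge0// mulr_ge0.
  apply: (aeS2 fixed_first (aeS2 b1 w1 (fun x h1 h2 => conj h1 h2))) => x e [h1 h2] bxa.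
  rewrite (_ : (free_term a d).1 x = (q, K).1 x - (W a (q, K)).1 x); last by rewrite e// addrC addKr.
  by rewrite (le_trans (ler_normB _ _))// lerD ?h1// (le_trans (h2 bxa)).
apply: ge_ereal_sup => _ [[x y] [bxa yx] <-]; rewrite lee_fin.
rewrite (_ : (free_term a d).2 _ _ = (q, K).2 x y - (W a (q, K)).2 x y); last first.
  by rewrite fixed_second// addrC addKr.
by rewrite (le_trans (ler_normB _ _))// lerD ?b2// (le_trans (w2 _ _ bxa yx)).
Qed.
End one_step.
End lines.

(** * Uniqueness of the fixed point *)

Section unique.
Variable R : realType.
Notation mu := (@lebesgue_measure R).

Lemma le_geometric0 (x A : R) : 0 <= x -> (forall n, x <= A / 2 ^+ n) -> x = 0.
Proof.
move=> x0 h; apply/eqP; rewrite eq_le x0 andbT leNgt; apply/negP => xp.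
have : (geometric A 2^-1) @ \oo --> (0 : R).
  by apply: cvg_geometric; rewrite ger0_norm ?invr_ge0// invf_lt1// ltr1n.
move=> /cvgrPdist_lt /(_ _ xp) [n _ /(_ n (leqnn n))]; rewrite sub0r normrN /= exprVn => hn.
by have := le_lt_trans (le_trans (h n) (ler_norm _)) hn; rewrite ltxx.
Qed.

(** The weighted distance of two bounded fixed points with the same h is finite, and [W_halves]
    bounds it by half of itself, again and again. Both solutions are fixed, so no ball has to be
    preserved. *)
Lemma fixed_point_unique (b a P k P' k' : R) (V V' h : state R) :
  [/\ 0 <= b, b < a & a <= 1] -> 0 <= P -> 0 <= k -> 0 <= P' -> 0 <= k' ->
  bounded_state b a P k V -> bounded_state b a P' k' V' ->
  {ae mu, forall x, b <= x <= a -> V.1 x = (W a V).1 x + h.1 x} ->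
  (forall x y, b <= x <= a -> `|y| <= x -> V.2 x y = (W a V).2 x y + h.2 x y) ->
  {ae mu, forall x, b <= x <= a -> V'.1 x = (W a V').1 x + h.1 x} ->
  (forall x y, b <= x <= a -> `|y| <= x -> V'.2 x y = (W a V').2 x y + h.2 x y) ->
  {ae mu, forall x, b <= x <= a -> V.1 x = V'.1 x}.
Proof.
move=> ba P0 k0 P0' k0' g g' e1 e2 e1' e2'; have [b0 ltba a1] := ba.
(* The summand 1 makes M positive even when P and k' are 0. *)
pose M := P + k' + 1; have M0 : 0 < M by rewrite ltr_wpDl// addr_ge0.
have PM : P + k' <= M by rewrite lerDl.
pose w x := expR (4 * M * (a - x)).
have w1 x : x <= a -> 1 <= w x.
  by move=> xa; rewrite -expR0 ler_expR mulr_ge0// ?subr_ge0// mulr_ge0// ltW.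
pose E := P + P' + (k + k').
have cl n : weighted_close b a (E / 2 ^+ n) w V V'.
  elim: n => [|n IH].
    have [_ _ b1 b2] := g; have [_ _ b1' b2'] := g'; rewrite expr0 divr1; split.
      apply: (aeS2 b1 b1') => x h1 h1' xab; have /andP[bx xa] := xab.
      rewrite (le_trans (ler_normB _ _))//; apply: (@le_trans _ _ (P + P')); first by rewrite lerD ?h1 ?h1'.
      rewrite -[P + P']mulr1 ler_pM ?addr_ge0 ?w1// lerDl addr_ge0//.
    move=> x y xab yx; have /andP[bx xa] := xab.
    rewrite (le_trans (ler_normB _ _))//; apply: (@le_trans _ _ (k + k')); first by rewrite lerD ?b2 ?b2'.
    rewrite -[k + k']mulr1 ler_pM ?addr_ge0 ?w1// lerDr addr_ge0//.
  have En : 0 <= E / 2 ^+ n by rewrite divr_ge0 ?exprn_ge0// !addr_ge0.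
  have [c1 c2] := W_halves ba P0 k0 P0' k0' g g' PM M0 En IH.
  rewrite exprSr invfM mulrA.
  have cancel (x y z : R) : x + z - (y + z) = x - y by ring.
  split.
    apply: (aeS2 c1 (aeS2 e1 e1' (fun x h1 h2 => conj h1 h2))) => x hc [hx hx'] xab.
    by rewrite hx// hx'// cancel hc.
  by move=> x y xab yx; rewrite e2// e2'// cancel c2.
(* The exceptional null sets of the countably many estimates are united before n tends to
   infinity. *)
have : {ae mu, forall x, forall n, b <= x <= a -> `|V.1 x - V'.1 x| <= E / 2 ^+ n * w x}.
  by apply/ae_foralln => n; have [] := cl n.
move=> H; apply: (aeS H) => x hx xab; apply/eqP; rewrite -subr_eq0 -normr_eq0; apply/eqP.
apply: (@le_geometric0 _ (E * w x)) => // n.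
by rewrite (le_trans (hx n xab))// mulrAC.
Qed.
End unique.

(** * Reconstruction and uniqueness *)

Section main.
Variable R : realType.
Notation mu := (@lebesgue_measure R).

(** The given data agree only for 0 <= y <= 1, while a line carries data for |y| <= 1. Both k(1, y)
    and the difference of densities at 1 + y and 1 - y are odd in y, which settles the negative
    half. The data of one kernel then serve as data for the other, so both pairs have the same free
    term. *)
Lemma line_data_transfer (C C' : R) p k p' k' (d d' : data R) :
  kernel_pair C p k -> kernel_pair C' p' k' -> line_data p k 1 d -> line_data p' k' 1 d' ->
  (forall y : R, 0 <= y <= 1 -> k' 1 y = k 1 y) ->
  {ae mu, forall y : R, 0 <= y <= 1 -> d'.2 y = d.2 y} ->
  line_data p' k' 1 d.
Proof.
move=> [_ _ _ odd _] [_ _ _ odd' _] [d1 d2 m1 m2] [d1' d2' m1' m2'] kk dd; split => //.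
  move=> y y1; rewrite d1//; move: y1; rewrite ler_norml => /andP[y1 y2].
  have [y0|y0] := leP 0 y; first by rewrite kk ?y0.
  by rewrite -[y]opprK odd odd' kk//; apply/andP; split; lra.
pose D p k (y : R) := gam p k 1 (1 + y) - gam p k 1 (1 - y).
have Dodd P K (y : R) : D P K (- y) = - D P K y by rewrite /D opprK opprB.
have E : {ae mu, forall y : R, 0 <= y < 1 -> D p k y = D p' k' y}.
  apply: (aeS2 dd (aeS2 d2 d2' (fun x h1 h2 => conj h1 h2))) => y h [h1 h2] /andP[y0 y1].
  have ya : `|y| < 1 by rewrite ger0_norm.
  by rewrite /D -h1// -h2// h// y0 ltW.
apply: (aeS2 d2 (aeS2 E (ae_opp E) (fun x h1 h2 => conj h1 h2))) => y h [h1 h2] ya.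
rewrite h// -[LHS]/(D p k y) -[RHS]/(D p' k' y).
move: ya; rewrite ltr_norml => /andP[y1 y2]; have [y0|y0] := leP 0 y; first by rewrite h1 ?y0.
by apply: oppr_inj; rewrite -!Dodd h2//; apply/andP; split; lra.
Qed.

Lemma mu_step_gt0 (r rt : R) : r < rt -> 0 < rt -> 0 < mu_step r rt.
Proof.
by move=> h rt0; rewrite lt_min !divr_gt0 ?mulr_gt0 ?exprn_gt0 ?subr_gt0.
Qed.

Lemma process_reconstructs (q : R -> R) (K : R -> R -> R) (C : R) p k :
  0 <= C -> kernel_pair C p k -> extends q K p k -> reconstructs (cauchy_data K 1) q.
Proof.
(* r is the bound of [free_term_norm], valid on every line, so one value of [mu_step] serves all
   steps; rt may be any number above r. *)
move=> C0 hp he; pose r := 2 * C + 3 * (C * C); pose rt := r + 1.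
have r0 : 0 <= r by rewrite addr_ge0// !mulr_ge0.
have rrt : r < rt by rewrite ltrDl.
have mu0 : 0 < mu_step r rt by apply: mu_step_gt0 => //; exact: le_lt_trans rrt.
have [m] := ltr_add_invr mu0; rewrite add0r => hm.
pose x (j : nat) : R := 1 - j%:R / m.+1%:R.
have xS j : x j - x j.+1 = m.+1%:R^-1 by rewrite /x -natr1; ring.
have m0 : 0 < (m.+1%:R : R)^-1 by rewrite invr_gt0.
exists m.+1, x, (fun=> (q, K)); split; [by rewrite /x mul0r subr0|by rewrite /x divff ?subrr// pnatr_eq0|].
move=> j jm.
have bj : 0 <= x j.+1 by rewrite subr_ge0 ler_pdivrMr// mul1r ler_nat.
have aj : x j <= 1 by rewrite gerBl divr_ge0.
have ltx : x j.+1 < x j by rewrite -subr_gt0 xS.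
have ba : [/\ 0 <= x j.+1, x j.+1 < x j & x j <= 1] by [].
set d := step_data _ _ _ _; have hd : line_data p k (x j) d.
  have x01 : 0 < x j <= 1 by rewrite aj andbT; exact: le_lt_trans ltx.
  (* The first line carries the given two-sided data. On later lines the limit of the preceding step
     determines K only for x >= x j, so right-hand difference quotients are used. *)
  rewrite /d; case: j x01 {jm bj aj ltx ba d} => [|i] x01; last exact: (right_line_data hp he x01).
  by have := cauchy_line_data hp he x01; rewrite /step_data /x mul0r subr0.
have nr := free_term_norm hp he C0 ba hd.
have step : x j - mu_step r rt < x j.+1 by rewrite ltrBlDl -ltrBlDr xS.
split; last exact: aeW.
- by exists r, rt; split => //; rewrite step.
- by have [cv _] := step_converges hp he C0 ba hd nr rrt step; exact: cv.
Qed.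
End main.

Theorem theorem10p1 (R : realType) (q : R -> R) (K : R -> R -> R)
  (hq : admissible_potential q) (hK : transformation_kernel q K) :
  (forall r rt x0 : R,
     0 < x0 ->
     (L_norm x0 1 (free_term 1 (cauchy_data K 1)) <= r%:E)%E ->
     r < rt ->
     1 - mu_step r rt < x0 < 1 ->
     [/\ converges_in_L x0 1 (iterates 1 (cauchy_data K 1)) (q, K),
         geometric_rate_in_L x0 1 (iterates 1 (cauchy_data K 1)) (q, K)
       & forall r0 rt0 x1 : R,
           0 < x1 ->
           (L_norm x1 x0 (free_term x0 (cauchy_data K x0)) <= r0%:E)%E ->
           r0 < rt0 ->
           x0 - mu_step r0 rt0 < x1 < x0 ->
           converges_in_L x1 x0 (iterates x0 (cauchy_data K x0)) (q, K)]) /\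
  reconstructs (cauchy_data K 1) q /\
  (forall (q' : R -> R) (K' : R -> R -> R),
     admissible_potential q' -> transformation_kernel q' K' ->
     (forall y : R, 0 <= y <= 1 -> K' 1 y = K 1 y) ->
     {ae (@lebesgue_measure R), forall y : R, 0 <= y <= 1 ->
        derive1 (K'^~ y) 1 = derive1 (K^~ y) 1} ->
     {ae (@lebesgue_measure R), forall x : R, 0 <= x <= 1 -> q' x = q x}).
Proof.
have [C [p [k [C0 hp he]]]] := reduction hq hK.
have l01 : 0 < (1 : R) <= 1 by rewrite ltr01 lexx.
split; last split.
- move=> r rt x0 x00 nr rrt /andP[h1 h2].
  have ba : [/\ 0 <= x0, x0 < 1 & 1 <= (1 : R)] by split => //; exact: ltW.
  have [cv gr] := step_converges hp he C0 ba (cauchy_line_data hp he l01) nr rrt h1.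
  split; [exact: cv|exact: gr|move=> r0 rt0 x1 x10 nr0 rrt0 /andP[h3 h4]].
  have ba' : [/\ 0 <= x1, x1 < x0 & x0 <= 1] by split => //; exact: ltW.
  have x01 : 0 < x0 <= 1 by rewrite x00 ltW.
  have [cv' _] := step_converges hp he C0 ba' (cauchy_line_data hp he x01) nr0 rrt0 h3.
  exact: cv'.
- exact: process_reconstructs C0 hp he.
- move=> q' K' hq' hK' KK dKK.
  have [C' [p' [k' [C0' hp' he']]]] := reduction hq' hK'.
  have [[_ _ Kk] [_ _ Kk']] := (he, he').
  have ba : [/\ 0 <= (0 : R), 0 < (1 : R) & 1 <= (1 : R)] by [].
  have hd := cauchy_line_data hp he l01.
  (* The data of K are used for K' as well; this makes (q', K') a fixed point of the very map that
     fixes (q, K), on the whole interval from 0 to 1. *)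
  have hd' : line_data p' k' 1 (cauchy_data K 1).
    apply: (line_data_transfer hp hp' hd (cauchy_line_data hp' he' l01)) => // y /andP[y0 y1].
    have yy : `|y| <= 1 by rewrite ger0_norm.
    by rewrite -Kk ?ler1n// -Kk' ?ler1n// KK// y0.
  apply: (fixed_point_unique ba C0' C0' C0 C0 (bounded_state_pair hp' he' ba) (bounded_state_pair hp he ba)
    (fixed_first hp' he' ba hd') _ (fixed_first hp he ba hd)).
    by move=> x y; exact: (fixed_second hp' he' ba hd').
  by move=> x y; exact: (fixed_second hp he ba hd).
Qed.
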